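(* Let $B_1,B_2$ be Banach spaces, $R>0$, $r\in(1,\infty]$, $\kappa>2$, and assume that $D_{3\kappa R}<\infty$. Let $E$ be a $\mu$-measurable subset of $X$ with $\operatorname{diam}(E)<R$, let $$T\colon \chi_{B(E,R/2)}L^r(\mu;B_1)\to \chi_E L^r(\mu;B_2)$$ be a continuous linear mapping, and let $K\colon E\times B(E,R/2)\to \mathcal{L}(B_1;B_2)$ be a $(\mu\otimes\mu)$-measurable map. Assume that there are constants $A_R>0$ and $C_R>0$ such that the following hold: (i) for every open subset $F$ of $B(E,R/2)$, $K$ is $(\mu\otimes\mu)$-integrable on $(E\setminus F)\times F$, and $$(Tf)(x)=\int_F K(x,y)f(y)\,\mathrm{d}\mu(y)$$ for $\mu$-almost every $x\in E\setminus F$ and for every $f\in\chi_F L^\infty(\mu;B_1)$; (ii) $\|Tf\|_{L^r(\mu;B_2)}\leq A_R\|f\|_{L^r(\mu;B_1)}$ for every $f\in\chi_{B(E,R/2)}L^r(\mu;B_1)$; (iii) for $\mu$-almost every $y,y'\in B(E,R/2)$ with $d(y,y')<R$, $$\int_{E\setminus B(y,2d(y,y'))}|K(x,y)-K(x,y')|\,\mathrm{d}\mu(x)\leq C_R.$$ Then $$\|Tf\|_{L^p(\mu;B_2)}\leq 16\,\phi(r,p)\,(D_{3\kappa R}^9A_R+C_R)\,\|f\|_{L^p(\mu;B_1)}$$ for every $p\in(1,r]$ and for every $f\in\chi_E L^r(\mu;B_1)$.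
   Context: $(X,d)$ is a locally compact, connected metric space, endowed with a non-zero positive inner regular Radon measure $\mu$ such that $\operatorname{Supp}\mu=X$. That is, $\mu$ is a Borel measure such that $\mu(B)=\sup\{\mu(K): K\subseteq B \text{ compact}\}$ for every Borel set $B$, and every point has an open neighbourhood of finite measure (equivalently, compact sets have finite measure). $\mu$ is not assumed $\sigma$-finite. A set $E\subseteq X$ is $\mu$-measurable if for every compact $K\subseteq X$ there are Borel sets $B,N$ with $B\subseteq E\cap K\subseteq B\cup N$ and $\mu(N)=0$; $\mu$ is extended to such sets. Balls: $B(x,r)=\{y\in X: d(x,y)<r\}$; for a set $E$, $B(E,r)=\{y\in X: d(y,E)<r\}$. For $R>0$, $D_R$ is the least element of $[1,+\infty]$ such that $\mu(B(x,2r))\leq D_R\,\mu(B(x,r))$ for every $x\in X$ and every $r\in(0,R]$. A function $f\colon X\to B$ into a Banach space is $\mu$-measurable if for every compact $K\subseteq X$ and every $\varepsilon>0$ there is a compact $K'\subseteq K$ with $\mu(K\setminus K')<\varepsilon$ such that $f|_{K'}$ is continuous (strong measurability; integrals are Bochner integrals). $(\mu\otimes\mu)$-measurability of Banach-valued maps is likewise strong measurability. $L^p(\mu;B)$ is the corresponding Bochner–Lebesgue space. $\chi_E$ is the characteristic function of $E$, and $\chi_E L^p(\mu;B)=\{\chi_E f: f\in L^p(\mu;B)\}$. $\mathcal{L}(B_1;B_2)$ is the space of continuous linear maps $B_1\to B_2$ with the operator norm; $|\cdot|$ denotes the norm of the relevant Banach space. $p'$ denotes the conjugate exponent of $p$.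 For $p\in(1,r]$, $$\phi(r,p)=\inf_{q\in(1,p)}\left(q'+\frac{1}{r/q-1}\right)^{(1/p-1/r)/(1-q/r)},$$ with the usual conventions when $r=\infty$ (i.e. $1/(r/q-1)=0$, $1/r=0$, $q/r=0$). *)

(* Defs.v *)
From HB Require Import structures.
From mathcomp Require Import all_boot all_order all_algebra.
From mathcomp Require Import all_classical all_reals all_analysis.
Set Implicit Arguments.
Unset Strict Implicit.
Unset Printing Implicit Defensive.
Import Order.TTheory GRing.Theory Num.Theory.
Import numFieldNormedType.Exports.
Local Open Scope classical_set_scope.
Local Open Scope ring_scope.

(* Measurable types are pointed in the library, hence so are the metric spaces
   below; a space carrying a non-zero measure is non-empty anyway. *)
#[short(type="pmetricType")]
HB.structure Definition PointedMetric (K : numDomainType) :=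
  {M of Metric K M & isPointed M}.

Section metric_defs.
Context {R : realType} {X : pmetricType R}.
Local Open Scope ereal_scope.
Implicit Types (x : X) (A : set X).

Definition dist_set x A : \bar R := ereal_inf [set (mdist x a)%:E | a in A].

(* B(A, r) *)
Definition set_ball A (r : R) : set X := [set y | dist_set y A < r%:E].

(* sup set0 = -oo: the empty set has diameter less than every positive r. *)
Definition diameter A : \bar R :=
  ereal_sup [set (mdist z.1 z.2)%:E | z in A `*` A].

End metric_defs.

Definition borelType {R : realType} (X : pmetricType R) : Type :=
  g_sigma_algebraType (@open X).
HB.instance Definition _ (R : realType) (X : pmetricType R) :=
  Measurable.on (borelType X).

(* Not assumed sigma-finite. *)
Record radon_measure (R : realType) (X : pmetricType R) := RadonMeasure {
  radon_borel :> {measure set (borelType X) -> \bar R} ;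
  radon_inner_regular : forall B : set (borelType X), measurable B ->
    radon_borel B =
    ereal_sup [set radon_borel C | C in [set C : set X | compact C /\ C `<=` B]] ;
  radon_locally_finite : forall x : X,
    exists U : set X, [/\ open U, U x & (radon_borel U < +oo)%E] }.

Section radon_completion.
Context {R : realType} {X : pmetricType R} (mu : radon_measure X).
Local Open Scope ereal_scope.

Definition radon_measurable (A : set X) : Prop :=
  forall C : set X, compact C -> exists B N : set (borelType X),
    [/\ measurable B, measurable N, mu N = 0, B `<=` A `&` C &
        A `&` C `<=` B `|` N].

Lemma compact_borel (C : set X) : compact C -> measurable (C : set (borelType X)).
Proof.
move=> cC; rewrite -[C]setCK; apply: measurableC.
apply: sub_sigma_algebra; apply: closed_openC.
exact: (compact_closed (@metric_hausdorff R X) cC).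
Qed.

Lemma radon_measurable0 : radon_measurable set0.
Proof.
by move=> C cC; exists set0, set0; split => //; rewrite ?measure0 ?set0I// set0U.
Qed.

Lemma radon_measurableC (A : set X) :
  radon_measurable A -> radon_measurable (~` A).
Proof.
move=> mA C cC; have [B [N [mB mN N0 BA AB]]] := mA C cC.
exists (C `\` (B `|` N)), N; split => //.
- by apply: measurableD; [exact: compact_borel|exact: measurableU].
- move=> x [Cx /not_orP[nBx nNx]]; split => // Ax.
  by have [] := AB x (conj Ax Cx).
- move=> x [nAx Cx]; have [Nx|nNx] := pselect (N x); first by right.
  by left; split => // -[/BA[]|].
Qed.

Lemma radon_measurable_bigcup (F : (set X)^nat) :
  (forall i, radon_measurable (F i)) -> radon_measurable (\bigcup_i F i).
Proof.
move=> mF C cC.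
have /choice[b /choice[n bn]] := fun i => mF i C cC.
exists (\bigcup_i b i), (\bigcup_i n i); split.
- by apply: bigcupT_measurable => i; have [] := bn i.
- by apply: bigcupT_measurable => i; have [] := bn i.
- apply/eqP; rewrite eq_le measure_ge0 andbT.
  have mn i : measurable (n i) by have [] := bn i.
  apply: (le_trans (measure_sigma_subadditive mu mn _ (@subset_refl _ _))).
    exact: bigcupT_measurable.
  by rewrite eseries0// => i _ _; have [] := bn i.
- move=> x [i _ bx]; have [_ _ _ /(_ x bx)[Fx Cx] _] := bn i.
  by split => //; exists i.
- move=> x [[i _ Fx] Cx]; have [_ _ _ _ /(_ x (conj Fx Cx))[bx|nx]] := bn i.
    by left; exists i.
  by right; exists i.
Qed.

End radon_completion.

Fact radon_display : measure_display. Proof. exact: default_measure_display. Qed.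

(* X with the sigma-algebra of mu-measurable sets *)
Definition radonType {R : realType} {X : pmetricType R}
  (mu : radon_measure X) : Type := X.

Section radonType_instances.
Context {R : realType} {X : pmetricType R} (mu : radon_measure X).

HB.instance Definition _ := PointedMetric.on (radonType mu).
HB.instance Definition _ := @isMeasurable.Build radon_display (radonType mu)
  (radon_measurable mu) (radon_measurable0 mu) (@radon_measurableC _ _ mu)
  (@radon_measurable_bigcup _ _ mu).

End radonType_instances.

Section radon_ext.
Context {R : realType} {X : pmetricType R} (mu : radon_measure X).
Local Open Scope ereal_scope.

Lemma borel_radon (B : set X) : measurable (B : set (borelType X)) ->
  measurable (B : set (radonType mu)).
Proof.
move=> mB; suff : radon_measurable mu B by [].
move=> C cC; exists (B `&` C), set0; split; rewrite ?measure0 ?setU0//.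
by apply: measurableI => //; exact: compact_borel.
Qed.

(* The extension of mu to the mu-measurable sets, by inner regularity. *)
Definition radon_ext (A : set (radonType mu)) : \bar R :=
  ereal_sup [set mu C | C in [set C : set X | compact C /\ C `<=` A]].

Lemma radon_extE (B : set X) :
  measurable (B : set (borelType X)) -> radon_ext B = mu B.
Proof. by move=> mB; rewrite (radon_inner_regular _ mB). Qed.

Let radon_ext_ge0 A : 0 <= radon_ext A.
Proof.
apply: ereal_sup_ubound; exists set0; last by rewrite measure0.
by split; [exact: compact0|].
Qed.

Let radon_ext0 : radon_ext set0 = 0.
Proof. by rewrite radon_extE ?measure0. Qed.

Let le_radon_ext (A B : set X) : A `<=` B -> radon_ext A <= radon_ext B.
Proof.
move=> AB; apply: ereal_sup_le => _ [C [cC CA] <-].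
by exists C => //; split => //; exact: subset_trans AB.
Qed.

Let radon_extU (A B : set X) : [disjoint A & B] ->
  radon_ext A + radon_ext B <= radon_ext (A `|` B).
Proof.
move=> AB; set M := radon_ext (A `|` B).
have MCD C D : compact C -> compact D -> C `<=` A -> D `<=` B -> mu C + mu D <= M.
  move=> cC cD CA DB; rewrite -measureU; [|exact: compact_borel|exact: compact_borel|].
    apply: ereal_sup_ubound; exists (C `|` D) => //; split.
      exact: compactU.
    exact: setUSS.
  by apply: subsetI_eq0 CA DB _; exact/disj_set2P.
have [->|Mfin] := eqVneq M +oo; first by rewrite leey.
have {}Mfin : M \is a fin_num by rewrite ge0_fin_numE ?radon_ext_ge0// ltey.
have lt C D : compact C -> compact D -> C `<=` A -> D `<=` B ->
    (mu C \is a fin_num) && (mu D \is a fin_num).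
  move=> cC cD CA DB; have := MCD C D cC cD CA DB => h.
  rewrite !ge0_fin_numE//; apply/andP; split;
    apply: (@le_lt_trans _ _ M); rewrite -?ge0_fin_numE ?radon_ext_ge0//;
    apply: le_trans h; [exact: leeDl|exact: leeDr].
have supA D : compact D -> D `<=` B -> radon_ext A <= M - mu D.
  move=> cD DB; apply: ge_ereal_sup => _ [C [cC CA] <-].
  have /andP[_ fD] := lt _ _ cC cD CA DB.
  by rewrite leeBrDr//; exact: MCD.
have fA : radon_ext A \is a fin_num.
  have := supA set0 compact0 (@sub0set _ _); rewrite measure0 sube0 => h.
  rewrite ge0_fin_numE ?radon_ext_ge0//; apply: (le_lt_trans h).
  by rewrite -ge0_fin_numE// radon_ext_ge0.
rewrite addeC -leeBrDr//; apply: ge_ereal_sup => _ [D [cD DB] <-].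
rewrite leeBrDr// addeC -leeBrDr ?supA//.
by have /andP[] := lt set0 D compact0 cD (@sub0set _ _) DB.
Qed.

Let radon_ext_sigma_additive : semi_sigma_additive radon_ext.
Proof.
move=> F mF tF mUF.
have nd : cvgn (fun n => \sum_(0 <= i < n) radon_ext (F i)).
  by apply: is_cvg_ereal_nneg_natsum => i _; exact: radon_ext_ge0.
suff -> : radon_ext (\bigcup_i F i) = \sum_(0 <= i <oo) radon_ext (F i) by [].
apply/eqP; rewrite eq_le; apply/andP; split.
  apply: ge_ereal_sup => _ [C [cC CF] <-].
  have mF' i : radon_measurable mu (F i) := mF i.
  have /choice[b /choice[n bn]] := fun i => mF' i C cC.
  have mb i : measurable (b i) by have [] := bn i.
  have mn i : measurable (n i) by have [] := bn i.
  have mbn i : measurable (b i `|` n i) by exact: measurableU.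
  apply: (@le_trans _ _ (\sum_(0 <= i <oo) mu (b i `|` n i))).
    apply: measure_sigma_subadditive => //; first exact: compact_borel.
    move=> x Cx; have [i _ Fx] := CF x Cx; exists i => //.
    by have [_ _ _ _] := bn i; apply.
  apply: lee_nneseries => [|i _]; first by move=> i _ _; exact: measure_ge0.
  apply: (@le_trans _ _ (mu (b i))).
    have := @measureU2 _ _ _ (radon_borel mu) _ _ (mb i) (mn i).
    have n0 : mu (n i) = 0 by have [] := bn i.
    by rewrite [X in _ <= _ + X]n0 adde0.
  rewrite -radon_extE//; apply: le_radon_ext => x bx.
  by have [_ _ _ /(_ x bx)[]] := bn i.
apply: lime_le => //; apply: nearW => n.
apply: (@le_trans _ _ (radon_ext (\big[setU/set0]_(i < n) F i))); last first.
  by apply: le_radon_ext; rewrite -bigcup_mkord; exact: bigcup_subset.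
elim: n => [|n ih]; first by rewrite big_nil big_ord0 radon_ext0.
rewrite big_nat_recr//= big_ord_recr/=.
apply: le_trans (radon_extU _); first exact: leeD.
apply/disj_set2P; rewrite -bigcup_mkord setI_bigcupl.
apply: bigcup0 => i /= iltn.
by move/trivIsetP : tF => /(_ i n I I); apply; rewrite neq_ltn iltn.
Qed.

HB.instance Definition _ := isMeasure.Build radon_display (radonType mu) R
  radon_ext radon_ext0 radon_ext_ge0 radon_ext_sigma_additive.

End radon_ext.
Arguments radon_ext {R X} mu A.

Section operators.
Context {R : realType} (V W : normedModType R).

Definition linear_continuous_pred : {pred V -> W} :=
  [pred f | `[< linear f /\ continuous f >]].

Let lc_subproof : submod_closed linear_continuous_pred.
Proof.
split; first by apply/asboolP; split; [move=> a x y; rewrite scaler0 addr0|exact: cst_continuous].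
move=> a f g /asboolP[lf cf] /asboolP[lg cg]; apply/asboolP; split.
  move=> k x y; rewrite !fctE lf lg.
  by rewrite !scalerDr !scalerA [a * k]mulrC addrACA.
move=> x; apply: cvgD; last exact: cg.
by apply: cvgZl_tmp; exact: cf.
Qed.
HB.instance Definition _ :=
  GRing.isSubmodClosed.Build R (V -> W) linear_continuous_pred lc_subproof.

(* L(V; W) *)
Record cont_linear := ContLinear {
  cont_linear_fun :> V -> W ;
  cont_linearP : cont_linear_fun \in linear_continuous_pred }.

HB.instance Definition _ := [isSub for cont_linear_fun].
HB.instance Definition _ := [Choice of cont_linear by <:].
HB.instance Definition _ := [SubChoice_isSubLmodule of cont_linear by <:].

(* supremum of |f x| over the closed unit ball *)
Definition opnorm (f : cont_linear) : R :=
  sup [set `|f x| | x in [set x : V | `|x| <= 1]].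

Let cont_linear_linear (f : cont_linear) : linear f.
Proof. by have /asboolP[] := cont_linearP f. Qed.

Let cont_linear_scale (f : cont_linear) a x : f (a *: x) = a *: f x.
Proof.
have lf := cont_linear_linear f; have f0 : f 0 = 0.
  by have := lf (-1) 0 0; rewrite scaler0 addr0 scaleN1r addNr.
by have := lf a x 0; rewrite !addr0 f0 addr0.
Qed.

Let opnorm_has_sup (f : cont_linear) :
  has_sup [set `|f x| | x in [set x : V | `|x| <= 1]].
Proof.
have /asboolP[lf cf] := cont_linearP f; split.
  by exists `|f 0|, 0 => //=; rewrite normr0.
pose g : {linear V -> W} := HB.pack (f : V -> W)
  (GRing.isLinear.Build R V W *:%R (f : V -> W) lf).
have /linear_boundedP := (@linear_bounded_continuous R V W g).2 cf.
move=> /pinfty_ex_gt0[M M0 gM]; exists M => _ [x /= x1 <-].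
by rewrite (le_trans (gM x))// ler_piMr// ltW.
Qed.

Let opnorm_ub (f : cont_linear) x : `|x| <= 1 -> `|f x| <= opnorm f.
Proof.
by move=> x1; apply: ub_le_sup; [exact: (opnorm_has_sup f).2|exists x].
Qed.

Let opnorm_le (f : cont_linear) M :
  (forall x, `|x| <= 1 -> `|f x| <= M) -> opnorm f <= M.
Proof.
move=> fM; apply: ge_sup; first exact: (opnorm_has_sup f).1.
by move=> _ [x /= x1 <-]; exact: fM.
Qed.

Let opnormD f g : opnorm (f + g) <= opnorm f + opnorm g.
Proof.
apply: opnorm_le => x x1.
by rewrite (le_trans (ler_normD _ _))// lerD// opnorm_ub.
Qed.

Let opnormZ_le a f : opnorm (a *: f) <= `|a| * opnorm f.
Proof.
by apply: opnorm_le => x x1; rewrite normrZ ler_wpM2l// opnorm_ub.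
Qed.

Let opnormZ a f : opnorm (a *: f) = `|a| * opnorm f.
Proof.
apply/eqP; rewrite eq_le opnormZ_le/=.
have [->|a0] := eqVneq a 0.
  rewrite normr0 mul0r; apply: le_trans (opnorm_ub _ (x := 0) _) => //.
  by rewrite normr0.
rewrite -ler_pdivlMl ?normr_gt0// -normfV.
by apply: le_trans (opnormZ_le _ _); rewrite scalerA mulVf// scale1r.
Qed.

Let opnorm_eq0 f : opnorm f = 0 -> f = 0.
Proof.
move=> f0; apply: val_inj; apply/funext => x /=.
have f1 y : `|y| <= 1 -> f y = 0.
  by move=> /(opnorm_ub f); rewrite f0 normr_le0 => /eqP.
have [->|x0] := eqVneq x 0; first by apply: f1; rewrite normr0.
have : f (`|x|^-1 *: x) = 0.
  by apply: f1; rewrite normrZ normfV normr_id mulVf// normr_eq0.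
rewrite cont_linear_scale => /eqP; rewrite scaler_eq0 invr_eq0 normr_eq0.
by rewrite (negbTE x0) => /eqP.
Qed.

HB.instance Definition _ :=
  Lmodule_isNormed.Build R cont_linear opnormD opnormZ opnorm_eq0.

End operators.

Section strong_measurability.
Context {R : realType}.
Local Open Scope ereal_scope.

(* chi_A f. The library's f \_ A takes the value point, which need not be 0 in
   an abstract normed module. *)
Definition cutoff {T : Type} {V : lmodType R} (A : set T) (f : T -> V) : T -> V :=
  fun x => (\1_A x : R) *: f x.

(* Stated for a set function nu, because it is also used with the product
   mu \x mu, which the library equips with a measure structure only when the
   second factor is declared sigma-finite. *)
Definition strongly_measurable {T : topologicalType} {V : normedModType R}
    (nu : set T -> \bar R) (f : T -> V) : Prop :=
  forall C : set T, compact C -> forall e : R, (0 < e)%R ->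
    exists C' : set T, [/\ compact C', C' `<=` C, nu (C `\` C') < e%:E &
      {within C', continuous f}].

End strong_measurability.

Section radon_integral.
Context {R : realType} {X : pmetricType R} (mu : radon_measure X).
Local Open Scope ereal_scope.

Definition strongly_integrable {V : normedModType R} (A : set X) (f : X -> V) :=
  strongly_measurable (radon_ext mu) (cutoff A f) /\
  \int[radon_ext mu]_(x in A) `|f x|%:E < +oo.

(* mu (x) mu. It is a set function on the product of the two sigma-algebras of
   mu-measurable sets. A connected space with a finite doubling constant is
   separable and mu is then sigma-finite, so that it is a measure. *)
Definition radon_prod : set (X * X) -> \bar R :=
  (radon_ext mu \x radon_ext mu).

Definition prod_strongly_measurable {V : normedModType R} (A : set (X * X))
    (f : X * X -> V) := strongly_measurable radon_prod (cutoff A f).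

Definition prod_strongly_integrable {V : normedModType R} (A : set (X * X))
    (f : X * X -> V) :=
  prod_strongly_measurable A f /\
  \int[(radon_ext mu \x radon_ext mu)]_(z in A) `|f z|%:E < +oo.

Definition integrable_step {V : normedModType R} (s : X -> V) : Prop :=
  finite_set (range s) /\
  forall v : V, measurable (s @^-1` [set v] : set (radonType mu)) /\
    (v != 0%R -> radon_ext mu (s @^-1` [set v]) < +oo).

(* The term v = 0, where the measure may be infinite, vanishes. *)
Definition step_integral {V : normedModType R} (s : X -> V) : V :=
  (\sum_(v \in range s) fine (radon_ext mu (s @^-1` [set v])) *: v)%R.

(* f is Bochner integrable on A and its integral over A is v. *)
Definition bochner_integral_eq {V : normedModType R} (A : set X) (f : X -> V)
    (v : V) : Prop :=
  strongly_integrable A f /\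
  exists s : (X -> V)^nat, [/\ forall n, integrable_step (s n),
    (fun n => \int[radon_ext mu]_x `|cutoff A f x - s n x|%:E) @ \oo --> 0 &
    (fun n => step_integral (s n)) @ \oo --> v].

End radon_integral.

Section Lebesgue_Bochner_spaces.
Context {R : realType} {X : pmetricType R} (mu : radon_measure X).
Local Open Scope ereal_scope.

Definition Lp_norm {V : normedModType R} (p : \bar R) (f : X -> V) : \bar R :=
  Lnorm (radon_ext mu) p (fun x => `|f x|%:E).

(* The spaces below consist of functions rather than of classes of functions
   modulo equality almost everywhere. *)
Definition Lp_space {V : normedModType R} (p : \bar R) : set (X -> V) :=
  [set f | strongly_measurable (radon_ext mu) f /\ Lp_norm p f < +oo].

(* chi_A L^p(mu; V) *)
Definition cut_Lp {V : normedModType R} (A : set X) (p : \bar R) :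
    set (X -> V) :=
  [set f | exists2 g, Lp_space p g & \forall x \ae radon_ext mu, f x = cutoff A g x].

(* T induces a continuous linear mapping from chi_A L^r(mu; V) to
   chi_A' L^r(mu; W), after passing to classes. *)
Definition continuous_linear_Lp {V W : normedModType R} (r : \bar R)
    (A A' : set X) (T : (X -> V) -> (X -> W)) : Prop :=
  [/\ (forall f, cut_Lp A r f -> cut_Lp A' r (T f)),
      (forall f g, cut_Lp A r f -> cut_Lp A r g ->
        (\forall x \ae radon_ext mu, f x = g x) ->
        \forall x \ae radon_ext mu, T f x = T g x),
      (forall (a : R) f g, cut_Lp A r f -> cut_Lp A r g ->
        \forall x \ae radon_ext mu,
          T (fun z => a *: f z + g z)%R x = (a *: T f x + T g x)%R) &
      (forall f, cut_Lp A r f -> forall e : R, (0 < e)%R ->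
        exists2 d : R, (0 < d)%R & forall g, cut_Lp A r g ->
          Lp_norm r (fun x => g x - f x)%R < d%:E ->
          Lp_norm r (fun x => T g x - T f x)%R < e%:E)].

Definition supp : set X :=
  [set x | forall U : set X, open U -> U x -> 0 < mu U].

(* D_rho. The infimum is attained when all balls have positive measure, so
   that 0 * +oo does not occur on the right-hand side. *)
Definition doubling_const (rho : R) : \bar R :=
  ereal_inf [set D | 1 <= D /\ forall (x : X) (s : R), (0 < s <= rho)%R ->
    mu (ball x (2 * s)) <= D * mu (ball x s)].

End Lebesgue_Bochner_spaces.

(* phi(r, p). With r = +oo, the library's arithmetic on \bar R gives r / q = +oo,
   (r / q - 1)^-1 = 0, r^-1 = 0 and q / r = 0. *)
Definition interp_phi {R : realType} (r p : \bar R) : \bar R :=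
  ereal_inf [set ((hoelder_conjugate q%:E + (r / q%:E - 1)^-1)
                    `^ fine ((p^-1 - r^-1) / (1 - q%:E / r)))%E |
             q in [set q : R | 1 < q /\ (q%:E < p)%E]].

(* Main.v *)
(** The operator is of weak type (1,1) on bounded functions supported in [E]. Fix
   a level [l] and decompose [f] at height [b = l / (2 A D)] along disjoint
   measurable sets [V i], obtained from balls of radius [rho / 2 ^ n] selected
   by a Vitali argument. The good part is bounded by [l / (2 A)] and is handled
   by the bound on [L^r]; the bad part has mean zero on each [V i] and is handled
   by Hormander's condition off the union of enlarged balls, comparing [K (x, y)]
   with [K (x, y_i)] for a point [y_i] of [V i] in general position. This gives
   [mu (l < |T f|) <= M / l * int |f|] with [M = 4 (D ^ 5 A + C)].

   Interpolation with the bound on [L^r] is then elementary. For [q < p], the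
   layer cake formula yields the bound [K (2 M) ^ q] for [int |T f| ^ q], where
   [K = q / (q - 1) + q / (r - q)]. Splitting [f] at all heights and integrating
   in [l] the truncated power [min (x ^ q, l ^ (q - r) x ^ r)] interpolates
   between [q] and [r]: after optimising the splitting height, the norm on [L^p]
   is at most [4 M K ^ e] with [e = (1/p - 1/r) / (1 - q/r)]. General functions
   are reached by truncation. *)
Require Import Defs.
From HB Require Import structures.
From mathcomp Require Import all_boot all_order all_algebra finmap.
From mathcomp Require Import all_classical all_reals all_analysis.
From mathcomp Require Import measurable_realfun ess_sup_inf ring lra.
Set Implicit Arguments.
Unset Strict Implicit.
Unset Printing Implicit Defensive.
Import Order.TTheory GRing.Theory Num.Theory.
Import numFieldNormedType.Exports.
Local Open Scope classical_set_scope.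
Local Open Scope ring_scope.
Local Open Scope ereal_scope.

(** * Strongly measurable functions *)

(** The measure is not assumed sigma-finite nor [X] separable. Everything therefore takes place in a
    ball [S] of radius [2 rho] about a point of [E], which doubling shows to have finite measure:
    disjoint balls of positive measure in [S] are countably many, and Tonelli's theorem is applied
    to the restriction of the measure to [S]. The kernel, strongly measurable on the product only,
    is used through countably many compact sets on which it is continuous and which exhaust its
    domain up to a null set.

    On the constants: enlarging balls [16] times, to clear the ball excluded in Hormander's
    condition, costs [D ^ 4]; one more [D] comes from the level [b], since averages over the [V i]
    are bounded by [D b], which must not exceed [l / (2 A)]. Doubling is required for radii up to
    [6 rho], which [kappa > 2] places below [3 kappa rho]. The final [16] is [4 * 4]: one [4] is in
    the weak type constant, and the other collects a factor [2] for each of the two occasions on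
    which [T f] is split into two halves. *)

Section radon_facts.
Context {R : realType} {X : pmetricType R} (mu : radon_measure X).
Local Notation m := (radon_ext mu).
Local Notation mble A := (measurable (A : set (radonType mu))).

Lemma open_radon (U : set X) : open U -> mble U.
Proof. by move=> oU; apply: borel_radon; exact: sub_sigma_algebra. Qed.

Lemma compact_radon (C : set X) : compact C -> mble C.
Proof. by move=> cC; apply: borel_radon; exact: compact_borel. Qed.

Lemma le_radon_ext (A B : set X) : A `<=` B -> m A <= m B.
Proof.
move=> AB; apply: ereal_sup_le => _ [C [cC CA] <-].
by exists C => //; split => //; exact: subset_trans AB.
Qed.

Lemma radon_extU_le (A B : set X) : mble A -> mble B ->
  m (A `|` B) <= m A + m B.
Proof. exact: (@measureU2 _ _ _ m). Qed.

Lemma compact_radon_lty (C : set X) : compact C -> m C < +oo.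
Proof.
move=> cC; have [U /all_and3[oU Ux fU]] := choice (radon_locally_finite mu).
have := cC; rewrite compact_cover => /(_ X setT U (fun i _ => oU i)) [].
  by move=> x Cx; exists x.
move=> s _ Cs.
have [D fD CD] : exists2 D : set X, finite_set D & C `<=` \bigcup_(i in D) U i.
  exact: (ex_intro2 _ _ _ (finite_fset s) Cs).
have h := @content_sub_fsum _ _ _ m X D (C : set (radonType mu)) U fD.
apply: le_lt_trans (h _ _ CD) _.
- by move=> i _; exact: open_radon.
- exact: compact_radon.
rewrite fsbig_finite//=.
rewrite lte_sum_pinfty// => i _.
by rewrite radon_extE//; exact: sub_sigma_algebra.
Qed.

Lemma radon_inner (A : set X) (e : R) : mble A -> m A < +oo -> (0 < e)%R ->
  exists C : set X, [/\ compact C, C `<=` A & m (A `\` C) < e%:E].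
Proof.
move=> mA Aoo e0.
have fA : m A \is a fin_num by rewrite ge0_fin_numE.
have [_ [C [cC CA] <-] h] := ub_ereal_sup_adherent e0 fA.
exists C; split => //; have mC := compact_radon cC.
rewrite (measureD mA mC Aoo) setIidr//.
have fC : m C \is a fin_num by rewrite ge0_fin_numE// compact_radon_lty.
rewrite lteBlDl// addeC -lteBlDl//.
suff : m A - e%:E < m C by [].
by rewrite (radon_extE mu (compact_borel cC)).
Qed.

Lemma compact_closedm (C : set X) : compact C -> closed C.
Proof. exact: (compact_closed (@metric_hausdorff R X)). Qed.

Lemma compactIm (C D : set X) : compact C -> compact D -> compact (C `&` D).
Proof.
move=> cC cD; apply: (@subclosed_compact _ _ C) => //.
by apply: closedI; exact: compact_closedm.
Qed.

Section lusin.
Context {V W Z : normedModType R}.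

(** Lusin's property gives compact sets [D n] that fill [C] up to a null Borel set and on which [f]
    is continuous. In each [D n] the preimage is relatively open, hence Borel, and the rest of [C]
    serves as the null set in the definition of mu-measurability. *)
Lemma sm_preimage (f : X -> V) (U : set V) : strongly_measurable m f ->
  open U -> mble (f @^-1` U).
Proof.
move=> sf oU; suff : radon_measurable mu (f @^-1` U) by [].
move=> C cC.
have e0 n : (0 < (n.+1%:R^-1 : R))%R by [].
have /choice[D /all_and4[cD DC mD fD]] := fun n => sf C cC _ (e0 n).
have bD n : measurable (D n : set (borelType X)) by exact: compact_borel.
exists (\bigcup_n (D n `&` f @^-1` U)), (C `\` \bigcup_n D n).
have mN : measurable (C `\` \bigcup_n D n : set (borelType X)).
  apply: measurableD; first exact: compact_borel.
  exact: bigcupT_measurable.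
split => //.
- apply: bigcupT_measurable => n.
  have := fD n; move=> /continuousP /(_ _ oU) /open_subspaceP [U' oU' UD].
  rewrite setIC -UD; apply: measurableI => //.
  exact: sub_sigma_algebra.
- suff : m (C `\` \bigcup_n D n) = 0 by rewrite (radon_extE mu mN).
  apply/eqP; rewrite -measure_le0.
  apply/lee_addgt0Pr => e e_gt0; rewrite add0e.
  have [n _ /(_ n (leqnn _)) ne] := near_infty_natSinv_lt (PosNum e_gt0).
  apply: (@le_trans _ _ (m (C `\` D n))).
    by apply: le_radon_ext => x [Cx nD]; split => // Dx; apply: nD; exists n.
  by rewrite (le_trans (ltW (mD n)))// lee_fin ltW.
- by move=> x [n _ [Dx fx]]; split => //; exact: DC Dx.
- move=> x [fx Cx]; have [[n _ Dx]|nD] := pselect ((\bigcup_n D n) x).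
    by left; exists n.
  by right.
Qed.

Lemma sm_norm_measurable (f : X -> V) : strongly_measurable m f ->
  measurable_fun [set: radonType mu] (fun x => `|f x|%R).
Proof.
move=> sf; apply: (measurability _ (measurable_realfun.RGenOInfty.measurableE R)) => //.
move=> _ [_ [a ->] <-]; rewrite setTI.
have -> : (fun x => `|f x|%R) @^-1` `]a, +oo[ = f @^-1` [set v | a < `|v|]%R.
  by apply/seteqP; split => x /=; rewrite in_itv/= andbT.
apply: sm_preimage => //.
apply: (@open_comp _ _ (fun v : V => `|v|%R) [set y | a < y]%R).
  by move=> v _; exact: norm_continuous.
exact: open_gt.
Qed.

Lemma sm_cst (v : V) : strongly_measurable m (cst v : X -> V).
Proof.
move=> C cC e e0; exists C; split => //; first by rewrite setDv measure0 lte_fin.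
exact/continuous_subspaceT/cst_continuous.
Qed.

(** Removing the exceptional null set from a Lusin set destroys compactness; inner regularity
    restores it at the cost of another [e / 2]. *)
Lemma sm_ae (f g : X -> V) : strongly_measurable m f ->
  (\forall x \ae m, f x = g x) -> strongly_measurable m g.
Proof.
move=> sf [N [mN N0 Nfg]] C cC e e0.
have e20 : (0 < e / 2)%R by rewrite divr_gt0.
have [D [cD DC Ce fD]] := sf C cC _ e20.
have mD := compact_radon cD.
have mDN : mble (D `\` N) by exact: measurableD.
have DNoo : m (D `\` N) < +oo.
  apply: le_lt_trans (compact_radon_lty cD); apply: le_radon_ext.
  by move=> x [].
have [D' [cD' DD' De]] := radon_inner mDN DNoo e20.
exists D'; split => //.
- by move=> x /DD'[/DC].
- have mC := compact_radon cC; have mD' := compact_radon cD'.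
  apply: (@le_lt_trans _ _ (m ((C `\` D) `|` ((D `\` N) `\` D') `|` N))).
    apply: le_radon_ext => x [Cx nD'].
    have [Nx|nN] := pselect (N x); first by right.
    by left; have [Dx|nD] := pselect (D x); [right|left].
  apply: le_lt_trans (radon_extU_le _ _) _ => //.
    by apply: measurableU; apply: measurableD.
  rewrite N0 adde0.
  apply: le_lt_trans (radon_extU_le _ _) _ => //; first exact: measurableD.
    exact: measurableD.
  by rewrite [e in e%:E](splitr e) EFinD lteD.
- apply: (@subspace_eq_continuous _ _ _ f).
    move=> x; rewrite inE => /DD'[_ nN]; apply: contrapT => nfg.
    by apply: nN; apply: Nfg.
  by apply: continuous_subspaceW fD => x /DD'[].
Qed.

(** The pair [(f, g)] is continuous on the intersection of two Lusin sets. Sums, multiples and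
    images under continuous maps are all instances. *)
Lemma sm_comp2 (f : X -> V) (g : X -> W) (phi : V * W -> Z) :
  continuous phi -> strongly_measurable m f -> strongly_measurable m g ->
  strongly_measurable m (fun x => phi (f x, g x)).
Proof.
move=> cphi sf sg C cC e e0.
have e20 : (0 < e / 2)%R by rewrite divr_gt0.
have [D [cD DC De fD]] := sf C cC _ e20.
have [D' [cD' DC' De' gD]] := sg C cC _ e20.
exists (D `&` D'); split => //.
- exact: compactIm.
- by move=> x [/DC].
- rewrite setDIr; apply: le_lt_trans (radon_extU_le _ _) _.
  + by apply: measurableD; exact: compact_radon.
  + by apply: measurableD; exact: compact_radon.
  by rewrite [e in e%:E](splitr e) EFinD lteD.
- move=> x; apply: (@continuous_comp _ _ _ (fun x : subspace (D `&` D') => (f x, g x)) phi); last exact: cphi.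
  apply: cvg_pair.
  + by apply: (continuous_subspaceW _ fD) => y [].
  + by apply: (continuous_subspaceW _ gD) => y [].
Qed.

End lusin.

Section lusin2.
Context {V W : normedModType R}.

Lemma sm_comp (f : X -> V) (phi : V -> W) : continuous phi ->
  strongly_measurable m f -> strongly_measurable m (phi \o f).
Proof.
move=> cphi sf; apply: (@sm_comp2 V V W f f (phi \o fst)) => // z.
by apply: continuous_comp; [exact: cvg_fst|exact: cphi].
Qed.

End lusin2.

Section lusin3.
Context {V : normedModType R}.

Lemma smD (f g : X -> V) : strongly_measurable m f -> strongly_measurable m g ->
  strongly_measurable m (fun x => f x + g x)%R.
Proof.
by apply: (@sm_comp2 V V V f g (fun z => z.1 + z.2)%R); exact: add_continuous.
Qed.

Lemma smZ (a : R) (f : X -> V) : strongly_measurable m f ->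
  strongly_measurable m (fun x => a *: f x)%R.
Proof. by apply: (@sm_comp V V f ( *:%R a)); exact: scaler_continuous. Qed.

Lemma smB (f g : X -> V) : strongly_measurable m f -> strongly_measurable m g ->
  strongly_measurable m (fun x => f x - g x)%R.
Proof.
move=> sf sg; have -> : (fun x => f x - g x)%R = (fun x => f x + (-1) *: g x)%R.
  by apply/funext => x; rewrite scaleN1r.
by apply: smD => //; exact: smZ.
Qed.

(** Gluing along a countable measurable cover. As [C] has finite measure, finitely many pieces miss
    less than [e / 2] of it; on these a finite union of compact sets works, because continuity on
    two closed sets gives continuity on their union. The pieces may overlap, since [f] agrees with
    [F i] on the whole of [A i]. *)
Lemma sm_bigcup (A : (set X)^nat) (F : nat -> X -> V) (f : X -> V) :
  (forall i, mble (A i)) -> \bigcup_i A i = setT ->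
  (forall i, strongly_measurable m (F i)) ->
  (forall i x, A i x -> f x = F i x) -> strongly_measurable m f.
Proof.
move=> mA AT sF fF C cC e e0; have mC := compact_radon cC.
have fin N : forall e : R, (0 < e)%R -> exists D : set X,
    [/\ compact D, D `<=` C, m ((C `&` \big[setU/set0]_(i < N) A i) `\` D) < e%:E &
      {within D, continuous f}].
  elim: N => [|N IH] {}e {}e0.
    exists set0; split => //; first exact: compact0.
      by rewrite big_ord0 setI0 set0D measure0 lte_fin.
    exact: continuous_subspace0.
  have e20 : (0 < e / 2)%R by rewrite divr_gt0.
  have e40 : (0 < e / 2 / 2)%R by rewrite !divr_gt0.
  have [D [cD DC De fD]] := IH _ e20.
  have mCA : mble (C `&` A N) by exact: measurableI.
  have CAoo : m (C `&` A N) < +oo.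
    by apply: le_lt_trans (compact_radon_lty cC); apply: le_radon_ext => x [].
  have [D1 [cD1 D1C D1e]] := radon_inner mCA CAoo e40.
  have [D2 [cD2 D2C D2e fD2]] := sF N D1 cD1 _ e40.
  have mB : mble (\big[setU/set0]_(i < N) A i).
    by apply: bigsetU_measurable => i _; exact: mA.
  exists (D `|` D2); split.
  - exact: compactU.
  - by move=> x [/DC//|/D2C/D1C[]].
  - have mD := compact_radon cD; have mD1 := compact_radon cD1.
    have mD2 := compact_radon cD2.
    apply: (@le_lt_trans _ _ (m (((C `&` \big[setU/set0]_(i < N) A i) `\` D) `|`
      (((C `&` A N) `\` D1) `|` (D1 `\` D2))))).
      apply: le_radon_ext => x [[Cx]]; rewrite big_ord_recr/= => -[Bx|Ax] nD.
        by left; split => // Dx; apply: nD; left.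
      right; have [Dx|nDx] := pselect (D1 x); last by left.
      by right; split => // D2x; apply: nD; right.
    apply: le_lt_trans (radon_extU_le _ _) _.
    + by apply: measurableD => //; exact: measurableI.
    + by apply: measurableU; apply: measurableD.
    rewrite [e in e%:E](splitr e) EFinD lteD//.
    apply: le_lt_trans (radon_extU_le _ _) _; [exact: measurableD..|].
    by rewrite [(e / 2)%R](splitr (e / 2)) EFinD lteD.
  - apply: withinU_continuous => //; [exact: compact_closedm..|].
    apply: (@subspace_eq_continuous _ _ _ (F N)) => // x.
    by rewrite inE => /D2C/D1C[_ Ax]; exact/esym/fF.
have e20 : (0 < e / 2)%R by rewrite divr_gt0.
(* The part of [C] left by the first [N] pieces decreases to the empty set. *)
pose G N := C `\` \big[setU/set0]_(i < N) A i.
have mG i : mble (G i).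
  by apply: measurableD => //; apply: bigsetU_measurable => j _; exact: mA.
have G0 : \bigcap_N G N = set0.
  rewrite -subset0 => x Gx.
  have [i _ Ai] : (\bigcup_i A i) x by rewrite AT.
  have [_] := Gx i.+1 I; apply; rewrite -bigcup_mkord; exists i => //=.
have [N GN] : exists N, m (G N) < (e / 2)%:E.
  suff h : m \o G @ \oo --> 0.
    have /h [N _ GN] : nbhs (0 : \bar R) [set x | x < (e / 2)%:E].
      by apply: open_nbhs_nbhs; split; [exact: open_ereal_lt_ereal|rewrite /= lte_fin].
    by exists N; exact: (GN N (leqnn N)).
  rewrite -[X in _ --> X](measure0 m) -G0.
  apply: nonincreasing_cvg_mu => //.
  + by apply: le_lt_trans (compact_radon_lty cC); apply: le_radon_ext => x [].
  + by rewrite G0.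
  + apply/nonincreasing_seqP => n; rewrite subsetEset => x [Cx nA]; split => //.
    by rewrite -bigcup_mkord => -[j /= jn Aj]; apply: nA; rewrite -bigcup_mkord; exists j => //=; exact: ltnW.
have [D [cD DC De fD]] := fin N _ e20.
exists D; split => //.
apply: (@le_lt_trans _ _ (m (G N `|` (C `&` \big[setU/set0]_(i < N) A i `\` D)))).
  apply: le_radon_ext => x [Cx nD].
  by have [Bx|nB] := pselect ((\big[setU/set0]_(i < N) A i) x); [right|left].
apply: le_lt_trans (radon_extU_le _ _) _ => //.
  apply: measurableD; last exact: compact_radon.
  by apply: measurableI => //; apply: bigsetU_measurable => j _; exact: mA.
by rewrite [e in e%:E](splitr e) EFinD lteD.
Qed.

End lusin3.
End radon_facts.

(** * Bochner integrals *)

Section steps.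
Context {R : realType} {X : pmetricType R} (mu : radon_measure X).
Local Notation m := (radon_ext mu).
Local Notation mble A := (measurable (A : set (radonType mu))).

(** A function of finite range is indexed by ordinals, so that sums over its range become sums over
    ['I_n]. Removing duplicates from the list of values makes [phi] injective, hence the equality of
    fibres. *)
Lemma fin_range_factor (U : choiceType) (g : X -> U) : finite_set (range g) ->
  exists n (u : X -> 'I_n) (phi : 'I_n -> U),
    (forall x, g x = phi (u x)) /\
    (forall i, u @^-1` [set i] = g @^-1` [set phi i]).
Proof.
move=> /finite_seqP[s0 gs0]; pose s := undup s0.
have gs x : g x \in s.
  by rewrite mem_undup; have : range g (g x) by []; rewrite gs0.
exists (size s), (fun x => Ordinal (eq_ind_r is_true (gs x) (index_mem (g x) s))).
exists (fun i => nth (g point) s i); split.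
  by move=> x /=; rewrite nth_index.
move=> i; apply/seteqP; split => x /=.
  by move=> <- /=; rewrite nth_index.
by move=> gx; apply: val_inj; rewrite /= gx index_uniq// undup_uniq.
Qed.

Section one.
Context {V : normedModType R} {n : nat}.
Variables (u : X -> 'I_n) (phi : 'I_n -> V).
Hypothesis mu_ : forall i, mble (u @^-1` [set i]).
Hypothesis fu_ : forall i, phi i != 0%R -> m (u @^-1` [set i]) < +oo.

Local Notation w i := (fine (m (u @^-1` [set i]))).

Lemma ord_fiber (v : V) :
  (fun x => phi (u x)) @^-1` [set v] =
  \bigcup_(i in [set i | phi i = v]) u @^-1` [set i].
Proof.
by apply/seteqP; split => [x /= h|x [i /= <- <-]//]; exists (u x).
Qed.

Lemma ord_step : integrable_step mu (fun x => phi (u x)).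
Proof.
split.
  apply: (@sub_finite_set _ _ (phi @` setT)).
    by move=> _ [x _ <-]; exists (u x).
  exact: finite_image.
move=> v; rewrite ord_fiber; split.
  apply: fin_bigcup_measurable => //.
have fD : finite_set [set i | phi i = v] by exact: finite_finset.
have mU : mble (\bigcup_(i in [set i | phi i = v]) u @^-1` [set i]).
  exact: fin_bigcup_measurable.
move=> v0; apply: le_lt_trans (@content_sub_fsum _ _ _ m _ _ _ _ fD (fun i _ => mu_ i) mU (@subset_refl _ _)) _.
rewrite fsbig_finite//= big_seq lte_sum_pinfty// => i.
rewrite in_fset_set// inE/= => iv; apply: fu_; by rewrite iv.
Qed.

Lemma ord_step_measure (v : V) : v != 0%R ->
  fine (m ((fun x => phi (u x)) @^-1` [set v])) =
  (\sum_(i < n) (phi i == v)%:R * w i)%R.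
Proof.
move=> v0; rewrite ord_fiber.
have -> : \bigcup_(i in [set i | phi i = v]) u @^-1` [set i] =
    \big[setU/set0]_(i <- index_enum 'I_n | phi i == v) (u @^-1` [set i]).
  rewrite -bigcup_seq_cond; apply: eq_bigcupl; split=> i /=.
    by move=> ->; rewrite mem_index_enum eqxx.
  by move=> /andP[_ /eqP].
rewrite (measure_bigsetU_ord_cond m)//; last first.
  by move=> i j _ _ [x [/= -> ->]].
rewrite -sum_fine; last first.
  move=> i /eqP iv; rewrite ge0_fin_numE//; apply: fu_; by rewrite iv.
rewrite big_mkcond; apply: eq_bigr => i _.
by case: ifPn; rewrite ?mul1r ?mul0r.
Qed.

(** [phi] may take a value twice, so that several step functions can share the same [u]; the fibres
    of equal value are regrouped by exchanging two sums. *)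
Lemma ord_step_integral :
  step_integral mu (fun x => phi (u x)) = (\sum_(i < n) w i *: phi i)%R.
Proof.
rewrite /step_integral fsbig_finite/=; last exact: (ord_step).1.
transitivity (\sum_(v <- finmap.enum_fset (fset_set (range (fun x => phi (u x)))))
    \sum_(i < n) ((phi i == v)%:R * w i) *: v)%R.
  rewrite [LHS]big_seq [RHS]big_seq; apply: eq_bigr => v _.
  have [->|v0] := eqVneq v 0%R.
    by rewrite scaler0 big1// => i _; rewrite scaler0.
  by rewrite ord_step_measure// scaler_suml.
rewrite exchange_big/=; apply: eq_bigr => i _.
(* An empty fibre contributes zero on both sides; its value may lie outside the range. *)
have [[x ux]|nx] := pselect (exists x, u x = i); last first.
  have -> : u @^-1` [set i] = set0.
    by rewrite -subset0 => x /= ux; apply: nx; exists x.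
  rewrite measure0 scale0r big1// => v _.
  by rewrite mulr0 scale0r.
rewrite (bigD1_seq (phi i)) ?finmap.fset_uniq//=; last first.
  rewrite in_fset_set; last exact: (ord_step).1.
  by rewrite inE; exists x; rewrite // ux.
rewrite eqxx mul1r big1 ?addr0// => v /negbTE.
by rewrite eq_sym => ->; rewrite mul0r scale0r.
Qed.

Lemma ord_step_norm :
  \int[m]_x (`|phi (u x)|)%:E = (\sum_(i < n) w i * `|phi i|)%:E.
Proof.
have E x : (`|phi (u x)|)%:E =
    \sum_(i < n) ((`|phi i|)%:E * (\1_(u @^-1` [set i]) x)%:E).
  rewrite (bigD1 (u x))//= big1 ?adde0.
    by rewrite indicE mem_set ?mule1.
  by move=> i iu; rewrite indicE memNset ?mule0//= => h; rewrite h eqxx in iu.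
under eq_integral do rewrite E.
rewrite ge0_integral_sum//; last first.
  move=> i; apply: emeasurable_funM; first exact: measurable_cst.
  by apply/measurable_EFinP; exact: measurable_indic.
rewrite -sumEFin; apply: eq_bigr => i _.
rewrite ge0_integralZl//; last first.
  by apply/measurable_EFinP; exact: measurable_indic.
rewrite integral_indic// setIT.
have [->|p0] := eqVneq (phi i) 0%R; first by rewrite normr0 mul0e mulr0.
by rewrite EFinM fineK 1?muleC// ge0_fin_numE// fu_.
Qed.

Lemma ord_step_le :
  (`|step_integral mu (fun x => phi (u x))|)%:E <= \int[m]_x (`|phi (u x)|)%:E.
Proof.
rewrite ord_step_integral ord_step_norm lee_fin.
apply: (le_trans (ler_norm_sum _ _ _)); apply: ler_sum => i _.
by rewrite normrZ ger0_norm// fine_ge0.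
Qed.

Lemma ord_step_sm : strongly_measurable m (fun x => phi (u x)).
Proof.
apply: (@sm_bigcup _ _ mu _ (fun k => [set x | u x = k :> nat])
  (fun k => cst (if insub k is Some i then phi i else 0%R))).
- move=> k; case: (ltnP k n) => kn.
    have := mu_ (Ordinal kn); congr measurable; apply/seteqP; split => x /=.
      by move=> ->.
    by move=> h; apply: val_inj.
  rewrite (_ : [set x | _] = set0)// -subset0 => x /= h.
  by have := ltn_ord (u x); rewrite h ltnNge kn.
- by apply/seteqP; split => // x _; exists (u x).
- by move=> k; exact: sm_cst.
- by move=> k x /= <-; rewrite valK.
Qed.

End one.

(** Common refinement: the pair [(s, t)] is factored through its finite range. A fibre has finite
    measure as soon as one of the two values is nonzero, being contained in the corresponding fibre
    of [s] or [t]. *)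
Lemma two_steps (V W : normedModType R) (s : X -> V) (t : X -> W) :
  integrable_step mu s -> integrable_step mu t ->
  exists n (u : X -> 'I_n) (phi : 'I_n -> V) (psi : 'I_n -> W),
  [/\ forall x, s x = phi (u x), forall x, t x = psi (u x),
      forall i, mble (u @^-1` [set i]) &
      forall i, (phi i != 0%R) || (psi i != 0%R) -> m (u @^-1` [set i]) < +oo].
Proof.
move=> [fs ms] [ft mt].
have [|n [u [phi [hphi hu]]]] := @fin_range_factor (V * W)%type (fun x => (s x, t x)).
  apply: (@sub_finite_set _ _ (range s `*` range t)); last exact: finite_setX.
  by move=> _ [x _ <-]; split => /=; exists x.
exists n, u, (fst \o phi), (snd \o phi); split => //=.
- by move=> x; rewrite -hphi.
- by move=> x; rewrite -hphi.
- move=> i; rewrite hu.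
  rewrite (_ : _ @^-1` _ = s @^-1` [set (phi i).1] `&` t @^-1` [set (phi i).2]).
    by apply: measurableI; [exact: (ms _).1|exact: (mt _).1].
  by apply/seteqP; split => x /=; [move=> <-|case: (phi i) => a b /= [-> ->]].
- move=> i; rewrite hu => /orP[/(ms _).2|/(mt _).2]; apply: le_lt_trans;
  by apply: le_radon_ext => x /= <-.
Qed.

Lemma step_sm (V : normedModType R) (s : X -> V) :
  integrable_step mu s -> strongly_measurable m s.
Proof.
move=> ss; have [n [u [phi [psi [/funext -> _ mu_ fu_]]]]] := two_steps ss ss.
by apply: ord_step_sm.
Qed.

Lemma stepZD (V : normedModType R) (a : R) (s t : X -> V) :
  integrable_step mu s -> integrable_step mu t ->
  integrable_step mu (fun x => a *: s x + t x)%R /\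
  step_integral mu (fun x => a *: s x + t x)%R =
  (a *: step_integral mu s + step_integral mu t)%R.
Proof.
move=> ss st; have [n [u [phi [psi [/funext -> /funext -> mu_ fu_]]]]] := two_steps ss st.
pose f i := (a *: phi i + psi i)%R.
have ff i : f i != 0%R -> m (u @^-1` [set i]) < +oo.
  move=> fi; apply: fu_; apply: contraNT fi; rewrite negb_or !negbK.
  by move=> /andP[/eqP p /eqP q]; rewrite /f p q scaler0 addr0.
split; first exact: (@ord_step _ _ u f).
have fp i : phi i != 0%R -> m (u @^-1` [set i]) < +oo by move=> h; apply: fu_; rewrite h.
have fq i : psi i != 0%R -> m (u @^-1` [set i]) < +oo by move=> h; apply: fu_; rewrite h orbT.
rewrite (@ord_step_integral _ _ u f)// !ord_step_integral// scaler_sumr -big_split/=.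
by apply: eq_bigr => i _; rewrite scalerDr !scalerA mulrC.
Qed.

Lemma stepB_le (V : normedModType R) (s t : X -> V) :
  integrable_step mu s -> integrable_step mu t ->
  (`|step_integral mu s - step_integral mu t|)%:E <= \int[m]_x (`|s x - t x|)%:E.
Proof.
move=> ss st.
have [] := stepZD (-1)%R st ss.
rewrite scaleN1r addrC => h1 <-.
have [n [u [phi [psi [E _ mu_ fu_]]]]] := two_steps h1 h1.
rewrite (funext E) (eq_integral (fun x : radonType mu => (`|phi (u x)|)%:E)); last first.
  by move=> x _; rewrite -E scaleN1r addrC.
by apply: ord_step_le => // i h; apply: fu_; rewrite h.
Qed.

Lemma step_le (V : normedModType R) (s : X -> V) : integrable_step mu s ->
  (`|step_integral mu s|)%:E <= \int[m]_x (`|s x|)%:E.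
Proof.
move=> ss; have [n [u [phi [psi [/funext -> _ mu_ fu_]]]]] := two_steps ss ss.
by apply: ord_step_le => // i h; apply: fu_; rewrite h.
Qed.

Lemma step_linear (V W : normedModType R) (S : {linear V -> W}) (s : X -> V) :
  integrable_step mu s -> integrable_step mu (S \o s) /\
  step_integral mu (S \o s) = S (step_integral mu s).
Proof.
move=> ss; have [n [u [phi [psi [/funext -> _ mu_ fu_]]]]] := two_steps ss ss.
have fp i : phi i != 0%R -> m (u @^-1` [set i]) < +oo by move=> h; apply: fu_; rewrite h.
have fS i : S (phi i) != 0%R -> m (u @^-1` [set i]) < +oo.
  by move=> h; apply: fp; apply: contraNneq h => ->; rewrite linear0.
split; first exact: (@ord_step _ _ u (S \o phi)).
rewrite (@ord_step_integral _ _ u (S \o phi))// ord_step_integral//.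
by rewrite linear_sum; apply: eq_bigr => i _ /=; rewrite linearZ.
Qed.

End steps.

Section bint.
Context {R : realType} {X : pmetricType R} (mu : radon_measure X).
Local Notation m := (radon_ext mu).
Local Notation mble A := (measurable (A : set (radonType mu))).

(* [f] is assumed to vanish off the domain of integration. *)
Definition bint {V : normedModType R} (f : X -> V) (v : V) : Prop :=
  exists s : (X -> V)^nat, [/\ forall n, integrable_step mu (s n),
    (fun n => \int[m]_x (`|f x - s n x|)%:E) @ \oo --> 0 &
    (fun n => step_integral mu (s n)) @ \oo --> v].

Lemma sm_enorm {V : normedModType R} (f : X -> V) : strongly_measurable m f ->
  measurable_fun [set: radonType mu] (fun x => (`|f x|)%:E).
Proof. by move=> sf; apply/measurable_EFinP; exact: sm_norm_measurable. Qed.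

Lemma cvge0_lt (u : (\bar R)^nat) (e : R) : u @ \oo --> 0 -> (0 < e)%R ->
  \forall n \near \oo, u n < e%:E.
Proof.
move=> u0 e0; have : nbhs (0 : \bar R) [set x | x < e%:E].
  by apply: open_nbhs_nbhs; split; [exact: open_ereal_lt_ereal|rewrite /= lte_fin].
exact: u0.
Qed.

Lemma cvge0_le (u : (\bar R)^nat) : (forall n, 0 <= u n) ->
  (forall e : R, (0 < e)%R -> \forall n \near \oo, u n < e%:E) -> u @ \oo --> 0.
Proof.
move=> u0 h; apply/fine_cvgP; split.
  have := h 1%R ltr01; apply: filterS => n un.
  by rewrite ge0_fin_numE// (lt_trans un)// ltry.
apply/cvgrPdist_lt => e e0; have := h e e0; apply: filterS => n un.
rewrite sub0r normrN /= ger0_norm ?fine_ge0//.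
by rewrite -lte_fin fineK// ge0_fin_numE// (lt_trans un)// ltry.
Qed.

Lemma bint_le {V : normedModType R} (f : X -> V) (v : V) :
  strongly_measurable m f -> bint f v -> (`|v|)%:E <= \int[m]_x (`|f x|)%:E.
Proof.
move=> sf [s [ss sf0 sv]].
apply/lee_addgt0Pr => e e0.
have e20 : (0 < e / 2)%R by rewrite divr_gt0.
have [n [h1 h2]] : exists n, \int[m]_x (`|f x - s n x|)%:E < (e / 2)%:E /\
    (`|v - step_integral mu (s n)| < e / 2)%R.
  have : \forall n \near \oo, \int[m]_x (`|f x - s n x|)%:E < (e / 2)%:E /\
    (`|v - step_integral mu (s n)| < e / 2)%R.
    by near=> n; split; near: n; [exact: cvge0_lt|move/cvgrPdist_lt : sv; exact].
  by case=> N _ /(_ N (leqnn N)) ?; exists N.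
have sn := step_sm (ss n).
have mfs := sm_enorm (smB sf sn).
apply: (@le_trans _ _ (\int[m]_x (`|s n x|)%:E + (e / 2)%:E)).
  apply: le_trans (leeD (step_le (ss n)) (lexx _)).
  rewrite -EFinD lee_fin -[X in (`|X| <= _)%R](subrK (step_integral mu (s n))).
  by rewrite addrC (le_trans (ler_normD _ _))// lerD2l ltW.
rewrite [in leRHS](splitr e) EFinD addeA leeD//.
apply: le_trans (leeD (lexx _) (ltW h1)).
rewrite -ge0_integralD//; last exact: sm_enorm.
apply: ge0_le_integral => //.
- exact: sm_enorm.
- by apply: emeasurable_funD; [exact: sm_enorm|exact: mfs].
- move=> x _; rewrite -EFinD lee_fin.
  by rewrite -[X in (`|X| <= _)%R](subKr (f x)) (le_trans (ler_normB _ _))// lerD2l.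
Unshelve. all: by end_near. Qed.

Lemma bintB {V : normedModType R} (f g : X -> V) (v w : V) :
  strongly_measurable m f -> strongly_measurable m g ->
  bint f v -> bint g w -> bint (fun x => f x - g x)%R (v - w)%R.
Proof.
move=> sf sg [s [ss sf0 sv]] [t [st tg0 tw]].
exists (fun n x => -1 *: t n x + s n x)%R; split.
- by move=> n; exact: (stepZD (-1) (st n) (ss n)).1.
- apply: cvge0_le => [n|e e0]; first exact: integral_ge0.
  have e20 : (0 < e / 2)%R by rewrite divr_gt0.
  near=> n.
  have mfs := sm_enorm (smB sf (step_sm (ss n))).
  have mgs := sm_enorm (smB sg (step_sm (st n))).
  apply: (@le_lt_trans _ _ (\int[m]_x ((`|f x - s n x|)%:E + (`|g x - t n x|)%:E))).
    apply: ge0_le_integral => //.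
    + apply: sm_enorm; apply: smB; first exact: smB.
      by apply: smD; [apply: smZ; exact: step_sm|exact: step_sm].
    + exact: emeasurable_funD.
    + move=> x _; rewrite -EFinD lee_fin; apply: le_trans (ler_normB _ _).
      rewrite scaleN1r (addrC (- t n x)%R) opprB (addrC (t n x)) addrACA.
      by rewrite opprB (addrC (t n x) (- g x)%R).
  rewrite ge0_integralD//.
  rewrite [e in e%:E](splitr e) EFinD lteD//; near: n; exact: cvge0_lt.
- have -> : (fun n => step_integral mu (fun x => -1 *: t n x + s n x)%R) =
      (fun n => step_integral mu (s n) - step_integral mu (t n))%R.
    by apply/funext => n; rewrite (stepZD (-1) (st n) (ss n)).2 scaleN1r addrC.
  exact: cvgB.
Unshelve. all: by end_near. Qed.

Lemma bint_linear {V W : normedModType R} (S : {linear V -> W}) (M : R)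
    (f : X -> V) (v : V) : continuous S ->
  (forall x, `|S x| <= M * `|x|)%R ->
  strongly_measurable m f -> bint f v -> bint (S \o f) (S v).
Proof.
move=> cS SM sf [s [ss sf0 sv]].
exists (fun n => S \o s n); split.
- by move=> n; exact: (step_linear S (ss n)).1.
- apply: cvge0_le => [n|e e0]; first exact: integral_ge0.
  (* A positive multiplier above [M], which may be zero or negative. *)
  pose M1 := (Num.max M 0 + 1)%R.
  have M10 : (0 < M1)%R by rewrite ltr_wpDl// le_max lexx orbT.
  have e20 : (0 < e / M1)%R by rewrite divr_gt0.
  near=> n.
  have mfs := sm_enorm (smB sf (step_sm (ss n))).
  apply: (@le_lt_trans _ _ (\int[m]_x (M1%:E * (`|f x - s n x|)%:E))).
    apply: ge0_le_integral => //.
    + apply: sm_enorm; apply: smB; apply: sm_comp => //; exact: step_sm.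
    + by apply: emeasurable_funM => //; exact: measurable_cst.
    + move=> x _; rewrite -EFinM lee_fin /= -linearB (le_trans (SM _))//.
      by rewrite ler_wpM2r// /M1 ler_wpDr// le_max lexx.
  rewrite ge0_integralZl// ?lee_fin ?ltW//.
  rewrite -lte_pdivlMl// -EFinM mulrC; near: n; exact: cvge0_lt.
- have -> : (fun n => step_integral mu (S \o s n)) = S \o (fun n => step_integral mu (s n)).
    by apply/funext => n; rewrite (step_linear S (ss n)).2.
  by apply: continuous_cvg => //; exact: cS.
Unshelve. all: by end_near. Qed.

(** On a compact Lusin set [D] that nearly fills [A] the image of [f] is compact, hence covered by
    finitely many balls of radius [h]. Each point of [D] is sent to the first centre within [h] of
    its value and every other point to zero, so that the error is at most [h] on [D] and at most [M]
    on the small set [A \ D]. *)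
Lemma step_approx {V : normedModType R} (f : X -> V) (A : set X) (M e : R) :
  strongly_measurable m f -> (forall x, `|f x| <= M)%R -> mble A -> m A < +oo ->
  (forall x, ~ A x -> f x = 0%R) -> (0 < e)%R ->
  exists2 s, integrable_step mu s & \int[m]_x (`|f x - s x|)%:E < e%:E.
Proof.
move=> sf fM mA Aoo f0 e0.
have M0 : (0 <= M)%R by exact: le_trans (fM point).
have fA : m A \is a fin_num by rewrite ge0_fin_numE.
pose a := fine (m A); have a0 : (0 <= a)%R by exact: fine_ge0.
(* [A \ D] has measure at most [2 d], so that the errors from [d] and [h] amount to at most [e / 2]
   and [e / 4]; the [+ 1] keeps the denominators positive when [M] or [a] is zero. *)
pose d := (e / (4 * (M + 1)))%R; have d0 : (0 < d)%R.
  by rewrite divr_gt0// mulr_gt0// ltr_wpDl.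
pose h := (e / (4 * (a + 1)))%R; have h0 : (0 < h)%R.
  by rewrite divr_gt0// mulr_gt0// ltr_wpDl.
have [C [cC CA Cd]] := radon_inner mA Aoo d0.
have [D [cD DC Dd fD]] := sf C cC d d0.
have cfD : compact (f @` D).
  by apply: continuous_compact.
have [vs fvs] : exists vs : seq V, forall x, D x -> has (fun v => `|f x - v| < h)%R vs.
  have := cfD; rewrite compact_cover => /(_ V setT (fun v => ball v h) (fun i _ => ball_open i h)) [].
    by move=> v _; exists v => //; exact: ballxx.
  move=> vs _ hvs; exists (finmap.enum_fset vs) => x Dx.
  have [v /= vvs] := hvs (f x) (ex_intro2 _ _ x Dx erefl).
  rewrite -ball_normE /= => fv; apply/hasP; exists v => //.
  by rewrite distrC.
have DA : D `<=` A by exact: subset_trans CA.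
have mD := compact_radon mu cD; have mC := compact_radon mu cC.
(* Off [D] the index is [size vs], one past the list, where [nth] returns its default value zero. *)
pose k x := if pselect (D x) then find (fun v => `|f x - v| < h)%R vs else size vs.
have kn x : (k x < (size vs).+1)%N.
  by rewrite /k; case: (pselect (D x)) => ?; rewrite ltnS ?find_size.
pose u x := Ordinal (kn x).
pose phi (i : 'I_(size vs).+1) := nth 0%R vs i.
have mB v : mble [set x | `|f x - v| < h]%R.
  have := sm_norm_measurable (smB sf (@sm_cst _ _ mu _ v)) => /(_ measurableT _ (measurable_itv `]-oo, h[)).
  rewrite setTI; congr measurable; apply/seteqP; split => x /=; rewrite in_itv//=.
have mk (i : nat) : (i < size vs)%N -> mble (D `&` [set x | find (fun v => `|f x - v| < h)%R vs = i]).
  move=> ivs; apply: measurableI => //.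
  rewrite (_ : [set x | _] = [set x | `|f x - nth 0%R vs i| < h]%R `&`
      \bigcap_(j in [set j | (j < i)%N]) ~` [set x | `|f x - nth 0%R vs j| < h]%R).
    apply: measurableI => //; apply: bigcap_measurableType => // j _.
    exact: measurableC.
  apply/seteqP; split => x /=.
    move=> fi; split.
      by rewrite -fi; apply: (@nth_find _ 0%R (fun v => `|f x - v| < h)%R); rewrite has_find fi.
    move=> j /= ji /=; rewrite -fi in ji.
    by have := before_find 0%R ji => -> .
  move=> [hi hj]; apply/eqP; rewrite eqn_leq; apply/andP; split.
    rewrite leqNgt; apply/negP => li.
    by have := before_find 0%R li; rewrite hi.
  rewrite leqNgt; apply/negP => /[dup] li /hj; apply.
  by apply: (@nth_find _ 0%R (fun v => `|f x - v| < h)%R); rewrite has_find (ltn_trans li).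
have fib i : (i < size vs)%N -> k @^-1` [set i] = D `&` [set x | find (fun v => `|f x - v| < h)%R vs = i].
  move=> ivs; apply/seteqP; split => x /=; rewrite /k; case: pselect => //.
    by move=> nD /= si; move: ivs; rewrite -si ltnn.
  - by move=> ? [].
  - by move=> nD [].
have mu1 i : (i < size vs)%N -> mble (k @^-1` [set i]).
  by move=> ivs; rewrite fib//; exact: mk.
have mu_ (i : 'I_(size vs).+1) : mble (u @^-1` [set i]).
  have -> : u @^-1` [set i] = k @^-1` [set (i : nat)].
    by apply/seteqP; split => x /=; [move=> <-|move=> ki; exact: val_inj].
  have := ltn_ord i; rewrite ltnS leq_eqVlt => /predU1P[->|]; last exact: mu1.
  rewrite (_ : _ @^-1` _ = ~` \bigcup_(j in [set j | (j < size vs)%N]) k @^-1` [set j]).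
    by apply: measurableC; apply: bigcup_measurable => j /= ?; exact: mu1.
  apply/seteqP; split => x /=.
    by move=> kx [j /= jl kj]; move: jl; rewrite -kj kx ltnn.
  move=> h1; have := kn x; rewrite ltnS leq_eqVlt => /predU1P[//|kl].
  by exfalso; apply: h1; exists (k x).
have fu_ i : phi i != 0%R -> m (u @^-1` [set i]) < +oo.
  move=> pi; apply: le_lt_trans Aoo; apply: le_radon_ext => x /= ux.
  apply: DA; apply: contrapT => nD; move: pi; rewrite -ux /phi/= /k.
  by case: pselect => // ?; rewrite nth_default// eqxx.
exists (fun x => phi (u x)); first exact: ord_step.
have ssm := ord_step_sm phi mu_.
have mI B : mble B -> measurable_fun [set: radonType mu] (fun x => (\1_B x : R)%:E).
  by move=> mB'; apply/measurable_EFinP; exact: measurable_indic.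
have mAD : mble (A `\` D) by exact: measurableD.
apply: (@le_lt_trans _ _ (\int[m]_x (h%:E * (\1_A x)%:E + M%:E * (\1_(A `\` D) x)%:E))).
  apply: ge0_le_integral => //.
  - apply: sm_enorm; apply: smB => //.
  - by apply: emeasurable_funD; apply: emeasurable_funM; [exact: measurable_cst|exact: mI|exact: measurable_cst|exact: mI].
  - move=> x _; rewrite -!EFinM -EFinD lee_fin !indicE.
    have [Dx|nD] := pselect (D x).
      rewrite (mem_set (DA _ Dx)) (memNset (_ : ~ (A `\` D) x)); last by move=> [].
      rewrite mulr1 mulr0 addr0 ltW// /phi/= /k; case: pselect => // ?.
      by apply: (@nth_find _ 0%R (fun v => `|f x - v| < h)%R); exact: fvs.
    have -> : phi (u x) = 0%R.
      by rewrite /phi/= /k; case: pselect => // ?; rewrite nth_default.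
    rewrite subr0; have [Ax|nA] := pselect (A x); last first.
      by rewrite f0// normr0 addr_ge0// mulr_ge0// ltW.
    rewrite (mem_set Ax) (mem_set (conj Ax nD : (A `\` D) x)) !mulr1.
    by rewrite (le_trans (fM x))// lerDr ltW.
have h0' : 0 <= h%:E by rewrite lee_fin ltW.
rewrite ge0_integralD//; [|by move=> x _; rewrite mule_ge0// lee_fin|
  by apply: emeasurable_funM; [exact: measurable_cst|exact: mI]|
  by move=> x _; rewrite mule_ge0// lee_fin|
  by apply: emeasurable_funM; [exact: measurable_cst|exact: mI]].
rewrite !ge0_integralZl//; [|exact: mI|exact: mI].
rewrite !integral_indic// !setIT.
have ADd : m (A `\` D) <= (d + d)%:E.
  apply: (@le_trans _ _ (m ((A `\` C) `|` (C `\` D)))).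
    apply: le_radon_ext => x [Ax nD].
    by have [Cx|nC] := pselect (C x); [right|left].
  apply: le_trans (radon_extU_le _ _) _; [exact: measurableD..|].
  by rewrite EFinD leeD// ltW.
apply: (@le_lt_trans _ _ (h%:E * a%:E + M%:E * (d + d)%:E)).
  by rewrite leeD// ?fineK// lee_wpmul2l// lee_fin.
rewrite -!EFinM -EFinD lte_fin /h /d.
have a1 : (a / (a + 1) <= 1)%R by rewrite ler_pdivrMr ?mul1r ?lerDl// ltr_wpDl.
have M1 : (M / (M + 1) <= 1)%R by rewrite ler_pdivrMr ?mul1r ?lerDl// ltr_wpDl.
have -> : (e / (4 * (a + 1)) * a = e / 4 * (a / (a + 1)))%R.
  by field; rewrite gt_eqF// ltr_wpDl.
have -> : (M * (e / (4 * (M + 1)) + e / (4 * (M + 1))) = e / 2 * (M / (M + 1)))%R.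
  by field; rewrite gt_eqF// ltr_wpDl.
have e4 : (0 <= e / 4)%R by rewrite divr_ge0// ltW.
have e2 : (0 <= e / 2)%R by rewrite divr_ge0// ltW.
have h1 := ler_wpM2l e4 a1; have h2 := ler_wpM2l e2 M1.
lra.
Qed.

(** Completeness of [V] enters here: the integrals of the approximating step functions form a Cauchy
    sequence by [stepB_le]. *)
Lemma bint_exists {V : completeNormedModType R} (f : X -> V) (A : set X) (M : R) :
  strongly_measurable m f -> (forall x, `|f x| <= M)%R -> mble A -> m A < +oo ->
  (forall x, ~ A x -> f x = 0%R) -> exists v, bint f v.
Proof.
move=> sf fM mA Aoo f0.
have e0 n : (0 < (n.+1%:R^-1 : R))%R by [].
have /choice[s hs] : forall n, exists s, integrable_step mu s /\
    \int[m]_x (`|f x - s x|)%:E < (n.+1%:R^-1)%:E.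
  by move=> n; have [s h1 h2] := step_approx sf fM mA Aoo f0 (e0 n); exists s.
have ss n := (hs n).1; have hs2 n := (hs n).2.
have fs0 : (fun n => \int[m]_x (`|f x - s n x|)%:E) @ \oo --> 0.
  apply: cvge0_le => [n|e e_gt0]; first exact: integral_ge0.
  have := near_infty_natSinv_lt (PosNum e_gt0); apply: filterS => n ne.
  by rewrite (lt_trans (hs2 n))// lte_fin.
have cauchy : cauchy ((fun n => step_integral mu (s n)) @ \oo).
  apply/cauchy_ballP => e e_gt0; rewrite near_map2.
  have e20 : (0 < e / 2)%R by rewrite divr_gt0.
  have hN := cvge0_lt fs0 e20.
  near=> i j.
  rewrite -ball_normE /= -lte_fin.
  apply: (le_lt_trans (stepB_le (ss i) (ss j))).
  have mfi := sm_enorm (smB sf (step_sm (ss i))).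
  have mfj := sm_enorm (smB sf (step_sm (ss j))).
  apply: (@le_lt_trans _ _ (\int[m]_x ((`|f x - s i x|)%:E + (`|f x - s j x|)%:E))).
    apply: ge0_le_integral => //.
    + by apply: sm_enorm; apply: smB; exact: step_sm.
    + exact: emeasurable_funD.
    + move=> x _; rewrite -EFinD lee_fin.
      rewrite (distrC (f x)) addrC addrC; apply: le_trans (ler_normD _ _).
      by rewrite addrA subrK.
  rewrite ge0_integralD// [e in e%:E](splitr e) EFinD lteD//.
    by near: i.
  by near: j.
have /cauchy_cvgP/cvg_ex[v sv] := cauchy.
by exists v, s; split.
Unshelve. all: by end_near. Qed.

End bint.

(** * Calderon-Zygmund decomposition *)

Section vitali_family.
Context {R : realType} {X : pmetricType R} (mu : radon_measure X).
Local Notation m := (radon_ext mu).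
Local Notation mble A := (measurable (A : set (radonType mu))).

Lemma ball_mdist (x y : X) (s : R) : ball x s y <-> (mdist x y < s)%R.
Proof. by rewrite ballEmdist. Qed.

Lemma mball_open (x : X) (s : R) : open (ball x s).
Proof.
rewrite openE => y /ball_mdist xy; apply/nbhs_ballP.
exists (s - mdist x y)%R => /=; first by rewrite subr_gt0.
move=> z /ball_mdist yz; apply/ball_mdist.
by apply: le_lt_trans (metric_triangle x y z) _; rewrite -ltrBrDl.
Qed.

Lemma ball_radon (x : X) (s : R) : mble (ball x s).
Proof. by apply: open_radon; exact: mball_open. Qed.

Variables (c : R) (c0 : (0 < c)%R).
Definition dyadic (n : nat) : R := (c / 2 ^+ n)%R.

Lemma dyadic_gt0 n : (0 < dyadic n)%R.
Proof. by rewrite /dyadic divr_gt0// exprn_gt0. Qed.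

Lemma dyadic_le n k : (n <= k)%N -> (dyadic k <= dyadic n)%R.
Proof.
move=> nk; rewrite /dyadic ler_pM2l// lef_pV2 ?posrE ?exprn_gt0//.
by rewrite ler_eXn2l// ltr1n.
Qed.

Lemma dyadic_lt (e : R) : (0 < e)%R -> exists n, (dyadic n < e)%R.
Proof.
move=> e0; have [n _ /(_ n (leqnn _)) ne] := near_infty_natSinv_lt (PosNum (divr_gt0 e0 c0)).
exists n; rewrite /dyadic -ltr_pdivlMl// mulrC; apply: le_lt_trans ne.
by rewrite lef_pV2 ?posrE ?exprn_gt0// -natrX ler_nat ltn_expl.
Qed.

Lemma dyadicS n : (2 * dyadic n.+1 = dyadic n)%R.
Proof. by rewrite /dyadic exprS; field; rewrite expf_neq0. Qed.

Variables (Om S : set X) (gen : X -> nat).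
Local Notation B x := (ball x (dyadic (gen x))).
Hypothesis Soo : m S < +oo.
Hypothesis BS : forall x, Om x -> B x `<=` S.
Hypothesis B0 : forall x, Om x -> 0 < m (B x).

Let H (n : nat) (U : set X) :=
  [set x | [/\ Om x, gen x = n & forall y, U y -> B x `&` B y = set0]].

Let step (n : nat) (U : set X) : set X :=
  sval (ex_maximal_disjoint_subcollection (fun x => B x) (H n U)).

Let stepP n U : maximal_disjoint_subcollection (fun x => B x) (step n U) (H n U).
Proof. by rewrite /step; case: ex_maximal_disjoint_subcollection. Qed.

(** After [n] rounds the generations below [n] have been treated; larger balls are chosen before
    smaller ones. *)
Fixpoint vitali_sel (n : nat) : set X :=
  if n is k.+1 then vitali_sel k `|` step k (vitali_sel k) else set0.

Let G := \bigcup_n vitali_sel n.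

Let sel_mono n k : (n <= k)%N -> vitali_sel n `<=` vitali_sel k.
Proof.
elim: k => [|k IH]; first by rewrite leqn0 => /eqP ->.
rewrite leq_eqVlt => /predU1P[->//|/IH h]; exact: subset_trans h (@subsetUl _ _ _).
Qed.

Let sel_Om n : vitali_sel n `<=` Om.
Proof.
elim: n => [//|n IH] x /= [/IH//|]; have [sub _ _] := stepP n (vitali_sel n).
by move=> /sub[].
Qed.

Let sel_tI n x y : vitali_sel n x -> vitali_sel n y -> x <> y -> B x `&` B y = set0.
Proof.
elim: n x y => [//|n IH] x y /=.
have [sub tI _] := stepP n (vitali_sel n).
move=> [hx|hx] [hy|hy] xy; first exact: IH.
- by rewrite setIC; have [_ _] := sub _ hy; exact.
- by have [_ _] := sub _ hx; exact.
- by apply: contrapT => /eqP/set0P h; apply: xy; exact: tI hx hy h.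
Qed.

Let G_tI x y : G x -> G y -> x <> y -> B x `&` B y = set0.
Proof.
move=> [i _ Gx] [j _ Gy]; apply: (@sel_tI (maxn i j)).
  by apply: sel_mono Gx; exact: leq_maxl.
by apply: sel_mono Gy; exact: leq_maxr.
Qed.

(** If [B x] met no ball selected up to generation [gen x], it could be added to the maximal
    disjoint family chosen in that round. *)
Let G_cover x : Om x -> exists2 y, G y & (gen y <= gen x)%N /\ B x `&` B y !=set0.
Proof.
move=> Ox; apply: contrapT => nex.
have sel_gen k y : vitali_sel k y -> (gen y < k)%N.
  elim: k y => [//|k IH] y /= [/IH/ltnW//|].
  by have [sub _ _] := stepP k (vitali_sel k) => /sub[_ -> _].
have disj y : vitali_sel (gen x).+1 y -> B x `&` B y = set0.
  move=> sy; apply: contrapT => /eqP/set0P Bxy; apply: nex; exists y.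
    by exists (gen x).+1.
  by split => //; rewrite -ltnS; exact: sel_gen.
have [sub tI maxi] := stepP (gen x) (vitali_sel (gen x)).
have xB : B x x by apply: ballxx; exact: dyadic_gt0.
have nx : ~ step (gen x) (vitali_sel (gen x)) x.
  move=> sx; have := disj x (or_intror sx); rewrite setIid => e.
  by rewrite e in xB.
apply: (maxi (x |` step (gen x) (vitali_sel (gen x)))).
- split; first by move=> y; right.
  by move=> h; apply: nx; apply: h; left.
- move=> y [->|/sub//]; split => // z sz; by apply: disj; left.
- move=> y z [->|sy] [->|sz] // [w [wy wz]].
  + by have := disj z (or_intror sz); rewrite -subset0 => /(_ w (conj wy wz)).
  + by have := disj y (or_intror sy); rewrite -subset0 => /(_ w (conj wz wy)).
  + by apply: tI => //; exists w.
Qed.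

(** Disjoint balls inside [S], each of measure above [1 / (k + 1)], are finitely many since [m S] is
    finite. This takes the place of separability. *)
Let G_countable : countable G.
Proof.
pose Gk k := [set x | G x /\ (k.+1%:R^-1)%:E < m (B x)].
suff fGk k : finite_set (Gk k).
  have -> : G = \bigcup_k Gk k.
    apply/seteqP; split => [x Gx|x [k _ []//]].
    have Bx0 : 0 < m (B x) by apply: B0; case: Gx => n _ /sel_Om.
    have [i _ Gxi] := Gx.
    have Bfin : m (B x) \is a fin_num.
      rewrite ge0_fin_numE//; apply: le_lt_trans Soo; apply: le_radon_ext.
      by apply: BS; exact: sel_Om Gxi.
    have f0 : (0 < fine (m (B x)))%R.
      by rewrite fine_gt0// Bx0/= -ge0_fin_numE.
    have [k _ /(_ k (leqnn _)) hk] := near_infty_natSinv_lt (PosNum f0).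
    by exists k => //; split => //; rewrite -(fineK Bfin) lte_fin.
  by apply: bigcup_countable => // k _; exact: finite_set_countable.
apply: contrapT => infG.
pose N := (Num.truncn (fine (m S) * k.+1%:R)).+1.
have [F FG FN] := infinite_set_fset N infG.
have GkS x : Gk k x -> B x `<=` S by move=> [[n _ /sel_Om]] Ox _; exact: BS.
have : m (\bigcup_(x in [set` F]) B x) <= m S.
  by apply: le_radon_ext; apply: bigcup_sub => x /FG/GkS.
rewrite (@measure_fin_bigcup _ _ _ m)//; last 2 first.
- move=> x y /FG[Gx _] /FG[Gy _] [w [wx wy]]; apply: contrapT => /(G_tI Gx Gy).
  by rewrite -subset0 => /(_ w (conj wx wy)).
- by move=> x _; exact: ball_radon.
apply/negP; rewrite -ltNge.
have fS : m S \is a fin_num by rewrite ge0_fin_numE.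
apply: (@lt_le_trans _ _ (\sum_(x \in [set` F]) (k.+1%:R^-1 : R)%:E)).
  rewrite fsbig_finite//= set_fsetK sumEFin -(fineK fS) lte_fin.
  rewrite (_ : (\sum_(i <- F) k.+1%:R^-1 = #|`F|%:R / k.+1%:R :> R)%R); last first.
    by rewrite big_const_seq count_predT iter_addr_0 mulr_natl.
  rewrite ltr_pdivlMr//.
  apply: lt_le_trans (truncnS_gt _) _.
  by rewrite ler_nat.
by apply: lee_fsum => // x /FG[_ /ltW].
Qed.

(* Radii range over a dyadic sequence, so that a maximal disjoint subfamily is
   selected generation by generation. [None] stands for a missing ball. *)
Lemma vitali_balls : exists z : nat -> option X,
  [/\ forall i x, z i = Some x -> Om x,
      forall i j x y, z i = Some x -> z j = Some y -> i <> j -> B x `&` B y = set0 &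
      forall x, Om x -> exists i y, [/\ z i = Some y, (gen y <= gen x)%N &
        B x `&` B y !=set0] ].
Proof.
have /countable_injP[f finj] := G_countable.
pose P i x := G x /\ f x = i.
exists (fun i => if pselect (exists x, P i x) is left h then Some (sval (cid h)) else None).
have PS i x : (if pselect (exists x, P i x) is left h then Some (sval (cid h)) else None) = Some x -> P i x.
  by case: pselect => // h [<-]; exact: (svalP (cid h)).
split.
- by move=> i x /PS[[n _ /sel_Om]].
- move=> i j x y /PS[Gx fx] /PS[Gy fy] ij; apply: G_tI => // xy.
  by apply: ij; rewrite -fx -fy xy.
- move=> x /G_cover[y Gy [gyx Bxy]]; exists (f y), y; split => //.
  case: pselect => [h|]; last by move=> nh; exfalso; apply: nh; exists y.
  congr Some; have [Gz fz] := svalP (cid h).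
  exact: (finj _ _ (mem_set Gz) (mem_set Gy) fz).
Qed.

End vitali_family.

Section calderon_zygmund.
Context {R : realType} {X : pmetricType R} (mu : radon_measure X).
Local Notation m := (radon_ext mu).
Local Notation mble A := (measurable (A : set (radonType mu))).
Variables (D rho : R) (E : set X) (x0 : X).
Hypothesis D1 : (1 <= D)%R.
Hypothesis rho0 : (0 < rho)%R.
Hypothesis dbl : forall x s, (0 < s)%R -> (s <= 6 * rho)%R ->
  m (ball x (2 * s)%R) <= D%:E * m (ball x s).
Hypothesis posB : forall x s, (0 < s)%R -> 0 < m (ball x s).
Hypothesis finB : forall x s, (s <= 6 * rho)%R -> m (ball x s) < +oo.
Hypothesis Ex0 : E x0.
Hypothesis Ed : forall x y, E x -> E y -> (mdist x y < rho)%R.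

Let c := (rho / 2)%R.
Let c0 : (0 < c)%R. Proof. by rewrite divr_gt0. Qed.
Local Notation s_ := (dyadic c).
Let s0 := dyadic_gt0 c0.
Let S := ball x0 (2 * rho)%R.
Let D0 : (0 < D)%R. Proof. exact: lt_le_trans D1. Qed.

Let mS : mble S. Proof. exact: ball_radon. Qed.
Let Soo : m S < +oo.
Proof. by apply: finB; rewrite ler_pM2r// ler_nat. Qed.

Let s_le n : (s_ n <= rho / 2)%R.
Proof. by rewrite -[leRHS](_ : s_ 0 = _)%R ?dyadic_le// /dyadic expr0 divr1. Qed.

Let ball_S x s : E x -> (s <= rho)%R -> ball x s `<=` S.
Proof.
move=> Ex sr y /ball_mdist xy; apply/ball_mdist.
apply: le_lt_trans (metric_triangle x0 x y) _.
have h1 := Ed Ex0 Ex; have h2 := lt_le_trans xy sr; lra.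
Qed.

Let half_le : (rho / 2 <= rho)%R.
Proof. by rewrite ler_pdivrMr// ler_peMr ?ler1n// ltW. Qed.

Section family.
Variables (gen : X -> nat) (z : nat -> option X).
Definition vitali_fam (k : R) i : set X :=
  if z i is Some x then ball x (k * s_ (gen x))%R else set0.

Lemma vitali_fam_open k i : open (vitali_fam k i).
Proof. by rewrite /vitali_fam; case: (z i) => [x|]; [exact: mball_open|exact: open0]. Qed.

Lemma vitali_fam_measurable k i : mble (vitali_fam k i).
Proof. by apply: open_radon; exact: vitali_fam_open. Qed.

(** Radii are at most [rho / 2], so that [k <= 12] keeps the dilated radius in the range [6 * rho]
    of the doubling property. *)
Lemma vitali_fam_double k i : (0 < k)%R -> (k <= 12)%R ->
  m (vitali_fam (2 * k)%R i) <= D%:E * m (vitali_fam k i).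
Proof.
move=> k0 k12; rewrite /vitali_fam; case: (z i) => [x|]; last by rewrite measure0 mule0.
rewrite -mulrA; apply: dbl; first by rewrite mulr_gt0.
have := ler_pM (ltW k0) (ltW (s0 (gen x))) k12 (s_le (gen x)).
by move=> /le_trans; apply; lra.
Qed.

Hypothesis z_disj : forall i j x y, z i = Some x -> z j = Some y -> i <> j ->
  ball x (s_ (gen x)) `&` ball y (s_ (gen y)) = set0.

Lemma vitali_fam_trivIset : trivIset setT (vitali_fam 1).
Proof.
move=> i j _ _ [w []]; rewrite /vitali_fam.
case zi : (z i) => [x|//]; case zj : (z j) => [y|//]; rewrite !mul1r => wx wy.
apply: contrapT => /(z_disj zi zj); by rewrite -subset0 => /(_ w (conj wx wy)).
Qed.

Hypothesis zE : forall i x, z i = Some x -> E x.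

End family.

(* Differentiation of the integral: cover [K] inside a small neighbourhood by the
   doubled balls of a Vitali family. *)
Lemma density_null (g : X -> R) (b b' : R) (K : set X) :
  measurable_fun [set: radonType mu] g -> (forall x, 0 <= g x)%R ->
  (0 <= b)%R -> (b < b')%R ->
  compact K -> K `<=` E -> (forall x, K x -> (b' <= g x)%R) ->
  (forall x n, K x -> \int[m]_(y in ball x (s_ n)) (g y)%:E <= b%:E * m (ball x (s_ n))) ->
  m K = 0.
Proof.
move=> mg g0 b0 bb' cK KE Kg Kavg.
have mK := compact_radon mu cK.
have b'0 : (0 < b')%R by exact: le_lt_trans bb'.
(* Open neighbourhoods of the compact set [K] that shrink to it, so that their measures tend to
   [m K]. *)
pose U n := \bigcup_(x in K) ball x (s_ n).
have mU n : mble (U n).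
  by apply: open_radon; apply: bigcup_open => x _; exact: mball_open.
have US n : U n `<=` S.
  by apply: bigcup_sub => x /KE Ex; apply: ball_S => //; rewrite (le_trans (s_le _)).
have Uoo n : m (U n) < +oo by apply: le_lt_trans Soo; exact: le_radon_ext.
have KU n : K `<=` U n by move=> x Kx; exists x => //; exact: ballxx.
have Kfin : m K \is a fin_num by rewrite ge0_fin_numE// compact_radon_lty.
have UK : \bigcap_n U n = K.
  apply/seteqP; split => [x Ux|x Kx n _]; last exact: KU.
  rewrite (closure_id K).1; last exact: compact_closedm.
  move=> B /nbhs_ballP[e /= e0 eB]; have [n ne] := dyadic_lt c0 e0.
  have [y Ky /ball_mdist xy] := Ux n I; exists y; split => //.
  by apply: eB; apply/ball_mdist; rewrite metric_sym (lt_trans xy).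
(* Let [W] be the union of the selected balls. The bound on averages gives [b' m(W & K) <= b m(W)],
   hence [(b' - b) m(W) <= b' m(W \ K) <= b' (m(U n) - m(K))]. The doubled balls cover [K], so that
   [m(K) <= D m(W)]. *)
have key n : ((b' - b)%R%:E * m K <= (D * b')%R%:E * (m (U n) - m K)).
  have [] := @vitali_balls _ _ mu c c0 K S (cst n) Soo.
  - by move=> x /KE Ex; apply: ball_S => //; rewrite (le_trans (s_le _)).
  - by move=> x _; apply: posB; exact: s0.
  move=> z [zK zd zc].
  pose F := vitali_fam (cst n) z.
  have Ft : trivIset setT (F 1%R) by exact: vitali_fam_trivIset.
  have mF k i : mble (F k i) by exact: vitali_fam_measurable.
  pose W := \bigcup_i F 1%R i.
  have mW : mble W by exact: bigcupT_measurable.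
  have WU : W `<=` U n.
    apply: bigcup_sub => i _ y; rewrite /F /vitali_fam; case zi : (z i) => [x|//].
    by rewrite mul1r => xy; exists x => //; exact: zK zi.
  have WE : \sum_(0 <= i <oo) m (F 1%R i) = m W.
    by apply/cvg_lim => //; exact: (@measure_sigma_additive _ _ _ m).
  have KW : m K <= D%:E * m W.
    apply: (@le_trans _ _ (\sum_(0 <= i <oo) m (F 2%R i))).
      apply: (@measure_sigma_subadditive _ _ _ m) => // x /zc[i [y [zi _ [w [xw yw]]]]].
      exists i => //; rewrite /F /vitali_fam zi; apply/ball_mdist.
      move/ball_mdist : xw; move/ball_mdist : yw => /= yw; rewrite metric_sym => xw.
      apply: le_lt_trans (metric_triangle y w x) _.
      by rewrite mulr2n mulrDl mul1r ltrD.
    rewrite -WE -nneseriesZl//; apply: lee_nneseries => // i _.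
    by have := @vitali_fam_double (cst n) z 1%R i ltr01; rewrite mulr1 ler1n; apply.
  have gW : b'%:E * m (W `&` K) <= b%:E * m W.
    have mgE A : measurable_fun (A : set (radonType mu)) (EFin \o g).
      by apply: measurable_funTS; exact/measurable_EFinP.
    apply: (@le_trans _ _ (\int[m]_(y in W) (g y)%:E)).
      apply: (@le_trans _ _ (\int[m]_(y in W `&` K) (g y)%:E)).
        rewrite -integral_cst; last exact: measurableI.
        apply: ge0_le_integral => //; first exact: measurableI.
        - by move=> x _; rewrite lee_fin ltW.
        - by move=> x [_ /Kg]; rewrite lee_fin.
      by apply: ge0_subset_integral => //; [exact: measurableI|move=> x _; rewrite lee_fin].
    rewrite /W ge0_integral_bigcup//; last by move=> x _; rewrite lee_fin.
    rewrite -/W -WE -nneseriesZl//; apply: lee_nneseries => [i _ _|i _].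
      by apply: integral_ge0 => x _; rewrite lee_fin.
    rewrite /F /vitali_fam; case zi : (z i) => [x|]; last by rewrite integral_set0 measure0 mule0.
    by rewrite mul1r; apply: Kavg; exact: zK zi.
  have Woo : m W < +oo by apply: le_lt_trans (Uoo n); exact: le_radon_ext.
  have WK : m (W `\` K) <= m (U n) - m K.
    rewrite -[X in _ - m X](setIidr (KU n)) -(@measureD _ _ _ m) ?Uoo//.
    by apply: le_radon_ext => x [/WU].
  have WD : m W = m (W `\` K) + m (W `&` K) by exact: measureDI.
  have WKoo : m (W `&` K) < +oo by apply: le_lt_trans Woo; apply: le_radon_ext => x [].
  have WDoo : m (W `\` K) < +oo by apply: le_lt_trans Woo; apply: le_radon_ext => x [].
  have fin A : m A < +oo -> m A \is a fin_num by move=> ?; rewrite ge0_fin_numE.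
  move: KW gW WK WD.
  rewrite -(fineK Kfin) -(fineK (fin _ Woo)) -(fineK (fin _ WKoo)) -(fineK (fin _ WDoo)) -(fineK (fin _ (Uoo n))).
  rewrite -!EFinB -!EFinD -!EFinM !lee_fin => KW gW WK [WD].
  set k := fine (m K) in KW WK *; set w := fine (m W) in KW gW WD *.
  set a := fine (m (W `&` K)) in gW WD *; set d := fine (m (W `\` K)) in WK WD *.
  set u := fine (m (U n)) in WK *.
  have h1 : ((b' - b) * w <= b' * (u - k))%R.
    have : (b' * d <= b' * (u - k))%R by rewrite ler_pM2l.
    nra.
  have h2 : ((b' - b) * k <= (b' - b) * (D * w))%R by rewrite ler_pM2l ?subr_gt0.
  have h3 : (D * ((b' - b) * w) <= D * (b' * (u - k)))%R by rewrite ler_pM2l.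
  nra.
have Ucvg : m \o U @ \oo --> m K.
  rewrite -[X in _ --> m X]UK; apply: nonincreasing_cvg_mu => //.
  - exact: Uoo.
  - by rewrite UK.
  - apply/nonincreasing_seqP => n; rewrite subsetEset => y [x Kx /ball_mdist xy].
    by exists x => //; apply/ball_mdist; rewrite (lt_le_trans xy)// dyadic_le.
have : (b' - b)%R%:E * m K <= (D * b')%R%:E * (m K - m K).
  have : (fun n => (D * b')%R%:E * (m (U n) - m K)) @ \oo --> (D * b')%R%:E * (m K - m K).
    apply: cvgeZl => //; apply: cvgeB; [|exact: Ucvg|exact: cvg_cst].
    by rewrite fin_num_adde_defr// fin_numN.
  by apply: cvge_ge; exact: nearW.
rewrite subee// mule0 => h; apply/eqP; rewrite -measure_le0.
by rewrite -(@lee_pmul2l _ (b' - b)%R%:E) ?lte_fin ?subr_gt0// mule0.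
Qed.

Lemma vitali_fam_le gen z k k' i : (k <= k')%R -> vitali_fam gen z k i `<=` vitali_fam gen z k' i.
Proof.
move=> kk'; rewrite /vitali_fam; case: (z i) => [x|//].
by move=> y /ball_mdist xy; apply/ball_mdist; rewrite (lt_le_trans xy)// ler_pM2r.
Qed.

(** A stopping time: [gen x] is the first scale at which the average of [g] about [x] exceeds [b].
    That the average over a selected ball is above [b] bounds the total measure of the enlarged
    balls; that the average over its double, one scale earlier, is at most [b] bounds the average
    over [V i] by [D b], since [V i] lies between the ball and its double. *)
Lemma cz_decomp (g : X -> R) (b : R) :
  measurable_fun [set: radonType mu] g -> (forall x, 0 <= g x)%R ->
  (forall x, ~ E x -> g x = 0%R) -> (0 < b)%R ->
  (forall x, E x -> \int[m]_(y in ball x (rho / 2)%R) (g y)%:E <=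
                    b%:E * m (ball x (rho / 2)%R)) ->
  exists V Bs : nat -> set X,
  [/\ trivIset setT V, forall i, mble (V i), open (\bigcup_i V i),
      \bigcup_i V i `<=` set_ball E (rho / 2) & forall i, V i `<=` Bs i] /\
  [/\ forall i, mble (Bs i),
      \sum_(0 <= i <oo) m (Bs i) <= (D ^+ 4 / b)%:E * \int[m]_x (g x)%:E,
      forall i, \int[m]_(x in V i) (g x)%:E <= (D * b)%:E * m (V i) &
      forall i, V i !=set0 -> 0 < m (V i)] /\
  [/\ forall i y y', V i y -> V i y' -> (mdist y y' < rho)%R,
      forall i y y', V i y -> V i y' -> ball y (2 * mdist y y')%R `<=` Bs i &
      \forall x \ae m, ~ (\bigcup_i V i) x -> (g x <= b)%R].
Proof.
move=> mg g0 gE b0 avg.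
have mgE A : measurable_fun (A : set (radonType mu)) (EFin \o g).
  by apply: measurable_funTS; exact/measurable_EFinP.
have gE0 x : 0 <= (g x)%:E by rewrite lee_fin.
pose bad x n := ~ (\int[m]_(y in ball x (s_ n)) (g y)%:E <= b%:E * m (ball x (s_ n))).
pose Om := [set x | E x /\ exists n, bad x n].
have /choice[gen genP] : forall x : X, exists n, Om x ->
    bad x n /\ forall k, (k < n)%N -> ~ bad x k.
  move=> x.
  have [[Ex [n bn]]|nO] := pselect (Om x); last by exists 0%N.
  have exn : exists n, `[< bad x n >] by exists n; apply/asboolP.
  case: (ex_minnP exn) => k /asboolP bk kmin; exists k => _; split => // j jk /asboolP/kmin.
  by rewrite leqNgt jk.
have c_s0 : s_ 0 = (rho / 2)%R by rewrite /dyadic expr0 divr1.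
(* Generation [0] is excluded by the assumption on balls of radius [rho / 2], so the doubled ball is
   the previous scale, where the average is still at most [b]. *)
have gen2 x : Om x -> \int[m]_(y in ball x (2 * s_ (gen x))%R) (g y)%:E <=
    b%:E * m (ball x (2 * s_ (gen x))%R).
  move=> Ox; have [bx nb] := genP x Ox.
  case: (gen x) bx nb => [bx _|n _ nb].
    by exfalso; apply: bx; rewrite c_s0; apply: avg; case: Ox.
  by rewrite dyadicS; apply: contrapT; exact: nb.
have gen1 x : Om x -> (2 * s_ (gen x) <= rho / 2)%R.
  move=> Ox; have [bx _] := genP x Ox.
  case: (gen x) bx => [bx|n _]; last by rewrite dyadicS.
  by exfalso; apply: bx; rewrite c_s0; apply: avg; case: Ox.
have OmS x : Om x -> ball x (s_ (gen x)) `<=` S.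
  by move=> [Ex _]; apply: ball_S => //; rewrite (le_trans (s_le _)).
have [z [zO zd zc]] := vitali_balls c0 Soo OmS (fun x _ => posB x (s0 (gen x))).
pose F := vitali_fam gen z.
have Ft : trivIset setT (F 1%R) by exact: vitali_fam_trivIset.
have mF k i : mble (F k i) by exact: vitali_fam_measurable.
have Fd k i : (0 < k)%R -> (k <= 12)%R -> m (F (2 * k)%R i) <= D%:E * m (F k i).
  exact: vitali_fam_double.
have F12 i : F 1%R i `<=` F 2%R i by apply: vitali_fam_le; rewrite ler1n.
pose A1 := \bigcup_j F 1%R j.
have mA1 : mble A1 by exact: bigcupT_measurable.
(* The doubled balls are made disjoint after removal of all the undilated ones. Thus [V i] contains
   its whole ball, and the union of the [V i] is that of the doubled balls, an open set. *)
pose Q := seqDU (fun i => F 2%R i `\` A1).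
have mQ i : mble (Q i).
  apply: measurableD; first exact: measurableD.
  by apply: bigsetU_measurable => j _; exact: measurableD.
have QF i : Q i `<=` F 2%R i by move=> x [[]].
have QA i x : Q i x -> ~ A1 x by move=> [[]].
pose V i := F 1%R i `|` Q i.
have mV i : mble (V i) by exact: measurableU.
have VF i : V i `<=` F 2%R i by move=> x [/F12|/QF].
have Vt : trivIset setT V.
  move=> i j _ _ [w [[wi|wi] [wj|wj]]].
  - by apply: Ft => //; exists w.
  - by exfalso; apply: (QA _ _ wj); exists i.
  - by exfalso; apply: (QA _ _ wi); exists j.
  - by apply: (@trivIset_seqDU _ (fun i => F 2%R i `\` A1)) => //; exists w.
have VE : \bigcup_i V i = \bigcup_i F 2%R i.
  apply/seteqP; split => x [i _]; first by move=> /VF Fx; exists i.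
  move=> Fx; have [[j _ Fjx]|nA] := pselect (A1 x); first by exists j => //; left.
  have : (\bigcup_i (F 2%R i `\` A1)) x by exists i.
  by rewrite seqDU_bigcup_eq => -[j _ Qx]; exists j => //; right.
have OmV x : Om x -> (\bigcup_i V i) x.
  rewrite VE => /zc[i [y [zi gyx [w [/ball_mdist xw /ball_mdist yw]]]]].
  exists i => //; rewrite /F /vitali_fam zi; apply/ball_mdist.
  apply: le_lt_trans (metric_triangle y w x) _; rewrite (metric_sym w).
  have := dyadic_le c0 gyx; lra.
(* Two points of a ball of radius [2 s] are at distance less than [4 s], so the ball required about
   one of them has radius less than [8 s] and lies in the concentric ball of radius [10 s]; [16] is
   the next power of two. *)
exists V, (F 16%R); split; [split => //|split; split => //].
- rewrite VE; apply: bigcup_open => i _; exact: vitali_fam_open.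
- rewrite VE; apply: bigcup_sub => i _ y; rewrite /F /vitali_fam.
  case zi : (z i) => [x|//] /ball_mdist xy.
  have Ox := zO _ _ zi; rewrite /set_ball /= /dist_set.
  apply: (@le_lt_trans _ _ (mdist y x)%:E).
    by apply: ereal_inf_lbound; exists x => //; case: Ox.
  by rewrite lte_fin metric_sym (lt_le_trans xy)// gen1.
- by move=> i; apply: subset_trans (VF i) _; apply: vitali_fam_le; rewrite ler_nat.
- have F1g i : m (F 1%R i) <= (b^-1)%:E * \int[m]_(x in F 1%R i) (g x)%:E.
    rewrite -lee_pdivrMl ?invr_gt0// invrK /F /vitali_fam.
    case zi : (z i) => [x|]; last by rewrite measure0 mule0 integral_set0.
    rewrite mul1r ltW// ltNge; apply/negP.
    exact: (genP x (zO _ _ zi)).1.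
  have F16 i : m (F 16%R i) <= (D ^+ 4)%:E * m (F 1%R i).
    have e1 := Fd 1%R i ltr01; have e2 := Fd 2%R i; have e4 := Fd 4%R i; have e8 := Fd 8%R i.
    rewrite (_ : 16 = 2 * 8)%R; last by ring.
    apply: (le_trans (e8 _ _)); rewrite ?ler_nat// exprS EFinM -muleA lee_pmul2l ?lte_fin//.
    rewrite (_ : 8 = 2 * 4)%R; last by ring.
    apply: (le_trans (e4 _ _)); rewrite ?ler_nat// exprS EFinM -muleA lee_pmul2l ?lte_fin//.
    rewrite (_ : 4 = 2 * 2)%R; last by ring.
    apply: (le_trans (e2 _ _)); rewrite ?ler_nat// exprS EFinM -muleA lee_pmul2l ?lte_fin//.
    by rewrite -[X in F X]mulr1 expr1; apply: e1; rewrite ler1n.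
  apply: (@le_trans _ _ (\sum_(0 <= i <oo) ((D ^+ 4 / b)%:E * \int[m]_(x in F 1%R i) (g x)%:E))).
    apply: lee_nneseries => // i _; apply: (le_trans (F16 i)).
    by rewrite [(D ^+ 4 / b)%:E]EFinM -muleA lee_pmul2l ?lte_fin ?exprn_gt0.
  rewrite nneseriesZl//; last by move=> i _; exact: integral_ge0.
  rewrite lee_pmul2l ?lte_fin ?divr_gt0 ?exprn_gt0//.
  rewrite -ge0_integral_bigcup//; apply: ge0_subset_integral => //.
- move=> i; apply: (@le_trans _ _ (\int[m]_(x in F 2%R i) (g x)%:E)).
    exact: ge0_subset_integral.
  apply: (@le_trans _ _ (b%:E * m (F 2%R i))).
    rewrite /F /vitali_fam; case zi : (z i) => [x|]; last by rewrite measure0 mule0 integral_set0.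
    exact/gen2/(zO _ _ zi).
  rewrite mulrC EFinM -muleA lee_pmul2l ?lte_fin//.
  rewrite -[X in F X]mulr1; apply: (le_trans (Fd _ _ _ _)) => //; first by rewrite ler1n.
  by rewrite lee_pmul2l ?lte_fin//; apply: le_radon_ext => x; left.
- move=> i [x /VF]; rewrite /V /F /vitali_fam; case: (z i) => [y _|//].
  rewrite mul1r; apply: lt_le_trans (posB y (s0 (gen y))) _.
  by apply: le_radon_ext => w; left.
- move=> i y y' /VF + /VF; rewrite /F /vitali_fam; case zi : (z i) => [x|//] /ball_mdist xy /ball_mdist xy'.
  have := gen1 x (zO _ _ zi).
  have := metric_triangle y x y'; rewrite (metric_sym y x); lra.
- move=> i y y' /VF + /VF; rewrite /F /vitali_fam; case zi : (z i) => [x|//] /ball_mdist xy /ball_mdist xy' w.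
  move=> /ball_mdist yw; apply/ball_mdist.
  have := metric_triangle y x y'; rewrite (metric_sym y x).
  have := metric_triangle x y w; have := s0 (gen x); lra.
(* By inner regularity it is enough to show that compact subsets of [Z k] are null. They lie in [E],
   where [g] may be nonzero, and outside all [V i], hence outside [Om]: every average about their
   points is at most [b] and [density_null] applies. *)
- pose Z k := ~` (\bigcup_i V i) `&` [set x | b + k.+1%:R^-1 <= g x]%R.
  have mVV : mble (\bigcup_i V i) by exact: bigcupT_measurable.
  have mZ k : mble (Z k).
    apply: measurableI; first exact: measurableC.
    have := mg measurableT _ (measurable_itv `[(b + k.+1%:R^-1)%R, +oo[).
    by rewrite setTI; congr measurable; apply/seteqP; split => x /=; rewrite in_itv/= andbT.
  have Z0 k : m (Z k) = 0.
    apply/eqP; rewrite -measure_le0; apply: ge_ereal_sup => _ [K [cK KZ] <-].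
    have -> : mu K = m K by rewrite radon_extE//; exact: compact_borel.
    have KE : K `<=` E.
      move=> x /KZ[_ /= gx]; apply: contrapT => nE; move: gx; rewrite gE//.
      by apply/negP; rewrite -ltNge ltr_wpDr// invr_ge0.
    rewrite (@density_null g b (b + k.+1%:R^-1)%R K)// ?(ltW b0)//.
    + by rewrite ltrDl.
    + by move=> x /KZ[].
    + move=> x n /[dup] /KE Ex /KZ[nV _]; apply: contrapT => nb; apply: nV.
      by apply: OmV; split => //; exists n.
  exists (\bigcup_k Z k); split.
  + exact: bigcupT_measurable.
  + apply/eqP; rewrite -measure_le0.
    apply: (le_trans (@measure_sigma_subadditive _ _ _ m _ _ mZ _ (@subset_refl _ _))).
      exact: bigcupT_measurable.
    by rewrite eseries0// => i _ _; exact: Z0.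
  + move=> x /= /not_implyP[nV /negP]; rewrite -ltNge -subr_gt0 => gb.
    have [k _ /(_ k (leqnn _)) kk] := near_infty_natSinv_lt (PosNum gb).
    exists k => //; split => //=; rewrite -lerBrDl; exact: ltW.
Qed.

End calderon_zygmund.

(** * Measurability of the kernel *)

(** The integral of a nonnegative function is a supremum over the simple functions below it, whence
    monotonicity for integrands not known to be measurable. The integrand of Hormander's condition
    is of that kind. *)
Lemma le_integral_ge0 d (T : measurableType d) (R : realType)
    (m : {measure set T -> \bar R}) (D : set T) (f g : T -> \bar R) :
  (forall x, D x -> 0 <= f x) -> (forall x, D x -> f x <= g x) ->
  \int[m]_(x in D) f x <= \int[m]_(x in D) g x.
Proof.
move=> f0 fg; rewrite !ge0_integralE//; last first.
  by move=> x Dx; rewrite (le_trans (f0 x Dx))// fg.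
apply: ereal_sup_le => _ [h hf <-]; exists h => // x.
apply: le_trans (hf x) _; rewrite !patchE; case: ifPn => // /set_mem Dx.
exact: fg.
Qed.

(* [mu] is not known to be sigma-finite: Tonelli's theorem is applied to its
   restriction to a set of finite measure. *)
Section restricted.
Context d {T : measurableType d} {R : realType} (m : {measure set T -> \bar R}).
Variables (S : set T) (mS : measurable S) (Soo : m S < +oo).
Local Notation nu := (mfrestr mS Soo).

Lemma integral_mfrestr (f : T -> \bar R) : measurable_fun setT f ->
  (forall x, 0 <= f x) -> \int[nu]_x f x = \int[m]_(x in S) f x.
Proof.
move=> mf f0; have mCS := measurableC mS.
rewrite (@ge0_negligible_integral _ _ _ nu setT (~` S))//; last first.
  by rewrite -[LHS]/(m _) setICl measure0.
rewrite setTD setCK; apply: eq_measure_integral => A mA AS.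
by rewrite -[LHS]/(m _) setIidl.
Qed.

Lemma ae_mfrestr (P : T -> Prop) :
  (\forall x \ae m, S x -> P x) -> \forall x \ae nu, P x.
Proof.
move=> [N [mN N0 NP]]; exists (N `|` ~` S); split.
- by apply: measurableU => //; exact: measurableC.
- rewrite -[LHS]/(m _) setIUl setICl setU0; apply/eqP; rewrite -measure_le0 -N0.
  by apply: le_measure; rewrite ?inE//; exact: measurableI.
- move=> x /= nP; have [Sx|nS] := pselect (S x); last by right.
  by left; apply: NP => /= /(_ Sx).
Qed.

Lemma ae_mfrestr_inv (P : T -> Prop) :
  (\forall x \ae nu, P x) -> \forall x \ae m, S x -> P x.
Proof.
move=> [N [mN N0 NP]]; exists (N `&` S); split => //; first exact: measurableI.
by move=> x /= /not_implyP[Sx nP]; split => //; exact: NP.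
Qed.

End restricted.

Section product_measurability.
Context {R : realType} {X : pmetricType R} (mu : radon_measure X).
Local Notation XX := (radonType mu * radonType mu)%type.
Local Notation m := (radon_ext mu).
Local Notation mble A := (measurable (A : set (radonType mu))).

Lemma prod_hausdorff : hausdorff_space (X * X)%type.
Proof.
move=> [p1 p2] [q1 q2] h; congr pair; apply: (@metric_hausdorff R X).
- move=> A B nA nB.
  have [] := h (A `*` setT) (B `*` setT) _ _.
  + by exists (A, setT) => //; split => //; exact: filterT.
  + by exists (B, setT) => //; split => //; exact: filterT.
  by move=> [z1 z2] [[/= ? _] [/= ? _]]; exists z1.
- move=> A B nA nB.
  have [] := h (setT `*` A) (setT `*` B) _ _.
  + by exists (setT, A) => //; split => //; exact: filterT.
  + by exists (setT, B) => //; split => //; exact: filterT.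
  by move=> [z1 z2] [[/= _ ?] [/= _ ?]]; exists z2.
Qed.

Lemma prod_ball_measurable (z : X * X) (e : R) : measurable (ball z e : set XX).
Proof.
have -> : ball z e = ball z.1 e `*` ball z.2 e by [].
by apply: measurableX; exact: ball_radon.
Qed.

(** Without separability a closed subset of the product is not known to belong to the product
    sigma-algebra. A compact one is the intersection over [n] of finite unions of product balls of
    radius [1 / (n + 1)], which are rectangles. *)
Lemma compact_prod_measurable (C : set (X * X)) : compact C ->
  measurable (C : set XX).
Proof.
move=> cC.
have cov n : exists F : set (X * X), [/\ finite_set F, F `<=` C &
   C `<=` \bigcup_(z in F) ball z (n.+1%:R^-1 : R)].
  pose XXp : ptopologicalType :=
    HB.pack (X * X)%type (isPointed.Build (X * X)%type (point, point)).
  have : @compact XXp C by []; rewrite compact_cover.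
  move=> /(_ (X * X)%type C (fun z => interior (ball z (n.+1%:R^-1 : R)))) [].
  - by move=> z _; exact: open_interior.
  - by move=> z Cz; exists z => //; apply: nbhsx_ballx.
  move=> s sC Cs; exists [set` s]; split; [exact: finite_fset| |].
    by move=> z /sC/set_mem.
  by move=> z /Cs[w sw wz]; exists w => //; exact: interior_subset.
have {cov}[F /all_and3[Ffin FC CF]] := choice cov.
have -> : C = \bigcap_n \bigcup_(z in F n) ball z (n.+1%:R^-1 : R).
  apply/seteqP; split => [z Cz n _|z h]; first exact: CF.
  apply: contrapT => nCz.
  have : open (~` C) by exact/closed_openC/(compact_closed prod_hausdorff).
  move=> oC; have : nbhs z (~` C) by apply: open_nbhs_nbhs.
  move=> /nbhs_ballP[e /= e0 eC].
  have [n _ /(_ n (leqnn _)) ne] := near_infty_natSinv_lt (PosNum e0).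
  have [w Fw wz] := h n I.
  apply: (eC w); last exact: FC Fw.
  apply: ball_sym; apply: le_ball wz; exact: ltW.
apply: bigcapT_measurable => n.
apply: fin_bigcup_measurable => // z _; exact: prod_ball_measurable.
Qed.

(** Closed half-lines pull back to compact sets. *)
Lemma within_compact_measurable (C : set (X * X)) (h : X * X -> R) :
  compact C -> {within C, continuous h} -> measurable_fun (C : set XX) h.
Proof.
move=> cC hC; have mC := compact_prod_measurable cC.
apply: (measurability _ (measurable_realfun.RGenCInfty.measurableE R)) => //.
move=> _ [_ [a ->] <-]; apply: compact_prod_measurable.
have := hC; move=> /continuous_closedP /(_ _ (@closed_ge R a)).
have -> : [set y | a <= y]%R = `[a, +oo[%classic.
  by apply/seteqP; split => x /=; rewrite in_itv/= andbT.
move=> /closed_subspaceP [D cD DC].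
rewrite setIC -DC; apply: (@subclosed_compact _ _ C) => //.
by apply: closedI => //; exact: (compact_closed prod_hausdorff).
Qed.

Section kernel_support.
Context {V : normedModType R}.
Variables (S : set X) (mS : mble S) (Soo : m S < +oo).
Let nu : {finite_measure set (radonType mu) -> \bar R} := mfrestr mS Soo.
Variables (E E' : set X) (mE : mble E) (mE' : mble E').
Hypotheses (ES : E `<=` S) (ES' : E' `<=` S).
Variable K : X * X -> V.
Hypothesis Km : prod_strongly_measurable mu (E `*` E') K.

(** Gives access to Tonelli's theorem: the kernel lives on a subset of [S * S], where the finite
    measure [nu] carries all the information. *)
Lemma radon_prod_restr (A : set XX) : measurable A -> A `<=` S `*` S ->
  radon_prod mu A = (nu \x nu) A.
Proof.
move=> mA AS; rewrite /radon_prod /product_measure1 integral_mfrestr//; last first.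
  exact: measurable_fun_xsection.
rewrite [RHS]integral_mkcond; apply: eq_integral => x _.
have xAS : xsection A x `<=` S by move=> y /xsectionP/AS[].
rewrite patchE /=; case: ifPn => [_|/negP xS].
  by rewrite -[RHS]/(m (xsection A x `&` S)) setIidl.
suff -> : xsection A x = set0 by rewrite measure0.
rewrite -subset0 => y /xsectionP/AS[/= Sx _].
by apply: xS; rewrite inE.
Qed.

(** Strong measurability speaks of compact sets, so that [E * E'] is approximated by a product
    [C * C'] of compact sets before a Lusin set is taken. What the [n]-th set misses lies in a strip
    over [E \ C], a strip over [E' \ C'] and a Lusin remainder, of total measure at most
    [(2 m(S) + 1) / (n + 1)]. *)
Lemma kernel_support : exists W : nat -> set (X * X),
  [/\ forall n, compact (W n), forall n, W n `<=` E `*` E',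
      forall n, {within W n, continuous K} &
      (nu \x nu) ((E `*` E') `\` \bigcup_n W n) = 0].
Proof.
have lt_oo (A : set X) : A `<=` S -> m A < +oo.
  by move=> AS; apply: le_lt_trans Soo; exact: le_radon_ext.
have e0 n : (0 < (n.+1%:R^-1 : R))%R by [].
have ex n : exists W C C' : set _, [/\ compact W, compact C, compact C',
    W `<=` C `*` C' & C `<=` E] /\ [/\ C' `<=` E', {within W, continuous K},
    m (E `\` C) < (n.+1%:R^-1)%:E, m (E' `\` C') < (n.+1%:R^-1)%:E &
    (nu \x nu) (C `*` C' `\` W) < (n.+1%:R^-1)%:E].
  have [C [cC CE Cn]] := radon_inner mE (lt_oo _ ES) (e0 n).
  have [C' [cC' CE' Cn']] := radon_inner mE' (lt_oo _ ES') (e0 n).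
  have [W [cW WC Wn KW]] := Km (compact_setX cC cC') (e0 n).
  exists W, C, C'; split; split => //.
    apply: (@subspace_eq_continuous _ _ _ (cutoff (E `*` E') K)) => // z.
    rewrite inE => /WC[/CE ? /CE' ?].
    by rewrite /cutoff indicE mem_set ?scale1r.
  rewrite -radon_prod_restr//.
    apply: measurableD; first by apply: measurableX; exact: compact_radon.
    exact: compact_prod_measurable.
  by move=> [x y] [[/= /CE/ES ? /CE'/ES' ?] _].
have {ex}[W /choice[C /choice[C' WP]]] := choice ex.
have {WP}[/all_and5[cW cC cC' WC CE] /all_and5[CE' KW Cn Cn' Wn]] := all_and2 WP.
exists W; split => //.
  by move=> n z /WC[/CE ? /CE' ?].
apply/eqP; rewrite -measure_le0; apply/lee_addgt0Pr => e e_gt0; rewrite add0e.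
pose s := fine (m S); have s0 : (0 <= s)%R by exact: fine_ge0.
have mSs : m S = s%:E by rewrite fineK// ge0_fin_numE.
have d0 : (0 < e / (2 * s + 1))%R by rewrite divr_gt0// ltr_wpDl// mulr_ge0.
have [n _ /(_ n (leqnn _)) ne] := near_infty_natSinv_lt (PosNum d0).
have mW k : measurable (W k : set XX) by exact: compact_prod_measurable.
have mC k : mble (C k) by exact: compact_radon.
have mC' k : mble (C' k) by exact: compact_radon.
have mP : measurable (E `*` E' : set XX) by exact: measurableX.
pose P1 : set XX := (E `\` C n) `*` S.
pose P2 : set XX := S `*` (E' `\` C' n).
pose P3 : set XX := (C n `*` C' n) `\` W n.
have mP1 : measurable P1 by apply: measurableX => //; exact: measurableD.
have mP2 : measurable P2 by apply: measurableX => //; exact: measurableD.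
have mP3 : measurable P3.
  by apply: measurableD => //; exact: measurableX.
apply: (@le_trans _ _ ((nu \x nu) (P1 `|` P2 `|` P3))).
  apply: le_measure; rewrite ?inE.
  - by apply: measurableD => //; exact: bigcupT_measurable.
  - by apply: measurableU => //; exact: measurableU.
  - move=> [x y] [[/= Ex Ey] nW].
    have [Cx|nCx] := pselect (C n x); last first.
      by left; left; split => //=; exact: ES'.
    have [Cy|nCy] := pselect (C' n y); last first.
      by left; right; split => //=; exact: ES.
    by right; split => // Wxy; apply: nW; exists n.
apply: le_trans (measureU2 _ _ _) _ => //; first exact: measurableU.
have h1 : (nu \x nu) P1 <= (n.+1%:R^-1 * s)%:E.
  rewrite product_measure1E//; last exact: measurableD.
  change (m ((E `\` C n) `&` S) * m (S `&` S) <= (n.+1%:R^-1 * s)%:E).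
  rewrite setIid setIidl; last by move=> x [/ES].
  by rewrite mSs EFinM lee_wpmul2r ?lee_fin// ltW.
have h2 : (nu \x nu) P2 <= (n.+1%:R^-1 * s)%:E.
  rewrite product_measure1E//; last exact: measurableD.
  change (m (S `&` S) * m ((E' `\` C' n) `&` S) <= (n.+1%:R^-1 * s)%:E).
  rewrite setIid setIidl; last by move=> x [/ES'].
  by rewrite mSs mulrC EFinM lee_wpmul2l ?lee_fin// ltW.
apply: (@le_trans _ _ ((n.+1%:R^-1 * s)%:E + (n.+1%:R^-1 * s)%:E + (n.+1%:R^-1)%:E)).
  apply: leeD; last exact: (ltW (Wn n)).
  by apply: le_trans (measureU2 _ _ _) _ => //; exact: leeD.
rewrite -!EFinD lee_fin.
move: ne; rewrite /= ltr_pdivlMr ?ltr_wpDl ?mulr_ge0// => ne.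
by apply: ltW; move: (n.+1%:R^-1)%R ne => v; lra.
Qed.

End kernel_support.

End product_measurability.

Section null_sections.
Context d1 d2 {T1 : measurableType d1} {T2 : measurableType d2} {R : realType}.
Variable m1 : {sigma_finite_measure set T1 -> \bar R}.
Variable m2 : {sigma_finite_measure set T2 -> \bar R}.
Variables (A : set (T1 * T2)) (mA : measurable A).
Hypothesis A0 : (m1 \x m2) A = 0.

Lemma ae_xsection0 : \forall x \ae m1, m2 (xsection A x) = 0.
Proof.
have mf := measurable_fun_xsection m2 mA.
have /(ae_eq_integral_abs m1 measurableT mf) : \int[m1]_x `|m2 (xsection A x)| = 0.
  rewrite -[RHS]A0; apply: eq_integral => x _; rewrite gee0_abs//.
by apply: filterS => x /(_ I).
Qed.

(** The product measure integrates the sections at fixed first coordinate. For the other sections it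
    is identified with the product taken in the opposite order, by uniqueness on rectangles. *)
Lemma ae_ysection0 : \forall y \ae m2, m1 (ysection A y) = 0.
Proof.
have mf := measurable_fun_ysection m1 mA.
have A0' : (m1 \x^ m2) A = 0.
  rewrite -A0; apply/esym/product_measure_unique => // B1 B2 mB1 mB2.
  by rewrite /= product_measure2E.
have /(ae_eq_integral_abs m2 measurableT mf) : \int[m2]_y `|m1 (ysection A y)| = 0.
  rewrite -[RHS]A0'; apply: eq_integral => y _; rewrite gee0_abs//.
by apply: filterS => x /(_ I).
Qed.

End null_sections.

Section opnorm_facts.
Context {R : realType} {V W : normedModType R}.

Lemma cont_linear_linear (f : cont_linear V W) : linear f.
Proof. by have /asboolP[] := cont_linearP f. Qed.

Lemma cont_linear_continuous (f : cont_linear V W) : continuous f.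
Proof. by have /asboolP[] := cont_linearP f. Qed.

HB.instance Definition _ (f : cont_linear V W) :=
  GRing.isLinear.Build R V W *:%R (cont_linear_fun f) (cont_linear_linear f).

Lemma cont_linear_norm (f : cont_linear V W) x : (`|f x| <= `|f| * `|x|)%R.
Proof.
have [->|x0] := eqVneq x 0%R; first by rewrite linear0 !normr0 mulr0.
have nx0 : (0 < `|x|)%R by rewrite normr_gt0.
have /linear_boundedP := (@linear_bounded_continuous R V W f).2 (@cont_linear_continuous f).
move=> /pinfty_ex_gt0[M M0 fM].
have : (`|f (`|x|^-1 *: x)| <= `|f|)%R.
  apply: ub_le_sup; last first.
    by exists (`|x|^-1 *: x)%R => //=; rewrite normrZ normfV normr_id mulVf// gt_eqF.
  by exists M => _ [y /= y1 <-]; rewrite (le_trans (fM y))// ler_piMr// ltW.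
by rewrite linearZ normrZ normfV normr_id -ler_pdivlMl ?invr_gt0// invrK mulrC.
Qed.

End opnorm_facts.

(** * Cancellation over a disjoint family *)

Section cancellation.
Context {R : realType} {X : pmetricType R} (mu : radon_measure X).
Local Notation m := (radon_ext mu).
Local Notation mble A := (measurable (A : set (radonType mu))).

Lemma sm0 {V : normedModType R} : strongly_measurable m (fun _ : X => 0%R : V).
Proof. exact: (@sm_cst _ _ mu _ 0%R). Qed.

Lemma cutoff_in {V : lmodType R} (A : set X) (f : X -> V) x : A x ->
  cutoff A f x = f x.
Proof. by move=> Ax; rewrite /cutoff indicE mem_set// scale1r. Qed.

Lemma cutoff_out {V : lmodType R} (A : set X) (f : X -> V) x : ~ A x ->
  cutoff A f x = 0%R.
Proof. by move=> Ax; rewrite /cutoff indicE memNset// scale0r. Qed.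

Lemma sm_cutoff {V : normedModType R} (A : set X) (f : X -> V) : mble A ->
  strongly_measurable m f -> strongly_measurable m (cutoff A f).
Proof.
move=> mA sf; apply: (@sm_bigcup _ _ mu _ (fun i => if i is 0%N then A else ~` A)
  (fun i => if i is 0%N then f else fun=> 0%R)).
- by move=> [|i] //; exact: measurableC.
- apply/seteqP; split => // x _; have [Ax|nA] := pselect (A x).
    by exists 0%N.
  by exists 1%N.
- by move=> [|i] //; exact: sm0.
- by move=> [|i] x; [exact: cutoff_in|exact: cutoff_out].
Qed.

Lemma bint_cutoff_cst {V : normedModType R} (A : set X) (c : V) : mble A ->
  m A < +oo -> bint mu (cutoff A (cst c)) (fine (m A) *: c)%R.
Proof.
move=> mA Aoo.
pose u x : 'I_2 := if x \in A then ord_max else ord0.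
pose phi (i : 'I_2) := if i == ord0 then 0%R else c.
have fE : cutoff A (cst c) = (fun x => phi (u x)).
  apply/funext => x; rewrite /u; case: ifPn => [/set_mem/cutoff_in ->//|/negP xA].
  by rewrite cutoff_out// => Ax; apply: xA; rewrite inE.
have u1 : u @^-1` [set ord_max] = A.
  apply/seteqP; split => x /=; rewrite /u; first by case: ifPn => // /set_mem.
  by move=> Ax; rewrite mem_set.
have u0 : u @^-1` [set ord0] = ~` A.
  apply/seteqP; split => x /=; rewrite /u; case: ifPn => //.
    by move=> /negP xA _ Ax; apply: xA; rewrite inE.
  by move=> /set_mem.
have cases (i : 'I_2) : i = ord0 \/ i = ord_max.
  by case: i => -[|[|//]] ?; [left|right]; exact: val_inj.
have mu_ i : mble (u @^-1` [set i]).
  by have [->|->] := cases i; rewrite ?u0 ?u1//; exact: measurableC.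
have fu i : phi i != 0%R -> m (u @^-1` [set i]) < +oo.
  by have [->|->] := cases i; rewrite /phi ?eqxx// u1.
have ss := ord_step mu_ fu.
have sI := ord_step_integral mu_ fu.
rewrite fE; exists (fun=> fun x => phi (u x)); split => //.
  rewrite (_ : (fun=> _) = cst 0); first exact: cvg_cst.
  by apply/funext => n; rewrite integral0_eq// => x _; rewrite subrr normr0.
rewrite (_ : (fun=> _) = cst (fine (m A) *: c)%R); first exact: cvg_cst.
apply/funext => n; rewrite sI big_ord_recl big_ord1 /phi eqxx scaler0 add0r.
rewrite (_ : lift ord0 ord0 = ord_max); last exact: val_inj.
by rewrite u1.
Qed.

(** Subtracting finitely many [k i], of integral zero, does not change [v]. The L^1 norm of the
    difference is made of the wanted terms below [N] and a tail of the integrals of [|h|], which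
    tends to zero because [h] is integrable. The full series of the [k i] is not assumed integrable,
    hence the detour through partial sums. *)
Lemma bint_cancel {V : normedModType R} (U : (set X)^nat) (h : X -> V)
    (k : nat -> X -> V) (v : V) :
  trivIset setT U -> (forall i, mble (U i)) ->
  strongly_measurable m h -> (forall x, ~ (\bigcup_i U i) x -> h x = 0%R) ->
  \int[m]_x (`|h x|)%:E < +oo -> bint mu h v ->
  (forall i, strongly_measurable m (k i)) ->
  (forall i x, ~ U i x -> k i x = 0%R) -> (forall i, bint mu (k i) 0%R) ->
  (`|v|)%:E <= \sum_(0 <= i <oo) \int[m]_(x in U i) (`|h x - k i x|)%:E.
Proof.
move=> tU mU sh h0 hoo bh sk k0 bk.
pose a i := \int[m]_(x in U i) (`|h x - k i x|)%:E.
pose t i := \int[m]_(x in U i) (`|h x|)%:E.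
have a0 i : 0 <= a i by exact: integral_ge0.
have t0 i : 0 <= t i by exact: integral_ge0.
have mUU : mble (\bigcup_i U i) by exact: bigcupT_measurable.
have EF (f : X -> V) : strongly_measurable m f ->
    (forall x, ~ (\bigcup_i U i) x -> f x = 0%R) ->
    \int[m]_x (`|f x|)%:E = \sum_(0 <= i <oo) \int[m]_(x in U i) (`|f x|)%:E.
  move=> sf f0; rewrite -ge0_integral_bigcup//; last first.
    by apply: measurable_funTS; exact: sm_enorm.
  rewrite [RHS]integral_mkcond; apply: eq_integral => x _.
  rewrite patchE; case: ifPn => // /negP xU; rewrite f0 ?normr0// => Ux.
  by apply: xU; rewrite inE.
have tl := nneseries_tail_cvg (f := t) (P := xpredT) _ (fun i _ => t0 i).
have {tl}tl : \sum_(N <= i <oo) t i @[N --> \oo] --> 0 by apply: tl; rewrite -EF.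
pose hN N x := (h x - \sum_(i < N) k i x)%R.
have shN N : strongly_measurable m (hN N) /\ bint mu (hN N) v.
  elim: N => [|N [sN bN]].
    suff -> : hN 0%N = h by [].
    by apply/funext => x; rewrite /hN big_ord0 subr0.
  have -> : hN N.+1 = (fun x => hN N x - k N x)%R.
    by apply/funext => x; rewrite /hN big_ord_recr/= opprD addrA.
  split; first exact: smB.
  by rewrite -(subr0 v); exact: bintB.
have le N : (`|v|)%:E <= \sum_(0 <= i <oo) a i + \sum_(N <= i <oo) t i.
  have [sN bN] := shN N.
  apply: (le_trans (bint_le sN bN)); rewrite EF//; last first.
    move=> x nU; rewrite /hN h0// big1 ?subr0// => i _; apply: k0 => Ux.
    by apply: nU; exists i.
  rewrite (@nneseries_split _ _ 0 N) => [|i _]; last exact: integral_ge0.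
  rewrite add0n; apply: leeD.
    apply: (@le_trans _ _ (\sum_(0 <= i < N) a i)); last first.
      by apply: nneseries_lim_ge => i _ _.
    rewrite !big_mkord; apply: lee_sum => i _.
    rewrite le_eqVlt; apply/orP; left; apply/eqP; apply: eq_integral => x /set_mem Ux.
    congr (`| _ - _ |%R%:E); rewrite (bigD1 i)//= big1 ?addr0// => j ji.
    apply: k0 => Uj; move/trivIsetP : tU => /(_ i j I I).
    have ij : nat_of_ord i != j by apply: contra_neq ji => /ord_inj.
    by move=> /(_ ij); rewrite -subset0 => /(_ x); exact.
  rewrite eseries_cond [leRHS]eseries_cond; apply: lee_nneseries => [i _ _|i /andP[_ Ni]].
    exact: integral_ge0.
  rewrite le_eqVlt; apply/orP; left; apply/eqP; apply: eq_integral => x /set_mem Ux.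
  rewrite /hN big1 ?subr0// => j _; apply: k0 => Uj.
  move/trivIsetP : tU => /(_ i j I I).
  have ij : i != nat_of_ord j by rewrite gtn_eqF// (leq_trans _ Ni).
  by move=> /(_ ij); rewrite -subset0 => /(_ x); exact.
have [aoo|] := ltP (\sum_(0 <= i <oo) a i) +oo; last by rewrite leye_eq => /eqP ->; rewrite leey.
apply/lee_addgt0Pr => e e0.
have [N _ /(_ N (leqnn _)) tN] := cvge0_lt tl e0.
by apply: (le_trans (le N)); apply: leeD => //; exact: ltW.
Qed.

End cancellation.

Section sections_support.
Context {R : realType} {X : pmetricType R} (mu : radon_measure X).
Local Notation XX := (radonType mu * radonType mu)%type.
Local Notation m := (radon_ext mu).
Local Notation mble A := (measurable (A : set (radonType mu))).
Context {V : normedModType R}.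
Variables (S : set X) (mS : mble S) (Soo : m S < +oo).
Variables (E E' : set X) (mE : mble E) (mE' : mble E').
Hypotheses (ES : E `<=` S) (ES' : E' `<=` S).
Variable K : X * X -> V.
Hypothesis Km : prod_strongly_measurable mu (E `*` E') K.

Lemma kernel_sections : exists W : nat -> set (X * X),
  [/\ forall n, compact (W n), forall n, {within W n, continuous K},
      \forall x \ae m, E x -> \forall y \ae m, E' y -> (\bigcup_n W n) (x, y) &
      \forall y \ae m, E' y -> \forall x \ae m, E x -> (\bigcup_n W n) (x, y)].
Proof.
have [W [cW WE KW W0]] := kernel_support mS Soo mE mE' ES ES' Km.
pose N : set XX := (E `*` E') `\` \bigcup_n W n.
have mN : measurable N.
  apply: measurableD; first exact: measurableX.
  by apply: bigcupT_measurable => n; exact: compact_prod_measurable.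
exists W; split => //.
- have := ae_mfrestr_inv (ae_xsection0 mN W0).
  apply: filterS => x Nx Ex; have := Nx (ES Ex).
  move=> N0; exists (xsection N x `&` S); split => //.
    by apply: measurableI => //; exact: measurable_xsection.
  move=> y /= /not_implyP[Ey nW]; split; last exact: ES'.
  by apply/xsectionP; split.
- have := ae_mfrestr_inv (ae_ysection0 mN W0).
  apply: filterS => y Ny Ey; have := Ny (ES' Ey).
  move=> N0; exists (ysection N y `&` S); split => //.
    by apply: measurableI => //; exact: measurable_ysection.
  move=> x /= /not_implyP[Ex nW]; split; last exact: ES.
  by apply/ysectionP; split.
Qed.

End sections_support.

(** * The bad part *)

Lemma within_continuous_comp {T1 T2 T3 : topologicalType} (A : set T1)
    (B : set T2) (f : T1 -> T2) (g : T2 -> T3) : (forall x, A x -> B (f x)) ->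
  continuous f -> {within B, continuous g} -> {within A, continuous (g \o f)}.
Proof.
move=> AB cf /subspace_continuousP cg; apply/subspace_continuousP => x Ax.
move=> N /(cg _ (AB x Ax)) /= /(cf x) /=.
rewrite /nbhs /= /within; apply: filterS => y /= h Ay.
by apply: h; exact: AB.
Qed.

Lemma cont_linearB {R : realType} {V W : normedModType R}
  (f g : cont_linear V W) x : (f - g)%R x = (f x - g x)%R.
Proof. by []. Qed.

Section bad_part.
Context {R : realType} {X : pmetricType R} (mu : radon_measure X).
Local Notation XX := (radonType mu * radonType mu)%type.
Local Notation m := (radon_ext mu).
Local Notation mble A := (measurable (A : set (radonType mu))).
Context {B1 B2 : normedModType R}.
Variables (S : set X) (mS : mble S) (Soo : m S < +oo).
Let nu : {finite_measure set (radonType mu) -> \bar R} := mfrestr mS Soo.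
Variables (E E' : set X) (mE : mble E) (mE' : mble E').
Hypotheses (ES : E `<=` S) (ES' : E' `<=` S).
Variable K : X * X -> cont_linear B1 B2.
Hypothesis Km : prod_strongly_measurable mu (E `*` E') K.
Variables (rho C : R) (C0 : (0 < C)%R).
Hypothesis hormander : \forall y \ae m, E' y -> \forall y' \ae m, E' y' ->
  (mdist y y' < rho)%R ->
  \int[m]_(x in E `\` ball (y : X) (2 * mdist y y'))
    `|K (x, y) - K (x, y')|%:E <= C%:E.
Variables U Bs : nat -> set X.
Local Notation F := (\bigcup_i U i).
Local Notation G := (E `\` \bigcup_i Bs i).
Hypotheses (tU : trivIset setT U) (mU : forall i, mble (U i)) (FE' : F `<=` E').
Hypotheses (mB : forall i, mble (Bs i)) (UB : forall i, U i `<=` Bs i).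
Hypothesis Upos : forall i, U i !=set0 -> 0 < m (U i).
Hypothesis Udist : forall i y y', U i y -> U i y' -> (mdist y y' < rho)%R.
Hypothesis Uball : forall i y y', U i y -> U i y' ->
  ball y (2 * mdist y y')%R `<=` Bs i.
Variables (b : X -> B1) (Tb : X -> B2).
Hypotheses (sb : strongly_measurable m b) (sTb : strongly_measurable m Tb).
Hypothesis b_mean : forall i, bint mu (cutoff (U i) b) 0%R.
Hypothesis Tb_kernel : \forall x \ae m, (E `\` F) x ->
  bochner_integral_eq mu F (fun y => K (x, y) (b y)) (Tb x).

(** The ball excluded in Hormander's integral at the pair [yy i], [y] lies in [Bs i] by [Uball], so
    that its domain contains [G]. After Tonelli's theorem each [U i] contributes at most [C] times
    the integral of [|b|] over it. *)
Lemma bad_part : \int[m]_(x in G) (`|Tb x|)%:E <= C%:E * \int[m]_(y in F) (`|b y|)%:E.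
Proof.
have [W [cW KW Wx Wy]] := kernel_sections mS Soo mE mE' ES ES' Km.
pose Wu := \bigcup_n W n.
have aeF : Filter (nbhs (almost_everywhere m)).
  exact: (@ae_filter_ringOfSetsType _ (radonType mu) R m).
have mG : mble G by apply: measurableD => //; exact: bigcupT_measurable.
(* A point in general position of [U i], so that the Hormander condition and the
   continuity of [K] on the compact sets [W n] are available for it. *)
have centre i : exists y, U i !=set0 -> [/\ U i y,
    \forall y' \ae m, E' y' -> (mdist y y' < rho)%R ->
      \int[m]_(x in E `\` ball (y : X) (2 * mdist y y'))
        `|K (x, y) - K (x, y')|%:E <= C%:E &
    \forall x \ae m, E x -> Wu (x, y)].
  have [Une|Ue] := pselect (U i !=set0); last by exists point.
  have [N [mN N0 NP]] : \forall y \ae m, E' y -> 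
    (\forall y' \ae m, E' y' -> (mdist y y' < rho)%R ->
      \int[m]_(x in E `\` ball (y : X) (2 * mdist y y'))
        `|K (x, y) - K (x, y')|%:E <= C%:E) /\
    (\forall x \ae m, E x -> Wu (x, y)).
    apply: filterS2 hormander Wy => y h1 h2 Ey; split; [exact: h1|exact: h2].
  apply: contrapT => nex.
  (* Without a suitable point, [U i], of positive measure, would be contained in the null set
     [N]. *)
  have : U i `<=` N.
    move=> y Uy; apply: NP => /= h; apply: nex; exists y => _.
    by have [] := h (FE' (ex_intro2 _ _ i I Uy)).
  move=> /(le_radon_ext mu); rewrite [X in _ <= X]N0 => /(lt_le_trans (Upos Une)).
  by rewrite ltxx.
have [yy yyP] := choice centre.
(* [Q i] is a countable union of compact sets on which both [K (x, y)] and [K (x, yy i)] are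
   continuous, so that their difference is jointly measurable there. Almost every pair of interest
   lies in [Q i], and multiplying by its indicator in [h] loses nothing. *)
pose Q i := [set z : XX | Wu z /\ Wu (z.1, yy i)].
pose kd i (z : XX) : R := `|K z - K (z.1, yy i)|%R.
have mQk i : measurable (Q i) /\ measurable_fun (Q i) (kd i).
  pose P (n k : nat) : set (X * X) := [set z | W n z /\ W k (z.1, yy i)].
  have cP n k : compact (P n k).
    apply: (@subclosed_compact _ _ (W n)) => //; last by move=> z [].
    have -> : P n k = W n `&` (fun z : X * X => (z.1, yy i)) @^-1` (W k) by [].
    apply: closedI; first exact: (compact_closed (@prod_hausdorff _ X)).
    apply: closed_comp; last exact: (compact_closed (@prod_hausdorff _ X)).
    by move=> z _; apply: cvg_pair; [exact: cvg_fst|exact: cvg_cst].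
  have QE : Q i = \bigcup_n \bigcup_k P n k.
    apply/seteqP; split => [z [[n _ Wn] [k _ Wk]]|z [n _ [k _ [Wn Wk]]]].
      by exists n => //; exists k.
    by split; [exists n|exists k].
  have mP n k : measurable (P n k : set XX) by exact: compact_prod_measurable.
  rewrite QE; split.
    by apply: bigcupT_measurable => n; exact: bigcupT_measurable.
  apply/measurable_fun_bigcup => [n|n]; first exact: bigcupT_measurable.
  apply/measurable_fun_bigcup => // k.
  apply: (@within_compact_measurable _ _ mu (P n k) (kd i) (cP n k)).
  have c1 : {within P n k, continuous K}.
    by apply: continuous_subspaceW (KW n) => z [].
  have c2 : {within P n k, continuous (K \o (fun z => (z.1, yy i)))}.
    apply: within_continuous_comp (KW k) => [z [] //|z].
    by apply: cvg_pair; [exact: cvg_fst|exact: cvg_cst].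
  move=> z; apply: cvg_norm; apply: cvgB; [exact: c1|exact: c2].
have mQ i := (mQk i).1; have mkd i := (mQk i).2.
pose h i (z : XX) : R :=
  (\1_G z.1 * (\1_(U i) z.2 * (\1_(Q i) z * kd i z * `|b z.2|)))%R.
have h0 i z : (0 <= h i z)%R by rewrite /h /kd !mulr_ge0.
have mq i : measurable_fun [set: XX] (fun z => \1_(Q i) z * kd i z)%R.
  have := (measurable_restrictT (kd i) (mQ i)).1 (mkd i).
  congr measurable_fun; apply/funext => z.
  by rewrite patch_indic mulrC.
have mh i : measurable_fun [set: XX] (h i).
  apply: measurable_funM.
    by apply: (measurableT_comp (measurable_indic _)) => //; exact: measurable_fst.
  apply: measurable_funM.
    by apply: (measurableT_comp (measurable_indic _)) => //; exact: measurable_snd.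
  apply: measurable_funM; last first.
    by apply: (measurableT_comp (sm_norm_measurable sb)); exact: measurable_snd.
  exact: mq.
have mhE i : measurable_fun [set: XX] (fun z => (h i z)%:E) by exact/measurable_EFinP.
have hE0 i z : 0 <= (h i z)%:E by rewrite lee_fin.
pose J i x := \int[nu]_y (h i (x, y))%:E.
have J0 i x : 0 <= J i x by exact: integral_ge0.
have mJ i : measurable_fun [set: radonType mu] (J i).
  exact: (measurable_fun_fubini_tonelli_F (m2 := nu) _ (mhE i) (hE0 i)).
have mb A : measurable_fun (A : set (radonType mu)) (fun x => (`|b x|)%:E).
  by apply: measurable_funTS; exact: sm_enorm.
have mTb A : measurable_fun (A : set (radonType mu)) (fun x => (`|Tb x|)%:E).
  by apply: measurable_funTS; exact: sm_enorm.
have intJ i : \int[nu]_x J i x <= C%:E * \int[m]_(y in U i) (`|b y|)%:E.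
  rewrite (_ : \int[nu]_x J i x = \int[nu]_y \int[nu]_x (h i (x, y))%:E); last first.
    exact: (fubini_tonelli (m1 := nu) (m2 := nu) (fun z => (h i z)%:E)).
  rewrite -ge0_integralZl//; last by rewrite lee_fin ltW.
  pose Cb : radonType mu -> \bar R := (fun y => C%:E * (`|b y|)%:E) \_ (U i).
  have Cb0 y : 0 <= Cb y.
    by rewrite /Cb patchE; case: ifPn => // _; rewrite mule_ge0// lee_fin ltW.
  have mCb : measurable_fun setT Cb.
    apply/(measurable_restrictT _ (mU i)); apply: emeasurable_funM; last exact: mb.
    exact: measurable_cst.
  rewrite [leRHS]integral_mkcond.
  apply: (@le_trans _ _ (\int[nu]_y Cb y)).
    apply: ae_ge0_le_integral => //.
    - by move=> y _; exact: integral_ge0.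
    - exact: (measurable_fun_fubini_tonelli_G (m1 := nu) _ (mhE i) (hE0 i)).
    have [Une|Ue] := pselect (U i !=set0); last first.
      apply: aeW => y _; rewrite integral0_eq /Cb ?patchE.
        by case: ifPn => // _; rewrite mule_ge0// lee_fin ltW.
      move=> x _; rewrite /h [\1_(U i) _]indicE memNset ?mul0r ?mulr0//= => Uy.
      by apply: Ue; exists y.
    have [Uyy Hyy _] := yyP i Une.
    apply: ae_mfrestr; apply: filterS Hyy => y Hy Sy _.
    rewrite /Cb patchE; case: ifPn => [/set_mem Uy|/negP nU]; last first.
      rewrite integral0_eq// => x _; rewrite /h [\1_(U i) _]indicE memNset ?mul0r ?mulr0//=.
      by move=> Uy; apply: nU; rewrite inE.
    have := Hy (FE' (ex_intro2 _ _ i I Uy)) (Udist Uyy Uy) => {}Hy.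
    pose l x := (\1_G x * (\1_(Q i) (x, y) * kd i (x, y)))%R%:E.
    have l0 x : 0 <= l x by rewrite /l /kd lee_fin !mulr_ge0.
    have ml : measurable_fun [set: radonType mu] l.
      apply/measurable_EFinP; apply: measurable_funM; first exact: measurable_indic.
      exact: (measurableT_comp (mq i) (@pair2_measurable _ _ (radonType mu) (radonType mu) y)).
    under eq_integral => x _.
      rewrite (_ : (h i (x, y))%:E = (`|b y|)%:E * l x); last first.
        by rewrite /l /h /= [\1_(U i) _]indicE mem_set// mul1r -EFinM; congr EFin; ring.
      over.
    rewrite ge0_integralZl// muleC lee_wpmul2r//.
    rewrite integral_mfrestr//; apply: le_trans Hy.
    rewrite integral_mkcond [leRHS]integral_mkcond; apply: le_integral_ge0 => x _.
      by rewrite patchE; case: ifPn.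
    rewrite [leLHS]patchE [leRHS]patchE.
    have -> : (point : \bar R) = 0 by [].
    case: (x \in S); last by case: ifP => // _; rewrite lee_fin.
    have [Gx|nG] := pselect (G x); last first.
      by rewrite /l indicE memNset// mul0r; case: ifP => // _; rewrite lee_fin.
    rewrite mem_set; last first.
      by case: Gx => Ex nB; split => // xb; apply: nB; exists i => //; exact: (Uball Uyy Uy).
    have q1 : (\1_(Q i) (x, y) <= 1 :> R)%R by rewrite indicE; case: ((x, y) \in Q i).
    rewrite /l [\1_G _]indicE mem_set// mul1r distrC lee_fin.
    rewrite -[leRHS]/(kd i (x, y)); apply: ler_piMl => //; exact: normr_ge0.
  by rewrite integral_mfrestr//; apply: ge0_subset_integral.
have TbJ : \forall x \ae m, G x -> (`|Tb x|)%:E <= \sum_(0 <= i <oo) J i x.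
  have hyy : \forall x \ae m, forall i, U i !=set0 -> E x -> Wu (x, yy i).
    apply: ae_foralln => i; have [Une|Ue] := pselect (U i !=set0).
      have [_ _ h1] := yyP i Une.
      by apply: (filterS (F := nbhs (almost_everywhere m)) _ h1) => x h2 _.
    by apply: (@aeW _ (radonType mu)) => x /Ue.
  apply: filterS3 hyy Wx Tb_kernel => x hyy Wx' Tbx [Ex nB].
  have nF : ~ F x by move=> [i _ Ux]; apply: nB; exists i => //; exact: UB.
  have [[skx koo] bkx] := Tbx (conj Ex nF).
  pose hx := cutoff F (fun y => K (x, y) (b y)).
  (* It has integral zero, as the image of the mean of [b] on [U i] under the continuous linear map
     [K (x, yy i)]. *)
  pose k i := K (x, yy i) \o cutoff (U i) b.
  have scb i : strongly_measurable m (cutoff (U i) b) by exact: sm_cutoff.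
  have sk i : strongly_measurable m (k i).
    by apply: sm_comp => //; exact: cont_linear_continuous.
  have shx : strongly_measurable m hx by [].
  apply: (@le_trans _ _ (\sum_(0 <= i <oo) \int[m]_(y in U i) (`|hx y - k i y|)%:E)).
    apply: bint_cancel => //.
    - by move=> y nFy; exact: cutoff_out.
    - move: koo; rewrite integral_mkcond; congr (_ < _); apply: eq_integral => y _.
      rewrite patchE /hx; case: ifPn => [/set_mem/cutoff_in ->//|/negP nFy].
      by rewrite cutoff_out ?normr0// => Fy; apply: nFy; rewrite inE.
    - by move=> i y nU; rewrite /k /= cutoff_out// linear0.
    - move=> i; rewrite -(linear0 (K (x, yy i))).
      apply: (@bint_linear _ _ mu _ _ (K (x, yy i)) `|K (x, yy i)|%R) => //.
        exact: cont_linear_continuous.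
      exact: cont_linear_norm.
  apply: lee_nneseries => [i _ _|i _]; first exact: integral_ge0.
  rewrite /J integral_mfrestr//; last first.
    exact: (measurableT_comp (mhE i) (@pair1_measurable _ _ (radonType mu) (radonType mu) x)).
  have mhx A : measurable_fun (A : set (radonType mu)) (fun y => (h i (x, y))%:E).
    by apply: measurable_funTS; exact: (measurableT_comp (mhE i) (@pair1_measurable _ _ (radonType mu) (radonType mu) x)).
  apply: (@le_trans _ _ (\int[m]_(y in U i) (h i (x, y))%:E)); last first.
    by apply: ge0_subset_integral => // y Uy; apply/ES'/FE'; exists i.
  apply: ae_ge0_le_integral => //.
    by apply: measurable_funTS; apply: sm_enorm; exact: smB.
  apply: filterS (Wx' Ex) => y Wxy Uy.
  have Fy : F y by exists i.
  have Wxyy : Wu (x, yy i) by apply: hyy => //; exists y.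
  rewrite lee_fin /hx /k /= !cutoff_in// /h /= !indicE !mem_set//=; last first.
    by split => //; exact: Wxy (FE' Fy).
  by rewrite !mul1r -cont_linearB; exact: cont_linear_norm.
apply: (@le_trans _ _ (\int[m]_(x in G) \sum_(0 <= i <oo) J i x)).
  apply: ae_ge0_le_integral => //.
  - by move=> x _; exact: nneseries_ge0.
  - by apply: measurable_funTS; exact: ge0_emeasurable_sum.
rewrite integral_nneseries//; last by move=> i; exact: measurable_funTS.
rewrite ge0_integral_bigcup// -nneseriesZl; last by move=> i _; exact: integral_ge0.
apply: lee_nneseries => [i _ _|i _]; first exact: integral_ge0.
apply: le_trans (intJ i); rewrite integral_mfrestr//.
by apply: ge0_subset_integral => //; [exact: measurable_funTS|move=> x [/ES]].
Qed.
End bad_part.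

(** * Lebesgue-Bochner norms *)

Lemma integral_chebyshev d (T : measurableType d) (R : realType)
    (m : {measure set T -> \bar R}) (D : set T) (h : T -> R) (l : R) :
  measurable D -> measurable_fun D h -> (forall x, D x -> 0 <= h x)%R -> (0 < l)%R ->
  m (D `&` [set x | l < h x]%R) <= (l^-1)%:E * \int[m]_(x in D) (h x)%:E.
Proof.
move=> mD mh h0 l0.
have mS : measurable (D `&` [set x | l < h x]%R).
  have -> : [set x | l < h x]%R = h @^-1` `]l, +oo[.
    by apply/seteqP; split => x /=; rewrite in_itv/= andbT.
  exact: mh.
rewrite -lee_pdivrMl ?invr_gt0// invrK.
rewrite -integral_cst//.
apply: (@le_trans _ _ (\int[m]_(x in D `&` [set x | l < h x]%R) (h x)%:E)).
  apply: ge0_le_integral => //.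
  - by move=> x _; rewrite lee_fin ltW.
  - by apply/measurable_EFinP; apply: measurable_funS mh.
  - by move=> x [_ /= lh]; rewrite lee_fin ltW.
apply: ge0_subset_integral => //.
  exact/measurable_EFinP.
Qed.

Lemma Lnorm_normE d (T : measurableType d) (R : realType)
    (m : {measure set T -> \bar R}) (V : normedModType R) (s : R) (f : T -> V) :
  Lnorm m s%:E (fun x => (`|f x|)%:E) = (\int[m]_x (`|f x| `^ s)%:E) `^ s^-1.
Proof.
rewrite unlock; congr (_ `^ _); apply: eq_integral => x _.
by rewrite abse_EFin normr_id poweR_EFin.
Qed.

Section ae_facts.
Context {R : realType} {X : pmetricType R} (mu : radon_measure X).
Local Notation m := (radon_ext mu).

Lemma ae_everywhere (P : X -> Prop) : (forall x, P x) -> \forall x \ae m, P x.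
Proof. exact: (@aeW _ (radonType mu)). Qed.

Lemma ae_mono (P Q : X -> Prop) : (forall x, P x -> Q x) ->
  (\forall x \ae m, P x) -> \forall x \ae m, Q x.
Proof. by move=> PQ [N [mN N0 NP]]; exists N; split => // x nQ; apply: NP => /= /PQ. Qed.

Lemma ae_mono2 (P Q S : X -> Prop) : (forall x, P x -> Q x -> S x) ->
  (\forall x \ae m, P x) -> (\forall x \ae m, Q x) -> \forall x \ae m, S x.
Proof.
have aeF : Filter (nbhs (almost_everywhere m)).
  exact: (@ae_filter_ringOfSetsType _ (radonType mu) R m).
exact: filterS2.
Qed.

Lemma ae_le_measure (P Q : set X) : measurable (Q : set (radonType mu)) ->
  (\forall x \ae m, P x -> Q x) -> m P <= m Q.
Proof.
move=> mQ [N [mN N0 NP]]; apply: (@le_trans _ _ (m (Q `|` N))).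
  apply: le_radon_ext => x Px; have [Qx|nQ] := pselect (Q x); first by left.
  by right; apply: NP => /= /(_ Px).
by apply: le_trans (radon_extU_le mQ mN) _; rewrite N0 adde0.
Qed.

End ae_facts.

Section lp_facts.
Context {R : realType} {X : pmetricType R} (mu : radon_measure X).
Local Notation m := (radon_ext mu).
Local Notation mble A := (measurable (A : set (radonType mu))).
Context {V : normedModType R}.

Lemma Lp_normE (s : R) (f : X -> V) :
  Lp_norm mu s%:E f = (\int[m]_x (`|f x| `^ s)%:E) `^ s^-1.
Proof. exact: (@Lnorm_normE _ (radonType mu)). Qed.

Lemma Lp_norm_powR (s : R) (f : X -> V) : (0 < s)%R ->
  Lp_norm mu s%:E f `^ s = \int[m]_x (`|f x| `^ s)%:E.
Proof.
move=> s0; rewrite Lp_normE -poweRrM mulVf ?gt_eqF// poweRe1//.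
by apply: integral_ge0 => x _; rewrite lee_fin powR_ge0.
Qed.

Lemma Lp_norm_oo_le (k : R) (f : X -> V) : (0 <= k)%R ->
  (\forall x \ae m, `|f x| <= k)%R -> Lp_norm mu +oo f <= k%:E.
Proof.
move=> k0 fk; rewrite /Lp_norm unlock; case: ifPn => // _.
apply/ess_supP; apply: ae_mono fk => x fx.
by rewrite /= normr_id lee_fin.
Qed.

Lemma Lp_norm_oo_ae (k : R) (f : X -> V) : 0 < m setT ->
  Lp_norm mu +oo f <= k%:E -> \forall x \ae m, (`|f x| <= k)%R.
Proof.
move=> m0; rewrite /Lp_norm unlock m0 => /ess_supP; apply: ae_mono => x.
by rewrite /= normr_id lee_fin.
Qed.

Lemma bounded_cut_Lp (r : \bar R) (A : set X) (k : R) (f : X -> V) : 0 < r ->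
  strongly_measurable m f -> (forall x, `|f x| <= k)%R -> mble A -> m A < +oo ->
  (forall x, ~ A x -> f x = 0%R) -> cut_Lp mu A r f.
Proof.
move=> r0 sf fk mA Aoo f0; exists f; last first.
  apply: ae_everywhere => x; have [Ax|nA] := pselect (A x).
    by rewrite cutoff_in.
  by rewrite cutoff_out// f0.
split => //; have k0 : (0 <= k)%R by exact: le_trans (fk point).
case: r r0 => [s||//] s0; last first.
  apply: (@le_lt_trans _ _ k%:E); last exact: ltry.
  by apply: Lp_norm_oo_le => //; exact: ae_everywhere.
rewrite lte_fin in s0; rewrite Lp_normE; apply: poweR_lty.
apply: (@le_lt_trans _ _ (\int[m]_(x in A) (k `^ s)%:E)).
  rewrite [leRHS]integral_mkcond; apply: le_integral_ge0 => x _.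
    by rewrite lee_fin powR_ge0.
  rewrite patchE; case: ifPn => [_|/negP nA].
    by rewrite lee_fin; apply: ge0_ler_powR; rewrite ?nnegrE//; exact: ltW.
  rewrite f0 ?normr0 ?powR0 ?gt_eqF// => Ax; apply: nA; rewrite inE//.
by rewrite integral_cst// lte_mul_pinfty ?lee_fin ?powR_ge0.
Qed.

End lp_facts.

(** * Weak estimates drawn from the bound on L^r *)

Section operator.
Context {R : realType} {X : pmetricType R} (mu : radon_measure X).
Local Notation m := (radon_ext mu).
Local Notation mble A := (measurable (A : set (radonType mu))).
Context {V W : normedModType R}.
Variables (r : \bar R) (r1 : 1 < r) (A : R) (A0 : (0 < A)%R).
Variables (E E' : set X) (mE : mble E) (mu0 : 0 < m setT).
Variable T : (X -> V) -> (X -> W).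
Hypothesis Tlin : continuous_linear_Lp mu r E' E T.
Hypothesis Tbound : forall f : X -> V, cut_Lp mu E' r f ->
  Lp_norm mu r (T f) <= A%:E * Lp_norm mu r f.

Lemma operator_sm f : cut_Lp mu E' r f -> strongly_measurable m (T f).
Proof.
move=> cf; have [TE _ _ _] := Tlin; have [g [sg _] Tg] := TE f cf.
apply: sm_ae (sm_cutoff mE sg) _.
by apply: ae_mono Tg => x.
Qed.

Lemma operator_supp f : cut_Lp mu E' r f -> \forall x \ae m, ~ E x -> T f x = 0%R.
Proof.
move=> cf; have [TE _ _ _] := Tlin; have [g [sg _]] := TE f cf.
by apply: ae_mono => x -> nE; rewrite cutoff_out.
Qed.

Lemma operator_add f g : cut_Lp mu E' r f -> cut_Lp mu E' r g ->
  \forall x \ae m, T (fun z => f z + g z)%R x = (T f x + T g x)%R.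
Proof.
move=> cf cg; have [_ _ TD _] := Tlin; have := TD 1%R f g cf cg.
rewrite (_ : (fun z => 1 *: f z + g z)%R = (fun z => f z + g z)%R).
  by apply: ae_mono => x ->; rewrite scale1r.
by apply/funext => z; rewrite scale1r.
Qed.

Lemma measurable_norm_gt (h : X -> W) (l : R) : strongly_measurable m h ->
  mble [set x | (l < `|h x|)%R].
Proof.
move=> /sm_norm_measurable mh.
have -> : [set x | (l < `|h x|)%R] = (fun x => `|h x|)%R @^-1` `]l, +oo[.
  by apply/seteqP; split => x /=; rewrite in_itv/= andbT.
by rewrite -[X in measurable X]setTI; exact: mh.
Qed.

Lemma operator_power_le (s : R) f : r = s%:E -> cut_Lp mu E' r f ->
  \int[m]_x (`|T f x| `^ s)%:E <= (A `^ s)%:E * \int[m]_x (`|f x| `^ s)%:E.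
Proof.
move=> rs cf; have s1 : (1 < s)%R by move: r1; rewrite rs lte_fin.
have s0 : (0 < s)%R by exact: lt_trans s1.
rewrite -!Lp_norm_powR// -poweR_EFin -poweRM ?Lnorm_ge0 ?lee_fin ?(ltW A0)//.
have := Tbound cf; rewrite rs => h; apply: gt0_ler_poweR h; first exact: ltW.
  by rewrite in_itv/= Lnorm_ge0 leey.
by rewrite in_itv/= mule_ge0 ?Lnorm_ge0 ?lee_fin ?(ltW A0)// leey.
Qed.

Lemma operator_weak_power (s : R) f (l : R) : r = s%:E -> (0 < l)%R -> cut_Lp mu E' r f ->
  m [set x | (l < `|T f x|)%R] <= ((A / l) `^ s)%:E * \int[m]_x (`|f x| `^ s)%:E.
Proof.
move=> rs l0 cf; have s1 : (1 < s)%R by move: r1; rewrite rs lte_fin.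
have s0 : (0 < s)%R by exact: lt_trans s1.
have sT := operator_sm cf; have mT := sm_norm_measurable sT.
have -> : [set x | (l < `|T f x|)%R] = setT `&` [set x | l `^ s < `|T f x| `^ s]%R.
  rewrite setTI; apply/seteqP; split => x /= h.
    by apply: gt0_ltr_powR; rewrite ?nnegrE// ltW.
  rewrite ltNge; apply/negP => h'; move: h; rewrite ltNge => /negP; apply.
  by apply: ge0_ler_powR; rewrite ?nnegrE// ltW.
have mTs : measurable_fun [set: radonType mu] (fun x => `|T f x| `^ s)%R.
  exact: (measurableT_comp (measurable_powR s) mT).
apply: (le_trans (@integral_chebyshev _ (radonType mu) _ m setT _ _ _ mTs _ _)) => //.
  exact: powR_gt0.
have le1 := operator_power_le rs cf.
have ls0 : 0 <= ((l `^ s)^-1)%:E by rewrite lee_fin invr_ge0 powR_ge0.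
apply: (le_trans (lee_wpmul2l ls0 le1)).
rewrite muleA -EFinM powRM ?invr_ge0 ?(ltW l0) ?(ltW A0)//.
have -> : (l^-1 `^ s = (l `^ s)^-1)%R.
  by rewrite -powR_inv1 ?(ltW l0)// -powRrM mulN1r powRN.
by rewrite mulrC.
Qed.

Lemma operator_weak_oo f (k : R) : r = +oo -> (0 <= k)%R -> cut_Lp mu E' r f ->
  (\forall x \ae m, `|f x| <= k)%R -> m [set x | (A * k < `|T f x|)%R] = 0.
Proof.
move=> roo k0 cf fk; have sT := operator_sm cf.
have : \forall x \ae m, (`|T f x| <= A * k)%R.
  apply: (Lp_norm_oo_ae mu0); rewrite -roo; apply: (le_trans (Tbound cf)).
  rewrite EFinM lee_wpmul2l ?lee_fin ?(ltW A0)// roo.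
  exact: Lp_norm_oo_le.
move=> [N [mN N0 NP]]; apply/eqP; rewrite -measure_le0 -N0.
by apply: le_radon_ext => x /= h; apply: NP => /=; rewrite leNgt h.
Qed.

(** If [r] is a real [s], then [|f| ^ s <= (l / A) ^ (s - 1) |f|] and Chebyshev's factor
    [(A / l) ^ s] reduces to [A / l]. If [r] is infinite, [|T f|] is at most [l] almost everywhere
    and the set is null. The resulting bound is thus the same for every [r]. *)
Lemma operator_weak_bounded f (l : R) : (0 < l)%R -> cut_Lp mu E' r f ->
  strongly_measurable m f -> (\forall x \ae m, `|f x| <= l / A)%R ->
  m [set x | (l < `|T f x|)%R] <= (A / l)%:E * \int[m]_x (`|f x|)%:E.
Proof.
move=> l0 cf sf fl.
have k0 : (0 < l / A)%R by rewrite divr_gt0.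
have [[s rs]|roo] : (exists s, r = s%:E) \/ r = +oo.
  by case: (r) r1 => [s||//]; [left; exists s|right].
- apply: (le_trans (operator_weak_power rs l0 cf)).
  have s1 : (1 < s)%R by move: r1; rewrite rs lte_fin.
  have mf := sm_norm_measurable sf.
  apply: (@le_trans _ _ (((A / l) `^ s)%:E * \int[m]_x (((l / A) `^ (s - 1))%:E * (`|f x|)%:E))).
    rewrite lee_wpmul2l ?lee_fin ?powR_ge0//; apply: ae_ge0_le_integral => //.
    - by apply/measurable_EFinP; exact: (measurableT_comp (measurable_powR s) mf).
    - by move=> x _; rewrite mule_ge0 ?lee_fin ?powR_ge0.
    - by apply: emeasurable_funM; [exact: measurable_cst|exact/measurable_EFinP].
    apply: ae_mono fl => x fl _; rewrite -EFinM lee_fin.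
    have [->|f0] := eqVneq (f x) 0%R.
      by rewrite normr0 powR0 ?mulr0// gt_eqF// (lt_trans _ s1).
    have nf0 : (`|f x| != 0)%R by rewrite normr_eq0.
    rewrite -[X in (X <= _)%R](_ : (`|f x| `^ (s - 1) * `|f x|)%R = _).
      rewrite ler_wpM2r//; apply: ge0_ler_powR; rewrite ?nnegrE ?(ltW k0)//.
      by rewrite subr_ge0 ltW.
    rewrite -[X in (_ * X)%R]powRr1// -powRD ?subrK//.
    by rewrite nf0 implybT.
  rewrite ge0_integralZl//; last 2 first.
  - exact/measurable_EFinP.
  - by rewrite lee_fin powR_ge0.
  rewrite muleA -EFinM.
  rewrite (_ : (A / l) `^ s * (l / A) `^ (s - 1) = A / l)%R//.
  have al0 : (0 <= A / l)%R by rewrite divr_ge0 ?ltW.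
  have -> : (l / A = (A / l) `^ (-1))%R by rewrite powR_inv1// invf_div.
  rewrite -powRrM.
  rewrite -powRD ?(gt_eqF (divr_gt0 A0 l0)) ?implybT//.
  by rewrite mulN1r opprB addrC subrK powRr1.
- have := operator_weak_oo roo (ltW k0) cf fl; rewrite mulrC divfK ?gt_eqF// => ->.
  by apply: mule_ge0; [rewrite lee_fin divr_ge0 ?ltW|exact: integral_ge0].
Qed.

End operator.

(** * Weak type (1,1) *)

Section good_function.
Context {R : realType} {X : pmetricType R} (mu : radon_measure X).
Local Notation m := (radon_ext mu).
Local Notation mble A := (measurable (A : set (radonType mu))).

Lemma set_ball_bigcup (A : set X) (c : R) :
  set_ball A c = \bigcup_(a in A) ball a c.
Proof.
apply/seteqP; split => [y /= /ereal_inf_lt[_ [a Aa <-]]|y [a Aa /ball_mdist ay]].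
  by rewrite lte_fin metric_sym => ya; exists a => //; exact/ball_mdist.
apply: (@le_lt_trans _ _ (mdist y a)%:E); last by rewrite lte_fin metric_sym.
by apply: ereal_inf_lbound; exists a.
Qed.

Lemma set_ball_open (A : set X) (c : R) : open (set_ball A c).
Proof. by rewrite set_ball_bigcup; apply: bigcup_open => a _; exact: mball_open. Qed.

Section averages.
Context {V : completeNormedModType R}.
Variables (U : nat -> set X) (tU : trivIset setT U) (mU : forall i, mble (U i)).
Variables (S : set X) (mS : mble S) (Soo : m S < +oo) (US : \bigcup_i U i `<=` S).
Hypothesis Upos : forall i, U i !=set0 -> 0 < m (U i).
Variables (f : X -> V) (M : R) (sf : strongly_measurable m f).
Hypothesis fM : forall x, (`|f x| <= M)%R.
Local Notation F := (\bigcup_i U i).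

(** [g] is a conditional expectation: on [U i] it is the Bochner integral [w i] divided by the
    measure of [U i], and off [F] it is [f] itself. *)
Lemma conditional_average : exists g : X -> V, [/\ strongly_measurable m g,
  forall x, ~ F x -> g x = f x,
  forall i, bint mu (cutoff (U i) (fun x => f x - g x)%R) 0%R,
  forall i x, U i x -> (`|g x|)%:E * m (U i) <= \int[m]_(y in U i) (`|f y|)%:E &
  forall i, \int[m]_(x in U i) (`|g x|)%:E <= \int[m]_(x in U i) (`|f x|)%:E].
Proof.
have Uoo i : m (U i) < +oo.
  by apply: le_lt_trans Soo; apply: le_radon_ext => x Ux; apply: US; exists i.
have M0 : (0 <= M)%R by exact: le_trans (fM point).
have scf i : strongly_measurable m (cutoff (U i) f) by exact: sm_cutoff.
have /choice[w wP] : forall i, exists w, bint mu (cutoff (U i) f) w.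
  move=> i; apply: (@bint_exists _ _ mu _ _ (U i) M) => //.
  - move=> x; have [Ux|nU] := pselect (U i x); first by rewrite cutoff_in.
    by rewrite cutoff_out// normr0.
  - by move=> x nU; rewrite cutoff_out.
have w_le i : (`|w i|)%:E <= \int[m]_(x in U i) (`|f x|)%:E.
  apply: (le_trans (bint_le (scf i) (wP i))).
  rewrite [leRHS]integral_mkcond; apply: le_integral_ge0 => // x _.
  rewrite patchE; case: ifPn => [/set_mem Ux|/negP nU]; first by rewrite cutoff_in.
  by rewrite cutoff_out ?normr0// => Ux; apply: nU; rewrite inE.
pose a i := fine (m (U i)).
have aE i : m (U i) = (a i)%:E by rewrite fineK// ge0_fin_numE.
have a0 i : (0 <= a i)%R by exact: fine_ge0.
pose c i := ((a i)^-1 *: w i)%R.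
have ac i : (a i *: c i = w i)%R.
  (* A piece of measure zero is empty by [Upos], and then [w i] vanishes, so that the division by
     zero in [c i] is harmless. *)
  rewrite /c scalerA; have [ai0|an0] := eqVneq (a i) 0%R; last first.
    by rewrite divff ?scale1r.
  have [Une|Ue] := pselect (U i !=set0).
    by have := Upos Une; rewrite aE ai0 lte_fin ltxx.
  have := w_le i; rewrite (_ : U i = set0); last first.
    by rewrite -subset0 => x Ux; apply: Ue; exists x.
  by rewrite integral_set0 lee_fin normr_le0 => /eqP ->; rewrite scaler0.
pose ix x := xget 0%N [set i | U i x].
have ixE i x : U i x -> ix x = i.
  move=> Ux; rewrite /ix; case: xgetP => [j _ /= Uj|]; last by move=> /(_ i Ux).
  by apply: contrapT => /eqP ji; move/trivIsetP : tU => /(_ j i I I ji);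
    rewrite -subset0 => /(_ x); apply.
pose g x := if x \in F then c (ix x) else f x.
have gF x : ~ F x -> g x = f x by move=> nF; rewrite /g memNset.
have gU i x : U i x -> g x = c i.
  by move=> Ux; rewrite /g mem_set ?(ixE i)//; exists i.
exists g.
have cle i : (`|c i|)%:E * m (U i) <= \int[m]_(y in U i) (`|f y|)%:E.
  apply: le_trans (w_le i); rewrite aE -EFinM lee_fin -[in leRHS]ac.
  by rewrite [leRHS]normrZ ger0_norm// mulrC.
have sg : strongly_measurable m g.
  apply: (@sm_bigcup _ _ mu _ (fun i => if i is j.+1 then U j else ~` F)
    (fun i => if i is j.+1 then cst (c j) else f)).
  - move=> [|i] //; apply: measurableC; exact: bigcupT_measurable.
  - apply/seteqP; split => // x _; have [[i _ Ux]|nF] := pselect (F x).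
      by exists i.+1.
    by exists 0%N.
  - by move=> [|i] //; exact: (@sm_cst _ _ mu _ (c i)).
  - by move=> [|i] x; [exact: gF|exact: gU].
split => //.
- move=> i.
  have -> : cutoff (U i) (fun x => f x - g x)%R =
      (fun x => cutoff (U i) f x - cutoff (U i) (cst (c i)) x)%R.
    apply/funext => x; have [Ux|nU] := pselect (U i x).
      by rewrite !cutoff_in// (gU i).
    by rewrite !cutoff_out// subr0.
  rewrite -(subrr (w i)) -[X in (_ - X)%R]ac; apply: bintB => //.
    by apply: sm_cutoff => //; exact: (@sm_cst _ _ mu _ (c i)).
  exact: bint_cutoff_cst.
- by move=> i x Ux; rewrite (gU i).
- move=> i; apply: le_trans (cle i); rewrite -integral_cst//.
  by apply: le_integral_ge0 => // x Ux; rewrite (gU i).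
Qed.

End averages.
End good_function.

Lemma half_bounds (R : realType) (rho : R) : (0 < rho)%R ->
  (rho + rho / 2 < 2 * rho)%R /\ (rho / 2 <= 6 * rho)%R.
Proof. by move=> rho0; split; lra. Qed.

Lemma set_ball_subset (R : realType) (X : pmetricType R) (E : set X) (x0 : X) (rho : R) :
  (0 < rho)%R -> E x0 -> (forall x y, E x -> E y -> (mdist x y < rho)%R) ->
  set_ball E (rho / 2) `<=` ball x0 (2 * rho)%R.
Proof.
move=> rho0 Ex0 Ed; rewrite set_ball_bigcup => y [a Ea /ball_mdist ay].
apply/ball_mdist; apply: le_lt_trans (metric_triangle x0 a y) _.
exact: lt_trans (ltrD (Ed _ _ Ex0 Ea) ay) (half_bounds rho0).1.
Qed.

(** The first inequality serves the case of a large average over a ball of radius [rho / 2]. The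
    second adds up the good part [2 A], the measure of the enlarged balls [2 A D ^ 5] and the bad
    part [4 C]. *)
Lemma weak_constants (R : realType) (D A C : R) : (1 <= D)%R -> (0 < A)%R ->
  (0 < C)%R -> (D * (2 * A * D) <= 4 * (D ^+ 5 * A + C))%R /\
  (2 * A + (2 * A * D ^+ 5 + 4 * C) <= 4 * (D ^+ 5 * A + C))%R.
Proof.
move=> D1 A0 C0.
have h1 : (A * D ^+ 2 <= A * D ^+ 5)%R by rewrite ler_pM2l// ler_weXn2l.
have h2 : (A * 1 <= A * D ^+ 5)%R by rewrite ler_pM2l// exprn_ege1.
have -> : (D * (2 * A * D) = 2 * (A * D ^+ 2))%R by ring.
have h3 : (0 <= A * D ^+ 2)%R by rewrite mulr_ge0 ?sqr_ge0 ?ltW.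
rewrite -![(2 * A * D ^+ 5)%R]mulrA [(D ^+ 5 * A)%R]mulrC.
move: (A * D ^+ 2)%R (A * D ^+ 5)%R h1 h2 h3 => u v h1 h2 h3.
by split; lra.
Qed.

Section weak_type.
Context {R : realType} {X : pmetricType R} (mu : radon_measure X).
Local Notation m := (radon_ext mu).
Local Notation mble A := (measurable (A : set (radonType mu))).
Context {B1 B2 : completeNormedModType R}.
Variables (D rho : R) (E : set X) (x0 : X).
Hypothesis D1 : (1 <= D)%R.
Hypothesis rho0 : (0 < rho)%R.
Hypothesis dbl : forall x s, (0 < s)%R -> (s <= 6 * rho)%R ->
  m (ball x (2 * s)%R) <= D%:E * m (ball x s).
Hypothesis posB : forall x s, (0 < s)%R -> 0 < m (ball x s).
Hypothesis finB : forall x s, (s <= 6 * rho)%R -> m (ball x s) < +oo.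
Hypothesis Ex0 : E x0.
Hypothesis Ed : forall x y, E x -> E y -> (mdist x y < rho)%R.
Variables (mE : mble E) (r : \bar R) (r1 : 1 < r).
Local Notation E' := (set_ball E (rho / 2)).
Variable T : (X -> B1) -> (X -> B2).
Hypothesis Tlin : continuous_linear_Lp mu r E' E T.
Variable K : X * X -> cont_linear B1 B2.
Hypothesis Km : prod_strongly_measurable mu (E `*` E') K.
Variables (A C : R) (A0 : (0 < A)%R) (C0 : (0 < C)%R).
Hypothesis T_kernel : forall F : set X, open F -> F `<=` E' ->
  forall f : X -> B1, cut_Lp mu F +oo f ->
    \forall x \ae m, (E `\` F) x ->
      bochner_integral_eq mu F (fun y => K (x, y) (f y)) (T f x).
Hypothesis Tbound : forall f : X -> B1, cut_Lp mu E' r f ->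
  Lp_norm mu r (T f) <= A%:E * Lp_norm mu r f.
Hypothesis hormander : \forall y \ae m, E' y -> \forall y' \ae m, E' y' ->
  (mdist y y' < rho)%R ->
  \int[m]_(x in E `\` ball (y : X) (2 * mdist y y'))
    `|K (x, y) - K (x, y')|%:E <= C%:E.

Local Notation S := (ball x0 (2 * rho)%R).

Let mS : mble S. Proof. exact: ball_radon. Qed.
Let Soo : m S < +oo.
Proof. by apply: finB; rewrite ler_pM2r// ler_nat. Qed.
Let mu0 : 0 < m setT.
Proof. by apply: (lt_le_trans (posB x0 rho0)); exact: le_radon_ext. Qed.
Let r0 : 0 < r. Proof. exact: lt_trans r1. Qed.
Let D0 : (0 < D)%R. Proof. exact: lt_le_trans D1. Qed.

Let E'S : E' `<=` S. Proof. exact: set_ball_subset. Qed.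

Let EE' : E `<=` E'.
Proof.
rewrite set_ball_bigcup => y Ey; exists y => //; apply: ballxx.
by rewrite divr_gt0.
Qed.

Let mE' : mble E'. Proof. by apply: open_radon; exact: set_ball_open. Qed.
Let E'oo : m E' < +oo.
Proof. exact: le_lt_trans (le_radon_ext mu E'S) Soo. Qed.

Lemma weak_type (f : X -> B1) (M l : R) : strongly_measurable m f ->
  (forall x, `|f x| <= M)%R -> (forall x, ~ E x -> f x = 0%R) -> (0 < l)%R ->
  m [set x | (l < `|T f x|)%R] <=
    (4 * (D ^+ 5 * A + C) / l)%:E * \int[m]_x (`|f x|)%:E.
Proof.
move=> sf fM f0 l0.
have M0 : (0 <= M)%R by exact: le_trans (fM point).
have cutE' (g : X -> B1) (k : R) : strongly_measurable m g ->
    (forall x, `|g x| <= k)%R -> (forall x, ~ E' x -> g x = 0%R) ->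
    cut_Lp mu E' r g.
  by move=> sg gk g0; exact: (bounded_cut_Lp r0 sg gk mE' E'oo g0).
have f0' x : ~ E' x -> f x = 0%R by move=> nE; apply: f0 => /EE'.
have cf : cut_Lp mu E' r f by exact: cutE' fM f0'.
(* With this level the good part is at most [D b = (l / 2) / A], exactly the bound that
   [operator_weak_bounded] asks for at height [l / 2]. *)
pose b := (l / (2 * A * D))%R.
have b0 : (0 < b)%R by rewrite divr_gt0// !mulr_gt0.
have f_int0 : 0 <= \int[m]_x (`|f x|)%:E by exact: integral_ge0.
have D1n n : (1 <= D ^+ n)%R by rewrite exprn_ege1.
have mf (Z : set X) : measurable_fun (Z : set (radonType mu)) (fun x => (`|f x|)%:E).
  by apply: measurable_funTS; exact: sm_enorm.
(* If some average over a ball of the largest radius exceeds [b], then [E] itself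
   is small enough. *)
have [[x [Ex big]]|small] := pselect (exists x, E x /\
    ~ \int[m]_(y in ball x (rho / 2)%R) (`|f y|)%:E <= b%:E * m (ball x (rho / 2)%R)).
  apply: (@le_trans _ _ (m E)).
    apply: ae_le_measure => //.
    apply: ae_mono (operator_supp Tlin cf) => y Ty /= lT; apply: contrapT => /Ty Ty0.
    by move: lT; rewrite Ty0 normr0 ltNge ltW.
  (* One doubling compares [E] with the ball of radius [rho / 2] about [x], whose measure is below
     [1 / b] times the integral of [|f|]. *)
  have Eb : E `<=` ball x rho by move=> y Ey; apply/ball_mdist; exact: Ed.
  apply: (le_trans (le_radon_ext mu Eb)).
  have r20 : (0 < rho / 2)%R by rewrite divr_gt0.
  have r26 : (rho / 2 <= 6 * rho)%R.
    exact: (half_bounds rho0).2.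
  have := @dbl x _ r20 r26; rewrite [(2 * _)%R]mulrC divfK// => /le_trans; apply.
  move/negP : big; rewrite -ltNge => big.
  apply: (@le_trans _ _ (D%:E * ((b^-1)%:E * \int[m]_x (`|f x|)%:E))).
    rewrite lee_wpmul2l ?lee_fin ?(ltW D0)//.
    rewrite -lee_pdivrMl ?invr_gt0// invrK; apply: (le_trans (ltW big)).
    by apply: ge0_subset_integral => //; exact: ball_radon.
  rewrite muleA -EFinM lee_wpmul2r// lee_fin.
  rewrite /b invf_div mulrA ler_pM2r ?invr_gt0//.
  exact: (weak_constants D1 A0 C0).1.
have avg x : E x -> \int[m]_(y in ball x (rho / 2)%R) (`|f y|)%:E <=
    b%:E * m (ball x (rho / 2)%R).
  by move=> Ex; apply: contrapT => h; apply: small; exists x.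
have nf0 x : ~ E x -> `|f x|%R = 0%R by move=> /f0 ->; rewrite normr0.
have [V [Bs [[tV mV oF FE' VB] [[mB sumB avgV Vpos] [Vdist Vball f_off]]]]] :=
  cz_decomp D1 rho0 dbl posB finB Ex0 Ed (sm_norm_measurable sf)
    (fun x => normr_ge0 _) nf0 b0 avg.
pose F := \bigcup_i V i.
have mF : mble F by exact: open_radon.
have FS : F `<=` S by exact: subset_trans E'S.
have [g [sg gF gb gU gint]] := conditional_average tV mV Soo FS Vpos sf fM.
have gV i x : V i x -> (`|g x| <= D * b)%R.
  move=> Vx; have Vp : 0 < m (V i) by apply: Vpos; exists x.
  have Voo : m (V i) < +oo.
    by apply: le_lt_trans Soo; apply: le_radon_ext => y Vy; apply: FS; exists i.
  have Vf : m (V i) \is a fin_num by rewrite ge0_fin_numE.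
  have := le_trans (gU i x Vx) (avgV i).
  by rewrite -(fineK Vf) -!EFinM lee_fin ler_pM2r// fine_gt0// Vp.
have gM x : (`|g x| <= M + D * b)%R.
  have Db : (0 <= D * b)%R by rewrite mulr_ge0 ?ltW.
  have [[i _ Vx]|nF] := pselect (F x); first by rewrite (le_trans (gV i x Vx))// ler_wpDl.
  by rewrite gF// (le_trans (fM x))// ler_wpDr.
have g_ae : \forall x \ae m, (`|g x| <= D * b)%R.
  apply: ae_mono f_off => x fx; have [[i _ Vx]|nF] := pselect (F x); first exact: gV Vx.
  by rewrite gF// (le_trans (fx nF))// ler_peMl// ltW.
have g0' x : ~ E' x -> g x = 0%R.
  by move=> nE'; rewrite gF ?f0'// => /FE'.
pose h x := (f x - g x)%R.
have sh : strongly_measurable m h by exact: smB.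
have hM x : (`|h x| <= M + (M + D * b))%R.
  by rewrite (le_trans (ler_normB _ _))// lerD.
have h0 x : ~ F x -> h x = 0%R by move=> nF; rewrite /h gF// subrr.
have cg : cut_Lp mu E' r g by exact: cutE' gM g0'.
have ch : cut_Lp mu E' r h by apply: (cutE' _ _ sh hM) => x nE; apply: h0 => /FE'.
have Foo : m F < +oo by apply: le_lt_trans Soo; exact: le_radon_ext.
(* The kernel formula concerns bounded functions carried by an open set; [h] vanishes off [F], which
   is open. *)
have chF : cut_Lp mu F +oo h by exact: (bounded_cut_Lp _ sh hM).
have Tfgh : \forall x \ae m, T f x = (T g x + T h x)%R.
  have := operator_add Tlin cg ch; rewrite (_ : (fun z => g z + h z)%R = f)//.
  by apply/funext => z; rewrite /h addrC subrK.
have l2 : (0 < l / 2)%R by rewrite divr_gt0.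
have sTg := operator_sm mE Tlin cg; have sTh := operator_sm mE Tlin ch.
have VFint (k : X -> B1) : strongly_measurable m k ->
    \int[m]_(x in F) (`|k x|)%:E = \sum_(0 <= i <oo) \int[m]_(x in V i) (`|k x|)%:E.
  move=> sk; rewrite ge0_integral_bigcup//.
  by apply: measurable_funTS; exact: sm_enorm.
have gFint : \int[m]_(x in F) (`|g x|)%:E <= \int[m]_(x in F) (`|f x|)%:E.
  rewrite !VFint//; apply: lee_nneseries => [i _ _|i _]; first exact: integral_ge0.
  exact: gint.
have g_int : \int[m]_x (`|g x|)%:E <= \int[m]_x (`|f x|)%:E.
  have mnF := measurableC mF.
  have split (k : X -> B1) : strongly_measurable m k -> \int[m]_x (`|k x|)%:E =
      \int[m]_(x in F) (`|k x|)%:E + \int[m]_(x in ~` F) (`|k x|)%:E.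
    move=> sk; rewrite -(setvU F) addeC; apply: ge0_integral_setU => //.
      by apply: measurable_funTS; exact: sm_enorm.
    exact/disj_set2P/setICl.
  rewrite !split//; apply: leeD => //.
  by apply: le_integral_ge0 => // x nF; rewrite gF.
have h_int : \int[m]_(x in F) (`|h x|)%:E <= 2%:E * \int[m]_x (`|f x|)%:E.
  apply: (@le_trans _ _ (\int[m]_(x in F) ((`|f x|)%:E + (`|g x|)%:E))).
    by apply: le_integral_ge0 => // x _; rewrite -EFinD lee_fin ler_normB.
  rewrite ge0_integralD//; last first.
    by apply: measurable_funTS; exact: sm_enorm.
  have fF : \int[m]_(x in F) (`|f x|)%:E <= \int[m]_x (`|f x|)%:E.
    by apply: ge0_subset_integral.
  rewrite -[2%R]/(1 + 1)%R EFinD ge0_muleDl// !mul1e; apply: leeD => //.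
  exact: le_trans gFint fF.
have good : m [set x | (l / 2 < `|T g x|)%R] <=
    (2 * A / l)%:E * \int[m]_x (`|f x|)%:E.
  have DbE : (D * b = l / 2 / A)%R.
    by rewrite /b; field; rewrite !gt_eqF.
  have := operator_weak_bounded r1 A0 mE mu0 Tlin Tbound l2 cg sg.
  rewrite -DbE => /(_ g_ae)/le_trans; apply.
  rewrite (_ : A / (l / 2) = 2 * A / l)%R; last by field; rewrite gt_eqF.
  by rewrite lee_wpmul2l// lee_fin divr_ge0 ?mulr_ge0// ltW.
pose BB := \bigcup_i Bs i.
have mBB : mble BB by exact: bigcupT_measurable.
(* [D ^ 4 / b] equals [2 A D ^ 5 / l]: the fifth power of [D] arises here. *)
have mBBle : m BB <= (2 * A * D ^+ 5 / l)%:E * \int[m]_x (`|f x|)%:E.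
  apply: (@le_trans _ _ (\sum_(0 <= i <oo) m (Bs i))).
    exact: (@measure_sigma_subadditive _ _ _ m).
  apply: (le_trans sumB); rewrite lee_wpmul2r// lee_fin /b.
  by rewrite le_eqVlt; apply/orP; left; apply/eqP; field; rewrite !gt_eqF.
(* The [4] is a factor [2] from [|h| <= |f| + |g|] times a factor [2] from the level [l / 2]. *)
have bad : m ((E `\` BB) `&` [set x | (l / 2 < `|T h x|)%R]) <=
    (4 * C / l)%:E * \int[m]_x (`|f x|)%:E.
  have mG : mble (E `\` BB) by exact: measurableD.
  have mTh : measurable_fun (E `\` BB : set (radonType mu)) (fun x => `|T h x|%R).
    by apply: measurable_funTS; exact: sm_norm_measurable.
  apply: (le_trans (@integral_chebyshev _ (radonType mu) _ m _ _ _ mG mTh _ l2)) => //.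
  have := bad_part mS Soo mE mE' (subset_trans EE' E'S) E'S Km C0 hormander tV mV
    FE' mB VB Vpos Vdist Vball sh sTh gb (T_kernel oF FE' chF).
  have l20 : 0 <= ((l / 2)^-1)%:E by rewrite lee_fin invr_ge0 ltW.
  move=> /(lee_wpmul2l l20)/le_trans; apply.
  apply: (@le_trans _ _ (((l / 2)^-1)%:E * (C%:E * (2%:E * \int[m]_x (`|f x|)%:E)))).
    by rewrite !lee_wpmul2l// lee_fin ltW.
  rewrite !muleA -!EFinM lee_wpmul2r// lee_fin.
  by rewrite le_eqVlt; apply/orP; left; apply/eqP; field; rewrite !gt_eqF.
have mTg := measurable_norm_gt (l / 2)%R sTg; have mTh := measurable_norm_gt (l / 2)%R sTh.
have mG : mble (E `\` BB) by exact: measurableD.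
have mGT : mble ((E `\` BB) `&` [set x | (l / 2 < `|T h x|)%R]) by exact: measurableI.
apply: (@le_trans _ _ (m ([set x | (l / 2 < `|T g x|)%R] `|` (BB `|`
    ((E `\` BB) `&` [set x | (l / 2 < `|T h x|)%R]))))).
  apply: ae_le_measure; first by apply: measurableU => //; exact: measurableU.
  apply: ae_mono2 Tfgh (operator_supp Tlin cf) => x Tx Tx0 /= lT.
  have Ex : E x by apply: contrapT => /Tx0 Ty0; move: lT; rewrite Ty0 normr0 ltNge ltW.
  have [gt|gle] := ltP (l / 2)%R `|T g x|%R; first by left.
  have [Bx|nB] := pselect (BB x); first by right; left.
  right; right; split => //=; rewrite ltNge; apply/negP => hle.
  move: lT; rewrite ltNge => /negP; apply; rewrite Tx (le_trans (ler_normD _ _))//.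
  by rewrite [leRHS](splitr l) lerD.
apply: le_trans (radon_extU_le mTg (measurableU _ _ mBB mGT)) _.
apply: (@le_trans _ _ ((2 * A / l)%:E * \int[m]_x (`|f x|)%:E +
   ((2 * A * D ^+ 5 / l)%:E * \int[m]_x (`|f x|)%:E +
    (4 * C / l)%:E * \int[m]_x (`|f x|)%:E))).
  apply: leeD => //; apply: le_trans (radon_extU_le mBB mGT) _; exact: leeD.
have nn (z : R) : (0 <= z)%R -> 0 <= z%:E by rewrite lee_fin.
have D00 := ltW D0; have A00 := ltW A0; have C00 := ltW C0; have l00 := ltW l0.
have D5 : (0 <= D ^+ 5)%R by rewrite exprn_ge0 ?ltW.
rewrite -!ge0_muleDl ?adde_ge0 ?nn ?divr_ge0 ?mulr_ge0//.
rewrite -!EFinD lee_wpmul2r// lee_fin -!mulrDl ler_pM2r ?invr_gt0//.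
exact: (weak_constants D1 A0 C0).2.
Qed.

End weak_type.

(** * Layer cake interpolation *)

Section power_integrals.
Context {R : realType}.
Local Notation leb := (@lebesgue_measure R).
Implicit Types (a c s x y : R).

Lemma integral_powR_itvcc c x y : c != 0%R -> (0 < x)%R -> (x < y)%R ->
  \int[leb]_(l in `[x, y]) (l `^ (c - 1))%:E
  = ((y `^ c - x `^ c) / c)%:E.
Proof.
move=> c0 x0 xy.
have dF z : (0 < z)%R -> derivable (fun l => l `^ c / c)%R z 1.
  by move=> z0; apply: derivableM => //; apply: derivable_powR; rewrite in_itv/= z0.
have cF : {within `[x, y], continuous (fun l => l `^ c / c)%R}.
  apply: derivable_within_continuous => z; rewrite in_itv/= => /andP[xz _].
  exact/dF/(lt_le_trans x0).
rewrite (@continuous_FTC2 _ _ (fun l => l `^ c / c)%R)//.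
- by rewrite -EFinB -mulrBl.
- apply: derivable_within_continuous => z; rewrite in_itv/= => /andP[xz _].
  by apply: derivable_powR; rewrite in_itv/= (lt_le_trans x0).
- split.
  + by move=> z; rewrite in_itv/= => /andP[xz _]; apply: dF; exact: (lt_trans x0).
  + by have /(continuous_within_itvP _ xy)[] := cF.
  + by have /(continuous_within_itvP _ xy)[] := cF.
- move=> z; rewrite in_itv/= => /andP[xz _].
  have z0 : (0 < z)%R by exact: (lt_trans x0).
  rewrite derive1E deriveM//; last by apply: derivable_powR; rewrite in_itv/= z0.
  rewrite derive_cst scaler0 add0r -derive1E powR_derive1 ?in_itv/= ?z0//.
  by rewrite -[LHS]/(c^-1 * (c * _))%R mulKf.
Qed.

Lemma cvg_powR_harmonic a : (0 < a)%R ->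
  ((n.+2%:R^-1 : R) `^ a)%R @[n --> \oo] --> 0%R.
Proof.
move=> a0.
have h : (n.+2%:R^-1 : R)%R @[n --> \oo] --> (0%R : R)^'+.
  move=> P; rewrite /at_right /within /= => hP.
  have h0 : (n.+2%:R^-1 : R)%R @[n --> \oo] --> (0%R : R).
    apply/cvgrPdist_lt => e e0.
    have [N _ NP] := near_infty_natSinv_lt (PosNum e0).
    exists N => // n /= Nn; rewrite sub0r normrN ger0_norm//.
    by apply: le_lt_trans (NP n Nn); rewrite lef_pV2 ?posrE// ler_nat.
  have [N _ NP] := h0 _ hP.
  by exists N => // n /= Nn; exact: NP.
exact: (cvg_comp _ _ h (powR_cvg0 a0)).
Qed.

Lemma integral_powR_itvoo a s : (0 < a)%R -> (0 < s)%R ->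
  \int[leb]_(l in `]0%R, s[) (l `^ (a - 1))%:E = (a^-1 * s `^ a)%:E.
Proof.
move=> a0 s0.
rewrite integral_itv_bndo_bndc; last first.
  by apply: measurable_funTS; apply/measurable_EFinP; exact: measurable_powR.
(* [n.+2] keeps the interval nondegenerate, as [integral_powR_itvcc] asks for [x < y]. *)
pose F n := `[(s * n.+2%:R^-1)%R, s]%classic : set (measurableTypeR R).
have FE : `]0%R, s]%classic = \bigcup_n F n.
  apply/seteqP; split => x /=.
    rewrite in_itv/= => /andP[x0 xs].
    have [N _ NP] := near_infty_natSinv_lt (PosNum (divr_gt0 x0 s0)).
    exists N => //; rewrite /F/= in_itv/= xs andbT.
    rewrite mulrC -ler_pdivlMr//; apply: le_trans (ltW (NP N (leqnn _))).
    by rewrite lef_pV2 ?posrE// ler_nat.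
  move=> [n _]; rewrite /F/= !in_itv/= => /andP[sx ->]; rewrite andbT.
  by apply: lt_le_trans sx; rewrite mulr_gt0.
rewrite FE.
have h : \int[leb]_(x in F i) (x `^ (a - 1))%:E @[i --> \oo] -->
    \int[leb]_(x in \bigcup_i F i) (x `^ (a - 1))%:E.
  apply: ge0_nondecreasing_set_cvg_integral => //.
  - apply/nondecreasing_seqP => n; rewrite subsetEset => x; rewrite /F/= !in_itv/=.
    move=> /andP[sx ->]; rewrite andbT; apply: le_trans sx.
    by rewrite ler_pM2l// lef_pV2 ?posrE// ler_nat.
  - by move=> n; rewrite /F.
  - move=> n; apply: measurable_funTS; apply/measurable_EFinP; exact: measurable_powR.
  - by move=> n x _; rewrite lee_fin powR_ge0.
apply: (cvg_unique _ h) => //.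
have -> : (fun i => \int[leb]_(x in F i) (x `^ (a - 1))%:E)
    = (fun n => (a^-1 * (s `^ a - s `^ a * (n.+2%:R^-1) `^ a))%:E).
  apply/funext => n; rewrite /F integral_powR_itvcc ?gt_eqF ?mulr_gt0//.
    by rewrite mulrC powRM// ltW.
  by rewrite gtr_pMr// invf_lt1// ltr1n.
apply: cvg_EFin; first exact: nearW.
have -> : (a^-1 * s `^ a = a^-1 * (s `^ a - s `^ a * 0))%R by rewrite mulr0 subr0.
apply: cvgMr; apply: cvgB; first exact: cvg_cst.
by apply: cvgMr; exact: cvg_powR_harmonic.
Qed.

Lemma integral_powR_itvcy a s : (0 < a)%R -> (0 < s)%R ->
  \int[leb]_(l in `[s, +oo[) (l `^ (- a - 1))%:E = (a^-1 * s `^ (- a))%:E.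
Proof.
move=> a0 s0.
(* Again [n.+2] excludes a degenerate interval. *)
pose F n := `[s, (s * n.+2%:R)%R]%classic : set (measurableTypeR R).
have FE : `[s, +oo[%classic = \bigcup_n F n.
  apply/seteqP; split => x /=.
    rewrite in_itv/= andbT => sx.
    have x0 : (0 < x)%R by apply: lt_le_trans sx.
    have [N _ NP] := near_infty_natSinv_lt (PosNum (divr_gt0 s0 x0)).
    exists N => //; rewrite /F/= in_itv/= sx/=.
    have /ltW := NP N (leqnn _); rewrite /= => NP'.
    rewrite -ler_pdivrMl// mulrC -[leLHS]invrK invf_div -[leRHS]invrK.
    rewrite lef_pV2 ?posrE ?divr_gt0//; apply: le_trans NP'.
    by rewrite lef_pV2 ?posrE// ler_nat.
  by move=> [n _]; rewrite /F/= !in_itv/= => /andP[-> _].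
rewrite FE.
have h : \int[leb]_(x in F i) (x `^ (- a - 1))%:E @[i --> \oo] -->
    \int[leb]_(x in \bigcup_i F i) (x `^ (- a - 1))%:E.
  apply: ge0_nondecreasing_set_cvg_integral => //.
  - apply/nondecreasing_seqP => n; rewrite subsetEset => x; rewrite /F/= !in_itv/=.
    move=> /andP[-> sx] /=; apply: (le_trans sx).
    by rewrite ler_pM2l// ler_nat.
  - by move=> n; rewrite /F.
  - move=> n; apply: measurable_funTS; apply/measurable_EFinP; exact: measurable_powR.
  - by move=> n x _; rewrite lee_fin powR_ge0.
apply: (cvg_unique _ h) => //.
have -> : (fun i => \int[leb]_(x in F i) (x `^ (- a - 1))%:E)
    = (fun n => (a^-1 * (s `^ (- a) - s `^ (- a) * (n.+2%:R^-1) `^ a))%:E).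
  apply/funext => n; rewrite /F integral_powR_itvcc ?oppr_eq0 ?gt_eqF//.
    rewrite powRM ?(ltW s0)// invrN mulrN -mulNr opprB mulrC.
    congr (_ * (_ - _ * _))%:E.
    by rewrite -[in RHS]powR_inv1// -powRrM mulN1r.
  by rewrite ltr_pMr// ltr1n.
apply: cvg_EFin; first exact: nearW.
have -> : (a^-1 * s `^ (- a) = a^-1 * (s `^ (- a) - s `^ (- a) * 0))%R by rewrite mulr0 subr0.
apply: cvgMr; apply: cvgB; first exact: cvg_cst.
by apply: cvgMr; exact: cvg_powR_harmonic.
Qed.

End power_integrals.

Section layer_cake.
Context d {T : measurableType d} {R : realType}.
Variable nu : {sigma_finite_measure set T -> \bar R}.
Local Notation leb := (@lebesgue_measure R).

(** The truncation is a boolean factor, which makes the integrand jointly measurable in [x] and [l].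
    For [k = 0] this is the distribution function of [g]. *)
Definition upper_part (k : R) (g : T -> R) (l : R) : \bar R :=
  \int[nu]_x ((l < g x)%R%:R * g x `^ k)%:E.
Definition lower_part (k : R) (g : T -> R) (l : R) : \bar R :=
  \int[nu]_x ((g x <= l)%R%:R * g x `^ k)%:E.

Lemma upper_part_ge0 k g l : 0 <= upper_part k g l.
Proof. by apply: integral_ge0 => x _; rewrite lee_fin mulr_ge0 ?powR_ge0. Qed.

Lemma lower_part_ge0 k g l : 0 <= lower_part k g l.
Proof. by apply: integral_ge0 => x _; rewrite lee_fin mulr_ge0 ?powR_ge0. Qed.

Section fixed.
Variables (g : T -> R) (mg : measurable_fun setT g) (g0 : forall x, (0 <= g x)%R).

Let mg1 : measurable_fun setT (fun z : T * measurableTypeR R => g z.1).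
Proof. by apply: (measurableT_comp mg); exact: measurable_fst. Qed.

Let mnat_bool (b : T * measurableTypeR R -> bool) :
  measurable_fun setT b -> measurable_fun setT (fun z => (b z)%:R : R).
Proof.
move=> mb; have -> : (fun z => (b z)%:R : R) = (fun z => if b z then 1%R else 0%R).
  by apply/funext => z; case: (b z).
exact: measurable_fun_ifT.
Qed.

Let mlt : measurable_fun setT (fun z : T * measurableTypeR R => (z.2 < g z.1)%R%:R : R).
Proof.
apply: mnat_bool; apply: measurable_fun_ltr => //; exact: measurable_snd.
Qed.

Let mle : measurable_fun setT (fun z : T * measurableTypeR R => (g z.1 <= z.2)%R%:R : R).
Proof.
apply: mnat_bool; apply: measurable_fun_ler => //; exact: measurable_snd.
Qed.

Let mpow k : measurable_fun setT (fun z : T * measurableTypeR R => (g z.1 `^ k)%R).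
Proof. exact: (measurableT_comp (measurable_powR k)). Qed.

Lemma measurable_upper_part k :
  measurable_fun [set: measurableTypeR R] (upper_part k g : measurableTypeR R -> \bar R).
Proof.
apply: (@measurable_fun_fubini_tonelli_G _ _ T (measurableTypeR R) R nu
  (fun z => ((z.2 < g z.1)%R%:R * g z.1 `^ k)%:E)).
- by apply/measurable_EFinP; exact: measurable_funM.
- by move=> z; rewrite lee_fin mulr_ge0 ?powR_ge0.
Qed.

Lemma measurable_lower_part k :
  measurable_fun [set: measurableTypeR R] (lower_part k g : measurableTypeR R -> \bar R).
Proof.
apply: (@measurable_fun_fubini_tonelli_G _ _ T (measurableTypeR R) R nu
  (fun z => ((g z.1 <= z.2)%R%:R * g z.1 `^ k)%:E)).
- by apply/measurable_EFinP; exact: measurable_funM.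
- by move=> z; rewrite lee_fin mulr_ge0 ?powR_ge0.
Qed.

Let pos (l : R) : R := (0 < l)%R%:R.

(** Tonelli's theorem for a measurable region [b] of pairs [(x, l)]; the factor [pos] confines [l]
    to the half-line. *)
Let layer (e : R) (b : T * measurableTypeR R -> bool) k : measurable_fun setT b ->
  \int[leb]_(l in `]0%R, +oo[)
    ((l `^ e)%:E * \int[nu]_x ((b (x, l))%:R * g x `^ k)%:E) =
  \int[nu]_x ((g x `^ k)%:E *
    \int[leb]_(l in `]0%R, +oo[) ((b (x, l))%:R * l `^ e)%:E).
Proof.
move=> mb.
pose f (z : T * measurableTypeR R) :=
  (pos z.2 * ((b z)%:R * z.2 `^ e * g z.1 `^ k))%:E.
have f0 z : 0 <= f z by rewrite lee_fin !mulr_ge0 ?powR_ge0.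
have mf : measurable_fun setT f.
  apply/measurable_EFinP; apply: measurable_funM.
    apply: mnat_bool; apply: measurable_fun_ltr => //; exact: measurable_snd.
  apply: measurable_funM => //; apply: measurable_funM; first exact: mnat_bool.
  apply: (measurableT_comp (measurable_powR e)); exact: measurable_snd.
have := @fubini_tonelli _ _ T (measurableTypeR R) R nu leb f mf f0 => FT.
transitivity (\int[leb]_l \int[nu]_x f (x, l)).
  rewrite integral_mkcond; apply: eq_integral => l _; rewrite patchE.
  case: ifPn => [|/negP]; rewrite inE/= in_itv/= andbT => l0.
    rewrite -ge0_integralZl//; last 3 first.
    - apply/measurable_EFinP; apply: measurable_funM.
        exact: (measurableT_comp (mnat_bool mb) (pair2_measurable l)).
      exact: (measurableT_comp (measurable_powR k)).
    - by move=> x _; rewrite lee_fin mulr_ge0 ?powR_ge0.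
    - by rewrite lee_fin powR_ge0.
    apply: eq_integral => x _; rewrite /f /pos/= l0 mul1r -EFinM.
    by congr EFin; rewrite mulrCA mulrA.
  rewrite integral0_eq// => x _; rewrite /f /pos/=.
  by move/negP/negbTE: l0 => ->; rewrite mul0r.
rewrite -FT; apply: eq_integral => x _.
rewrite [in RHS]integral_mkcond/= -ge0_integralZl//.
- apply: eq_integral => l _; rewrite patchE /f /pos/=.
  case: ifPn => [|/negP]; rewrite inE/= in_itv/= andbT => l0.
    by rewrite l0 mul1r -EFinM mulrC.
  by move/negP/negbTE: l0 => ->; rewrite mul0r mule0.
- apply/(measurable_restrictT _ _).1 => //.
  apply: measurable_funTS; apply/measurable_EFinP; apply: measurable_funM.
    exact: (measurableT_comp (mnat_bool mb) (pair1_measurable x)).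
  exact: measurable_powR.
- by move=> l _; rewrite erestrict_ge0// => y _; rewrite lee_fin mulr_ge0 ?powR_ge0.
- by rewrite lee_fin powR_ge0.
Qed.

Lemma layer_upper a k : (0 < a)%R -> (0 <= k)%R ->
  \int[leb]_(l in `]0%R, +oo[) ((l `^ (a - 1))%:E * upper_part k g l) =
  (a^-1)%:E * \int[nu]_x (g x `^ (k + a))%:E.
Proof.
move=> a0 k0; rewrite (layer _ _ (b := fun z => z.2 < g z.1)%R); last first.
  by apply: measurable_fun_ltr => //; exact: measurable_snd.
rewrite -ge0_integralZl//; last 3 first.
- apply/measurable_EFinP; exact: (measurableT_comp (measurable_powR _)).
- by move=> x _; rewrite lee_fin powR_ge0.
- by rewrite lee_fin invr_ge0 ltW.
apply: eq_integral => x _ /=.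
have := g0 x; rewrite le_eqVlt => /predU1P[<-|gx0].
  rewrite [(0 `^ (k + a))%R]powR0 ?gt_eqF ?ltr_wpDl// mule0 integral0_eq ?mule0// => l.
  by rewrite /= in_itv/= andbT => l0; rewrite ltNge (ltW l0) mul0r.
transitivity ((g x `^ k)%:E * \int[leb]_(l in `]0%R, g x[) (l `^ (a - 1))%:E).
  congr (_ * _); rewrite integral_mkcond [RHS]integral_mkcond.
  apply: eq_integral => l _; rewrite !patchE !mem_setE !in_itv/= andbT.
  by case: (ltP 0%R l) => //= _; case: ifPn => // _; rewrite ?mul1r ?mul0r.
rewrite integral_powR_itvoo// -!EFinM; congr EFin.
by rewrite mulrCA powRD// gt_eqF ?implybT// ltr_wpDl.
Qed.

Lemma layer_lower a k : (0 < a)%R -> (a < k)%R ->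
  \int[leb]_(l in `]0%R, +oo[) ((l `^ (- a - 1))%:E * lower_part k g l) =
  (a^-1)%:E * \int[nu]_x (g x `^ (k - a))%:E.
Proof.
move=> a0 k0; rewrite (layer _ _ (b := fun z => g z.1 <= z.2)%R); last first.
  by apply: measurable_fun_ler => //; exact: measurable_snd.
rewrite -ge0_integralZl//; last 3 first.
- apply/measurable_EFinP; exact: (measurableT_comp (measurable_powR _)).
- by move=> x _; rewrite lee_fin powR_ge0.
- by rewrite lee_fin invr_ge0 ltW.
apply: eq_integral => x _ /=.
have := g0 x; rewrite le_eqVlt => /predU1P[<-|gx0].
  rewrite powR0 ?gt_eqF//; last exact: lt_trans k0.
  by rewrite powR0 ?gt_eqF ?subr_gt0// mule0 mul0e.
transitivity ((g x `^ k)%:E * \int[leb]_(l in `[g x, +oo[) (l `^ (- a - 1))%:E).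
  congr (_ * _); rewrite integral_mkcond [RHS]integral_mkcond.
  apply: eq_integral => l _; rewrite !patchE !mem_setE !in_itv/= !andbT.
  case: (ltP 0%R l) => l0; case: (leP (g x) l) => gl; rewrite ?mul1r ?mul0r//.
  by have := lt_le_trans gx0 (le_trans gl l0); rewrite ltxx.
rewrite integral_powR_itvcy// -!EFinM; congr EFin.
by rewrite mulrCA powRD// gt_eqF ?implybT// subr_gt0.
Qed.

End fixed.

Local Notation D := ([set` Interval (BRight (0%R : R)) +oo%O] : set (measurableTypeR R)).

Let mupper k f : measurable_fun setT f ->
  measurable_fun D (upper_part k f : measurableTypeR R -> \bar R).
Proof. by move=> mf; apply: measurable_funTS; exact: measurable_upper_part. Qed.

Let mlower k f : measurable_fun setT f ->
  measurable_fun D (lower_part k f : measurableTypeR R -> \bar R).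
Proof. by move=> mf; apply: measurable_funTS; exact: measurable_lower_part. Qed.

Let mpw (c : R) :
  measurable_fun D ((fun l => (l `^ c)%:E) : measurableTypeR R -> \bar R).
Proof.
by apply: measurable_funTS; apply/measurable_EFinP; exact: measurable_powR.
Qed.

Let integral_two (b : bool) (c1 c2 k1 k2 : R) f : measurable_fun setT f ->
  \int[leb]_(l in D) ((l `^ c1)%:E * upper_part k1 f l +
    b%:R%:E * ((l `^ c2)%:E * lower_part k2 f l)) =
  \int[leb]_(l in D) ((l `^ c1)%:E * upper_part k1 f l) +
  b%:R%:E * \int[leb]_(l in D) ((l `^ c2)%:E * lower_part k2 f l).
Proof.
move=> mf; rewrite ge0_integralD//.
- congr (_ + _); rewrite ge0_integralZl//.
  + by apply: emeasurable_funM => //; exact: mlower.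
  + by move=> l _; rewrite mule_ge0 ?lower_part_ge0 ?lee_fin ?powR_ge0.
- by move=> l _; rewrite mule_ge0 ?upper_part_ge0 ?lee_fin ?powR_ge0.
- by apply: emeasurable_funM => //; exact: mupper.
- by move=> l _; rewrite !mule_ge0 ?lower_part_ge0 ?lee_fin ?powR_ge0.
- apply: emeasurable_funM; first exact: measurable_cst.
  by apply: emeasurable_funM => //; exact: mlower.
Qed.

Let mtwo (b : bool) (c1 c2 k1 k2 : R) f : measurable_fun setT f ->
  measurable_fun D ((fun l => (l `^ c1)%:E * upper_part k1 f l +
    b%:R%:E * ((l `^ c2)%:E * lower_part k2 f l)) : measurableTypeR R -> \bar R).
Proof.
move=> mf; apply: emeasurable_funD.
  by apply: emeasurable_funM => //; exact: mupper.
apply: emeasurable_funM; first exact: measurable_cst.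
by apply: emeasurable_funM => //; exact: mlower.
Qed.

(** Multiply the hypothesis by [l ^ (q - 1)] and integrate in [l]. By the layer cake formula the
    left-hand side becomes [1 / q] times the integral of [h ^ q], and the two terms on the right
    become [1 / (q - 1)] and [1 / (r - q)] times that of [g ^ q]. *)
Lemma weak_to_strong (b : bool) (q r : R) (h g : T -> R) :
  measurable_fun setT h -> measurable_fun setT g ->
  (forall x, 0 <= h x)%R -> (forall x, 0 <= g x)%R ->
  (1 < q)%R -> (q < r)%R ->
  (forall l, (0 < l)%R -> nu [set x | l < h x]%R <=
    (l^-1)%:E * upper_part 1 g l + b%:R%:E * ((l `^ (- r))%:E * lower_part r g l)) ->
  \int[nu]_x (h x `^ q)%:E <=
  (q / (q - 1) + b%:R * (q / (r - q)))%:E * \int[nu]_x (g x `^ q)%:E.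
Proof.
move=> mh mg h0 g0 q1 qr hw.
have q0 : (0 < q)%R by exact: lt_trans q1.
have q10 : (0 < q - 1)%R by rewrite subr_gt0.
have rq0 : (0 < r - q)%R by rewrite subr_gt0.
have gq0 : 0 <= \int[nu]_x (g x `^ q)%:E.
  by apply: integral_ge0 => x _; rewrite lee_fin powR_ge0.
have := @layer_upper h mh h0 q 0%R q0 (lexx _); rewrite add0r => E1.
have := @layer_upper g mg g0 (q - 1)%R 1%R q10 ler01.
rewrite (_ : 1 + (q - 1) = q)%R => [E2|]; last by ring.
have := @layer_lower g mg g0 (r - q)%R r rq0 _; rewrite gtrBl q0 => /(_ isT).
rewrite (_ : r - (r - q) = q)%R => [E3|]; last by ring.
suff : (q^-1)%:E * \int[nu]_x (h x `^ q)%:E <=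
    ((q - 1)^-1)%:E * \int[nu]_x (g x `^ q)%:E +
    b%:R%:E * (((r - q)^-1)%:E * \int[nu]_x (g x `^ q)%:E).
  rewrite -lee_pdivlMl ?invr_gt0// invrK => /le_trans; apply.
  rewrite muleA -ge0_muleDl ?lee_fin ?mulr_ge0 ?invr_ge0 ?(ltW rq0) ?(ltW q10)// muleA.
  by rewrite -(EFinM b%:R) -EFinD -EFinM mulrDr mulrCA.
rewrite -E1 -E2 -E3 -integral_two//; apply: ge0_le_integral => //.
- by move=> l _; rewrite mule_ge0 ?upper_part_ge0 ?lee_fin ?powR_ge0.
- by apply: emeasurable_funM => //; exact: mupper.
- exact: mtwo.
- move=> l /=; rewrite in_itv/= andbT => l0.
  apply: (@le_trans _ _ ((l `^ (q - 1))%:E * nu [set x | l < h x]%R)).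
    rewrite lee_pmul2l ?lte_fin ?powR_gt0//.
    have mS : measurable [set x | l < h x]%R.
      by rewrite -[X in measurable X]setTI; apply: measurable_fun_ltr.
    rewrite -[X in nu X]setIT -(integral_indic nu measurableT mS).
    rewrite le_eqVlt; apply/orP; left; apply/eqP/eq_integral => x _.
    rewrite powRr0 mulr1 indicE; case: (ltP l (h x)) => lh.
      by rewrite mem_set.
    by rewrite memNset//= ltNge lh.
  apply: (le_trans (lee_wpmul2l _ (hw l l0))); first by rewrite lee_fin powR_ge0.
  rewrite ge0_muleDr ?mule_ge0 ?upper_part_ge0 ?lower_part_ge0 ?lee_fin ?invr_ge0 ?powR_ge0 ?(ltW l0)//.
  rewrite muleA muleCA [X in _ + _ * X <= _]muleA -!EFinM.
  rewrite -(powR_inv1 (ltW l0)) -!powRD ?(gt_eqF l0) ?implybT//.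
  by rewrite (_ : (q - 1 - r = - (r - q) - 1)%R)//; ring.
Qed.

(** Integrated against [l ^ (p - q - 1)], each side of the hypothesis yields the integral of a
    [p]-th power with the same constant [1 / (p - q) + 1 / (r - p)], whose second term is absent
    when [b] is false. The constant cancels, and interpolation costs no factor beyond [P]. *)
Lemma strong_interp (b : bool) (p q r P : R) (h g : T -> R) :
  measurable_fun setT h -> measurable_fun setT g ->
  (forall x, 0 <= h x)%R -> (forall x, 0 <= g x)%R ->
  (0 < q)%R -> (q < p)%R -> (p < r)%R -> (0 <= P)%R ->
  (forall l, (0 < l)%R ->
    upper_part q h l + b%:R%:E * ((l `^ (q - r))%:E * lower_part r h l) <=
    P%:E * (upper_part q g l + b%:R%:E * ((l `^ (q - r))%:E * lower_part r g l))) ->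
  \int[nu]_x (h x `^ p)%:E <= P%:E * \int[nu]_x (g x `^ p)%:E.
Proof.
move=> mh mg h0 g0 q0 qp pr P0 hw.
have p0 : (0 < p)%R by exact: lt_trans qp.
have pq0 : (0 < p - q)%R by rewrite subr_gt0.
have rp0 : (0 < r - p)%R by rewrite subr_gt0.
have E (f : T -> R) : measurable_fun setT f -> (forall x, 0 <= f x)%R ->
    \int[leb]_(l in D) ((l `^ (p - q - 1))%:E * upper_part q f l +
      b%:R%:E * ((l `^ (- (r - p) - 1))%:E * lower_part r f l)) =
    ((p - q)^-1 + b%:R * (r - p)^-1)%:E * \int[nu]_x (f x `^ p)%:E.
  move=> mf f0; rewrite integral_two// layer_upper// ?ltW//.
  rewrite layer_lower//; last by rewrite gtrBl.
  rewrite (_ : q + (p - q) = p)%R; last by ring.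
  rewrite (_ : r - (r - p) = p)%R; last by ring.
  rewrite muleA -ge0_muleDl//.
    by rewrite lee_fin invr_ge0 ltW.
  by rewrite -EFinM lee_fin mulr_ge0// invr_ge0 ltW.
have c0 : (0 < (p - q)^-1 + b%:R * (r - p)^-1)%R.
  by rewrite ltr_pwDl ?invr_gt0// mulr_ge0// invr_ge0 ltW.
rewrite -(lee_pmul2l _ (_ : 0 < ((p - q)^-1 + b%:R * (r - p)^-1)%:E))//.
rewrite muleCA -!E//.
rewrite -ge0_integralZl//; last 2 first.
- exact: mtwo.
- by move=> l _; rewrite adde_ge0// !mule_ge0 ?lower_part_ge0 ?upper_part_ge0 ?lee_fin ?powR_ge0.
apply: ge0_le_integral => //.
- by move=> l _; rewrite adde_ge0// !mule_ge0 ?lower_part_ge0 ?upper_part_ge0 ?lee_fin ?powR_ge0.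
- exact: mtwo.
- by apply: emeasurable_funM; [exact: measurable_cst|exact: mtwo].
- move=> l /=; rewrite in_itv/= andbT => l0.
  have F f : (l `^ (p - q - 1))%:E * upper_part q f l +
      b%:R%:E * ((l `^ (- (r - p) - 1))%:E * lower_part r f l) =
      (l `^ (p - q - 1))%:E * (upper_part q f l + b%:R%:E * ((l `^ (q - r))%:E * lower_part r f l)).
    rewrite [RHS]ge0_muleDr ?mule_ge0 ?upper_part_ge0 ?lower_part_ge0 ?lee_fin ?powR_ge0//.
    congr (_ + _); rewrite [RHS]muleCA; congr (_ * _).
    rewrite muleA -EFinM -powRD ?(gt_eqF l0) ?implybT//.
    by congr ((_ `^ _)%:E * _); ring.
  rewrite (F h) (F g) [leRHS]muleCA lee_pmul2l ?lte_fin ?powR_gt0//; exact: hw.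
Qed.

End layer_cake.

(** * Strong type *)

(* If [b], the left-hand side is [min ((x/2) ^ q, l ^ (q - s) (x/2) ^ s)]. *)
Lemma min_power_le (R : realType) (b : bool) (q s l x y1 y2 : R) :
  (0 < q)%R -> (q < s)%R -> (0 < l)%R -> (0 <= x)%R -> (0 <= y1)%R -> (0 <= y2)%R ->
  (x <= y1 + y2)%R -> (~~ b -> (y2 <= l)%R) ->
  ((l < x / 2)%R%:R * (x / 2) `^ q + b%:R * (l `^ (q - s) * ((x / 2 <= l)%R%:R * (x / 2) `^ s)) <=
   y1 `^ q + b%:R * (l `^ (q - s) * y2 `^ s))%R.
Proof.
move=> q0 qs l0 x0 y10 y20 xy by2.
have s0 : (0 < s)%R by exact: lt_trans qs.
have x20 : (0 <= x / 2)%R by rewrite divr_ge0.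
have lqs : (0 <= l `^ (q - s))%R by exact: powR_ge0.
(* One of [y1], [y2] is at least [x / 2], and a minimum is bounded by either of its terms. When [b]
   is false and [y2] is the larger one, [x / 2 <= l] and the left-hand side vanishes. *)
have [x1|x1] := lerP (x / 2) y1.
  apply: (@le_trans _ _ ((x / 2) `^ q)%R); last first.
    apply: (@le_trans _ _ (y1 `^ q)%R); last by rewrite lerDl !mulr_ge0 ?powR_ge0.
    by apply: ge0_ler_powR; rewrite ?nnegrE// ltW.
  case: (ltP l (x / 2)%R) => lx /=; first by rewrite mul1r mul0r !mulr0 addr0.
  rewrite mul0r add0r mul1r.
  case: b by2 => /= _; last by rewrite mul0r powR_ge0.
  have [->|xn0] := eqVneq (x / 2)%R 0%R; first by rewrite !powR0 ?gt_eqF// mulr0 mulr0.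
  rewrite mul1r.
  have -> : ((x / 2) `^ s = (x / 2) `^ q * (x / 2) `^ (s - q))%R.
    by rewrite -powRD ?xn0 ?implybT// addrC subrK.
  rewrite mulrCA ler_piMr ?powR_ge0//.
  have -> : (q - s = - (s - q))%R by ring.
  rewrite powRN ler_pdivrMl ?powR_gt0// mulr1.
  by apply: ge0_ler_powR; rewrite ?nnegrE ?subr_ge0 ?(ltW l0)// ltW.
have x2 : (x / 2 <= y2)%R by lra.
case: b by2 => [_|/(_ isT) yl]; last first.
  rewrite !mul0r !addr0 ltNge (le_trans x2 yl) /= mul0r powR_ge0//.
rewrite !mul1r.
apply: (@le_trans _ _ (l `^ (q - s) * (x / 2) `^ s)%R); last first.
  rewrite ler_wpDl ?powR_ge0// ler_wpM2l//.
  by apply: ge0_ler_powR; rewrite ?nnegrE// ltW.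
case: (ltP l (x / 2)%R) => lx /=; last by rewrite mul0r add0r mul1r.
rewrite mul0r mulr0 addr0 mul1r.
have xp : (0 < x / 2)%R by exact: lt_trans lx.
have -> : ((x / 2) `^ s = (x / 2) `^ q * (x / 2) `^ (s - q))%R.
  by rewrite -powRD ?(gt_eqF xp) ?implybT// addrC subrK.
rewrite mulrCA ler_peMr ?powR_ge0//.
have -> : (q - s = - (s - q))%R by ring.
rewrite powRN ler_pdivlMl ?powR_gt0// mulr1.
by apply: ge0_ler_powR; rewrite ?nnegrE ?subr_ge0 ?(ltW l0)// ltW.
Qed.

Section lp_monotone.
Context {R : realType} {X : pmetricType R} (mu : radon_measure X).
Local Notation m := (radon_ext mu).
Context {V W : normedModType R}.

Lemma Lp_norm_le (r : \bar R) (f : X -> V) (g : X -> W) : 0 < r ->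
  (forall x, `|f x| <= `|g x|)%R -> Lp_norm mu r f <= Lp_norm mu r g.
Proof.
case: r => [s||//] s0 fg; last first.
  rewrite /Lp_norm unlock; case: ifPn => // _; apply: le_ess_sup.
  by apply: ae_everywhere => x; rewrite /= !normr_id lee_fin.
rewrite lte_fin in s0; rewrite !Lp_normE.
have I0 (Z : normedModType R) (k : X -> Z) : 0 <= \int[m]_x (`|k x| `^ s)%:E.
  by apply: integral_ge0 => x _; rewrite lee_fin powR_ge0.
apply: gt0_ler_poweR; rewrite ?in_itv/= ?leey ?I0 ?invr_ge0 ?(ltW s0)//.
apply: le_integral_ge0 => x _; first by rewrite lee_fin powR_ge0.
by rewrite lee_fin; apply: ge0_ler_powR; rewrite ?nnegrE//; exact: ltW.
Qed.

Lemma Lp_norm_ae (r : \bar R) (f g : X -> V) : 0 < r -> strongly_measurable m f ->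
  strongly_measurable m g -> (\forall x \ae m, f x = g x) ->
  Lp_norm mu r f = Lp_norm mu r g.
Proof.
case: r => [s||//] s0 sf sg fg; last first.
  rewrite /Lp_norm unlock; case: ifPn => // _; apply: eq_ess_sup.
  by apply: ae_mono fg => x /= ->.
have mpow (k : X -> V) : strongly_measurable m k ->
    measurable_fun [set: radonType mu] (fun x => (`|k x| `^ s)%:E).
  move=> sk; apply/measurable_EFinP.
  exact: (measurableT_comp (measurable_powR s) (sm_norm_measurable sk)).
rewrite !Lp_normE; congr (_ `^ _); apply: ge0_ae_eq_integral => //.
- exact: mpow.
- exact: mpow.
by apply: ae_mono fg => x -> _.
Qed.

End lp_monotone.

Section lp_minkowski.
Context {R : realType} {X : pmetricType R} (mu : radon_measure X).
Local Notation m := (radon_ext mu).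
Context {V : normedModType R}.

Lemma Lp_normD (p : R) (f g : X -> V) : (1 <= p)%R -> strongly_measurable m f ->
  strongly_measurable m g ->
  Lp_norm mu p%:E (fun x => f x + g x)%R <= Lp_norm mu p%:E f + Lp_norm mu p%:E g.
Proof.
move=> p1 sf sg; have p0 : (0 < p)%R by exact: lt_le_trans p1.
have := @minkowski_EFin _ (radonType mu) _ m (fun x => `|f x|%R) (fun x => `|g x|%R) p
  (sm_norm_measurable sf) (sm_norm_measurable sg) p1.
apply: le_trans.
have -> : Lnorm m p%:E (EFin \o ((fun x => `|f x|) \+ (fun x => `|g x|)))%R =
    Lp_norm mu p%:E (fun x => `|f x| + `|g x| : R^o)%R.
  by apply: eq_Lnorm => x /=; rewrite ger0_norm// addr_ge0.
apply: Lp_norm_le => [|x]; first by rewrite lte_fin.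
by rewrite [leRHS]ger0_norm ?addr_ge0// ler_normD.
Qed.

(** Members of [cut_Lp] vanish off [E] almost everywhere; [f0] is a representative that does so
    everywhere, as truncations require. *)
Lemma cut_sm_split (E : set X) (r : \bar R) (f : X -> V) :
  measurable (E : set (radonType mu)) -> 0 < r -> cut_Lp mu E r f -> strongly_measurable m f /\
  exists f0 : X -> V, [/\ strongly_measurable m f0,
    \forall x \ae m, f x = f0 x, forall x, ~ E x -> f0 x = 0%R &
    Lp_norm mu r f0 < +oo].
Proof.
move=> mE r0 [g [sg goo] fg]; split.
  by apply: sm_ae (sm_cutoff mE sg) _; apply: ae_mono fg => x.
exists (cutoff E g); split => //; first exact: sm_cutoff.
  by move=> x nE; rewrite cutoff_out.
apply: le_lt_trans goo; apply: Lp_norm_le => // x.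
have [Ex|nE] := pselect (E x); first by rewrite cutoff_in.
by rewrite cutoff_out// normr0.
Qed.

End lp_minkowski.

(* The boolean [b] tells whether [r] is finite; the real number [s] is then its
   value, and it is irrelevant otherwise. *)
Definition interp_const (R : realType) (b : bool) (q s : R) : R :=
  (q / (q - 1) + b%:R * (q / (s - q)))%R.

Definition phi_exponent (R : realType) (b : bool) (p q s : R) : R :=
  (if b then (p^-1 - s^-1) / (1 - q / s) else p^-1)%R.

Lemma interp_const_ge1 (R : realType) (b : bool) (q s : R) : (1 < q)%R -> (q < s)%R ->
  (1 <= interp_const b q s)%R.
Proof.
move=> q1 qs; have q0 : (0 < q)%R by exact: lt_trans q1.
have h1 : (1 <= q / (q - 1))%R by rewrite ler_pdivlMr ?subr_gt0// mul1r gerBl.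
apply: (le_trans h1); rewrite /interp_const lerDl; case: b; rewrite ?mul0r// mul1r.
by rewrite divr_ge0 ?subr_ge0 ?ltW.
Qed.

Section strong_type.
Context {R : realType} {X : pmetricType R} (mu : radon_measure X).
Local Notation m := (radon_ext mu).
Local Notation mble A := (measurable (A : set (radonType mu))).
Context {V W : normedModType R}.
Variables (b : bool) (q s : R) (q1 : (1 < q)%R) (qs : (q < s)%R).
Local Notation r := (if b then s%:E else +oo : \bar R).
Variables (A M : R) (A0 : (0 < A)%R) (AM : (A <= M)%R).
Variables (E E' : set X) (mE : mble E) (mE' : mble E') (EE' : E `<=` E').
Variables (Eoo : m E < +oo) (E'oo : m E' < +oo) (mu0 : 0 < m setT).
Variable T : (X -> V) -> (X -> W).
Hypothesis Tlin : continuous_linear_Lp mu r E' E T.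
Hypothesis Tbound : forall f : X -> V, cut_Lp mu E' r f ->
  Lp_norm mu r (T f) <= A%:E * Lp_norm mu r f.
Hypothesis Tweak : forall (f : X -> V) (k l : R), strongly_measurable m f ->
  (forall x, `|f x| <= k)%R -> (forall x, ~ E x -> f x = 0%R) -> (0 < l)%R ->
  m [set x | (l < `|T f x|)%R] <= (M / l)%:E * \int[m]_x (`|f x|)%:E.

Let nu : {finite_measure set (radonType mu) -> \bar R} := mfrestr mE Eoo.
Let M0 : (0 < M)%R. Proof. exact: lt_le_trans AM. Qed.
Let q0 : (0 < q)%R. Proof. exact: lt_trans q1. Qed.
Let s0 : (0 < s)%R. Proof. exact: lt_trans qs. Qed.
Let r1 : 1 < r.
Proof. by case: (b); rewrite ?ltry// lte_fin (lt_trans q1). Qed.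

(** The class to which the weak type estimate applies; it is stable under truncation. *)
Definition bounded_on (f : X -> V) : Prop := strongly_measurable m f /\
  ((exists k : R, forall x, (`|f x| <= k)%R) /\ (forall x, ~ E x -> f x = 0%R)).

Lemma bounded_on_cut f : bounded_on f -> cut_Lp mu E' r f.
Proof.
move=> [sf [[k fk] f0]].
apply: (bounded_cut_Lp (lt_trans _ r1) sf fk mE' E'oo) => // x nE.
by apply: f0 => /EE'.
Qed.

Lemma bounded_on_cutoff f G : mble G -> bounded_on f -> bounded_on (cutoff G f).
Proof.
move=> mG [sf [[k fk] f0]]; split; first exact: sm_cutoff.
have k0 : (0 <= k)%R by exact: le_trans (fk point).
split.
  exists k => x; have [Gx|nG] := pselect (G x); first by rewrite cutoff_in.
  by rewrite cutoff_out// normr0.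
move=> x nE; have [Gx|nG] := pselect (G x); last by rewrite cutoff_out.
by rewrite cutoff_in// f0.
Qed.

Lemma operator_split f G : mble G -> bounded_on f -> \forall x \ae m,
  (`|T f x| <= `|T (cutoff G f) x| + `|T (cutoff (~` G) f) x|)%R.
Proof.
move=> mG bf.
have := operator_add Tlin (bounded_on_cut (bounded_on_cutoff mG bf))
  (bounded_on_cut (bounded_on_cutoff (measurableC mG) bf)).
have -> : (fun z => cutoff G f z + cutoff (~` G) f z)%R = f.
  apply/funext => z; have [Gz|nG] := pselect (G z).
    by rewrite cutoff_in// cutoff_out ?addr0// => /(_ Gz).
  by rewrite cutoff_out// add0r cutoff_in.
by apply: ae_mono => x ->; exact: ler_normD.
Qed.

Lemma integral_nu {Z : normedModType R} (p : R) (k : X -> Z) : (0 < p)%R ->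
  strongly_measurable m k -> (\forall x \ae m, ~ E x -> k x = 0%R) ->
  \int[nu]_x (`|k x| `^ p)%:E = \int[m]_x (`|k x| `^ p)%:E.
Proof.
move=> p0 sk k0.
have mk : measurable_fun [set: radonType mu] (fun x => (`|k x| `^ p)%:E).
  apply/measurable_EFinP.
  exact: (measurableT_comp (measurable_powR p) (sm_norm_measurable sk)).
have k00 x : 0 <= (`|k x| `^ p)%:E by rewrite lee_fin powR_ge0.
rewrite integral_mfrestr// integral_mkcond; apply: ge0_ae_eq_integral => //.
- by apply/(measurable_restrictT _ mE); exact: measurable_funTS.
- by move=> x _; rewrite patchE; case: ifP.
apply: ae_mono k0 => x kx _; rewrite patchE; case: ifPn => // /negP nE.
rewrite kx ?normr0 ?powR0 ?gt_eqF// => Ex; apply: nE; rewrite inE//.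
Qed.

Lemma measurable_norm_powR {Z : normedModType R} (p : R) (k : X -> Z) : strongly_measurable m k ->
  measurable_fun [set: radonType mu] (fun x => (`|k x| `^ p)%:E).
Proof.
move=> sk; apply/measurable_EFinP.
exact: (measurableT_comp (measurable_powR p) (sm_norm_measurable sk)).
Qed.

Local Notation K0 := (interp_const b q s).

Lemma nu_le (B : set X) : nu B <= m B.
Proof. by apply: le_radon_ext => x []. Qed.

(** Split [f] where [2 M |f|] crosses [l] and estimate each half at level [l / 2]. The weak type
    bound on the upper half is [1 / l] times the integral of [2 M |f|]. The lower half is treated by
    the bound on L^r, with [A <= M]: for real [r] it gives the lower part of [2 M |f|], and for
    infinite [r] the image is at most [l / 2], so that its level set is null. *)
Lemma strong_type_q f : bounded_on f ->
  \int[nu]_x (`|T f x| `^ q)%:E <= (K0 * (2 * M) `^ q)%:E * \int[nu]_x (`|f x| `^ q)%:E.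
Proof.
move=> bf; have cf := bounded_on_cut bf; have sf := bf.1.
have f0 := bf.2.2.
have sT := operator_sm mE Tlin cf.
pose c := (2 * M)%R; have c0 : (0 < c)%R by rewrite mulr_gt0.
pose g x := (c * `|f x|)%R.
have g0 x : (0 <= g x)%R by rewrite mulr_ge0// ltW.
have mg : measurable_fun [set: radonType mu] g.
  by apply: measurable_funM => //; exact: sm_norm_measurable.
have := @weak_to_strong _ (radonType mu) R nu b q s (fun x => `|T f x|%R) g
  (sm_norm_measurable sT) mg (fun x => normr_ge0 _) g0 q1 qs.
have -> : \int[nu]_x (g x `^ q)%:E = (c `^ q)%:E * \int[nu]_x (`|f x| `^ q)%:E.
  rewrite -ge0_integralZl//; last 2 first.
  - exact: measurable_norm_powR.
  - by rewrite lee_fin powR_ge0.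
  by apply: eq_integral => x _; rewrite -EFinM powRM// ltW.
rewrite muleA -EFinM; apply => l l0.
pose G := [set x | l < g x]%R.
have mG : mble G.
  rewrite (_ : G = g @^-1` `]l, +oo[).
    by rewrite -[X in measurable X]setTI; exact: mg.
  by apply/seteqP; split => x /=; rewrite in_itv/= andbT.
have b1 := bounded_on_cutoff mG bf; have c1 := bounded_on_cut b1.
have b2 := bounded_on_cutoff (measurableC mG) bf; have c2 := bounded_on_cut b2.
have s1 := operator_sm mE Tlin c1; have s2 := operator_sm mE Tlin c2.
have l2 : (0 < l / 2)%R by rewrite divr_gt0.
have m1 := measurable_norm_gt (l / 2)%R s1; have m2 := measurable_norm_gt (l / 2)%R s2.
apply: (le_trans (nu_le _)).
apply: (@le_trans _ _ (m ([set x | (l / 2 < `|T (cutoff G f) x|)%R] `|`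
                          [set x | (l / 2 < `|T (cutoff (~` G) f) x|)%R]))).
  apply: ae_le_measure; first exact: measurableU.
  apply: ae_mono (operator_split mG bf) => x h /= lT.
  have [|h1] := ltP (l / 2)%R `|T (cutoff G f) x|%R; first by left.
  right; rewrite /= ltNge; apply/negP => h2.
  by move: lT; rewrite ltNge => /negP; apply; rewrite (le_trans h)// [leRHS](splitr l) lerD.
apply: (le_trans (radon_extU_le m1 m2)); apply: leeD.
  have [k fk] := b1.2.1.
  apply: (le_trans (Tweak b1.1 fk b1.2.2 l2)).
  rewrite /upper_part.
  have -> : \int[m]_x (`|cutoff G f x|)%:E = \int[nu]_x (`|cutoff G f x|)%:E.
    have := @integral_nu _ 1%R _ ltr01 b1.1 (ae_everywhere _ b1.2.2).
    by under eq_integral do rewrite powRr1//; under [X in _ = X]eq_integral do rewrite powRr1//.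
  have -> : (M / (l / 2))%:E = (l^-1)%:E * c%:E.
    by rewrite -EFinM /c; congr EFin; field; rewrite gt_eqF.
  rewrite -muleA lee_wpmul2l ?lee_fin ?invr_ge0 ?(ltW l0)//.
  rewrite -ge0_integralZl//; last 2 first.
  - exact: (sm_enorm b1.1).
  - by rewrite lee_fin ltW.
  apply: le_integral_ge0 => x _; first by rewrite -EFinM lee_fin mulr_ge0// ltW.
  rewrite powRr1// -EFinM lee_fin.
  have [Gx|nG] := pselect (G x); first by rewrite cutoff_in// (_ : (l < g x)%R)// mul1r.
  by rewrite cutoff_out// normr0 mulr0 mulr_ge0.
have small x : ~ G x -> (g x <= l)%R by move=> /negP; rewrite -leNgt.
have lc0 : (0 <= l / c)%R by rewrite divr_ge0// ltW.
have fk x : (`|cutoff (~` G) f x| <= l / c)%R.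
  have [Gx|nG] := pselect (G x); last by rewrite cutoff_in// ler_pdivlMr// mulrC small.
  by rewrite cutoff_out ?normr0//; apply.
have [bt|bF] := boolP b; last first.
  have roo : r = +oo by rewrite (negbTE bF).
  have Ts := operator_weak_oo A0 mE mu0 Tlin Tbound roo lc0 c2 (ae_everywhere _ fk).
  rewrite /= mul0e -Ts; apply: le_radon_ext => x /=; apply: le_lt_trans.
  have -> : (A * (l / c) = (l / 2) * (A / M))%R by rewrite /c; field; rewrite gt_eqF.
  by rewrite ler_piMr ?(ltW l2)// ler_pdivrMr// mul1r.
have rs : r = s%:E by rewrite bt.
apply: (le_trans (operator_weak_power r1 A0 mE Tlin Tbound rs l2 c2)).
rewrite /= mul1e.
rewrite -(integral_nu s0 b2.1 (ae_everywhere _ b2.2.2)).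
have -> : (A / (l / 2) = l^-1 * (2 * A))%R by field; rewrite gt_eqF.
have A20 : (0 <= 2 * A)%R by rewrite mulr_ge0 ?ltW.
have li0 : (0 <= l^-1)%R by rewrite invr_ge0 ltW.
rewrite [((l^-1 * _) `^ s)%R]powRM// EFinM -muleA.
have -> : (l^-1 `^ s = l `^ (- s))%R.
  by rewrite -powR_inv1 ?(ltW l0)// -powRrM mulN1r.
rewrite lee_wpmul2l ?lee_fin ?powR_ge0//.
rewrite -ge0_integralZl//; last 2 first.
- exact: measurable_norm_powR b2.1.
- by rewrite lee_fin powR_ge0.
apply: le_integral_ge0 => x _; first by rewrite -EFinM lee_fin mulr_ge0// powR_ge0.
rewrite -EFinM lee_fin.
have [Gx|nG] := pselect (G x).
  rewrite cutoff_out; last by apply.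
  by rewrite normr0 powR0 ?gt_eqF// mulr0 mulr_ge0 ?powR_ge0.
rewrite cutoff_in// small// mul1r /g [((c * _) `^ s)%R]powRM ?(ltW c0)//.
rewrite ler_wpM2r ?powR_ge0//; apply: ge0_ler_powR; rewrite ?nnegrE ?(ltW s0) ?(ltW c0)//.
by rewrite ler_pM2l.
Qed.

Variable p : R.
Hypotheses (qp : (q < p)%R) (ps : (p < s)%R).

(* Splitting [f] at height [t / M * l] balances the two contributions. *)
Let t := (if b then (2 `^ q * K0) `^ (s - q)^-1 else 1)%R.
Let P := (if b then t `^ s else 2 `^ q * K0)%R.


Let K0_gt0 : (0 < K0)%R. Proof. exact: lt_le_trans (interp_const_ge1 b q1 qs). Qed.
Let c0 : (0 < 2 `^ q * K0)%R. Proof. by rewrite mulr_gt0// powR_gt0. Qed.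
Let t0 : (0 < t)%R. Proof. by rewrite /t; case: ifP => // _; rewrite powR_gt0. Qed.
Let P0 : (0 < P)%R. Proof. by rewrite /P; case: ifP => // _; rewrite powR_gt0. Qed.

(** The height [t] is chosen for this identity: the left-hand side is [2 ^ q K0 t ^ q], and
    [t ^ (s - q) = 2 ^ q K0] turns it into [t ^ s], the constant of the L^s contribution. For
    infinite [r] there is a single contribution and [t = 1]. *)
Let PE : (K0 * (2 * M) `^ q * (t / M) `^ q = P)%R.
Proof.
have M00 := ltW M0; have t00 := ltW t0.
rewrite -mulrA -powRM ?mulr_ge0 ?divr_ge0 ?invr_ge0//.
have -> : (2 * M * (t / M) = 2 * t)%R by field; rewrite gt_eqF.
rewrite powRM//.
have tq : b -> (t `^ (s - q) = 2 `^ q * K0)%R.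
  move=> bt; rewrite /t ifT// -powRrM mulVf ?powRr1 ?(ltW c0)//.
  by rewrite subr_eq0 gt_eqF.
have tF : ~~ b -> t = 1%R by rewrite /t => /negbTE ->.
rewrite /P; move: tq; set k := K0 => tq.
case: ifP => [bt|/negbT bF]; last by rewrite tF// powR1 mulr1 mulrC.
have -> : (t `^ s = t `^ q * t `^ (s - q))%R.
  by rewrite -powRD ?(gt_eqF t0) ?implybT// addrC subrK.
by rewrite tq//; ring.
Qed.

Lemma integral_comb (u v : X -> R) (k : R) :
  measurable_fun [set: radonType mu] u -> measurable_fun [set: radonType mu] v ->
  (forall x, 0 <= u x)%R -> (forall x, 0 <= v x)%R -> (0 <= k)%R ->
  \int[nu]_x (u x)%:E + b%:R%:E * (k%:E * \int[nu]_x (v x)%:E) =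
  \int[nu]_x (u x + b%:R * (k * v x))%:E.
Proof.
move=> mu_ mv u0 v0 k0.
have mvE : measurable_fun [set: radonType mu] (fun x => (v x)%:E) by exact/measurable_EFinP.
have muE : measurable_fun [set: radonType mu] (fun x => (u x)%:E) by exact/measurable_EFinP.
rewrite -ge0_integralZl//; last first.
  by move=> x _; rewrite lee_fin.
have mkv : measurable_fun [set: radonType mu] (fun x => k%:E * (v x)%:E).
  by apply: emeasurable_funM => //; exact: measurable_cst.
have kv0 x : 0 <= k%:E * (v x)%:E by rewrite mule_ge0 ?lee_fin.
rewrite -ge0_integralZl//.
rewrite -ge0_integralD//.
- by move=> x _; rewrite lee_fin.
- by move=> x _; apply: mule_ge0 => //; rewrite lee_fin ler0n.
- by apply: emeasurable_funM => //; exact: measurable_cst.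
Qed.

(** For each [l], [min_power_le] is applied to the images of the parts of [f] above and below height
    [l t / M]. The upper part is estimated by [strong_type_q], the lower one by the bound on L^s;
    both produce the same constant [P], as [strong_interp] demands. *)
Lemma scaled_strong_type_p f : bounded_on f ->
  \int[nu]_x ((`|T f x| / 2) `^ p)%:E <= P%:E * \int[nu]_x ((`|f x| / (t / M)) `^ p)%:E.
Proof.
move=> bf; have cf := bounded_on_cut bf; have sf := bf.1.
have f0 := bf.2.2.
have sT := operator_sm mE Tlin cf.
pose c := (t / M)%R; have cc0 : (0 < c)%R by rewrite divr_gt0.
pose g x := (`|f x| / c)%R.
pose h x := (`|T f x| / 2)%R.
have g0 x : (0 <= g x)%R by rewrite divr_ge0// ltW.
have h0 x : (0 <= h x)%R by rewrite divr_ge0.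
have mg : measurable_fun [set: radonType mu] g.
  by apply: measurable_funM => //; exact: sm_norm_measurable.
have mh : measurable_fun [set: radonType mu] h.
  by apply: measurable_funM => //; exact: sm_norm_measurable.
apply: (@strong_interp _ (radonType mu) R nu b p q s P h g mh mg h0 g0 q0 qp ps (ltW P0)).
move=> l l0.
have mrel (k : X -> R) : measurable_fun [set: radonType mu] k ->
    measurable_fun [set: radonType mu] (fun x => (l < k x)%R%:R : R) /\
    measurable_fun [set: radonType mu] (fun x => (k x <= l)%R%:R : R).
  move=> mk; have nat (e : radonType mu -> bool) : measurable_fun setT e ->
      measurable_fun setT (fun x => (e x)%:R : R).
    move=> me; rewrite (_ : (fun x => _) = (fun x => if e x then 1%R else 0%R)).
      exact: measurable_fun_ifT.
    by apply/funext => x; case: (e x).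
  by split; apply: nat; [exact: measurable_fun_ltr|exact: measurable_fun_ler].
pose G := [set x | l < g x]%R.
have mG : mble G.
  rewrite (_ : G = g @^-1` `]l, +oo[).
    by rewrite -[X in measurable X]setTI; exact: mg.
  by apply/seteqP; split => x /=; rewrite in_itv/= andbT.
have b1 := bounded_on_cutoff mG bf; have c1 := bounded_on_cut b1.
have b2 := bounded_on_cutoff (measurableC mG) bf; have c2 := bounded_on_cut b2.
have s1 := operator_sm mE Tlin c1; have s2 := operator_sm mE Tlin c2.
have small x : ~ G x -> (g x <= l)%R by move=> /negP; rewrite -leNgt.
pose f1 := cutoff G f; pose f2 := cutoff (~` G) f.
have lqs : (0 <= l `^ (q - s))%R by exact: powR_ge0.
apply: (@le_trans _ _ (\int[nu]_x (`|T f1 x| `^ q)%:E +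
    b%:R%:E * ((l `^ (q - s))%:E * \int[nu]_x (`|T f2 x| `^ s)%:E))).
  have mhp (k : R) : measurable_fun [set: radonType mu] (fun x => h x `^ k)%R.
    exact: (measurableT_comp (measurable_powR k) mh).
  rewrite /upper_part /lower_part integral_comb//; last 4 first.
  - by apply: measurable_funM => //; exact: (mrel _ mh).1.
  - by apply: measurable_funM => //; exact: (mrel _ mh).2.
  - by move=> x; rewrite mulr_ge0 ?powR_ge0.
  - by move=> x; rewrite mulr_ge0 ?powR_ge0.
  have mTf (k : R) (f' : X -> V) : cut_Lp mu E' r f' ->
      measurable_fun [set: radonType mu] (fun x => `|T f' x| `^ k)%R.
    move=> cf'; apply: (measurableT_comp (measurable_powR k)).
    exact: (sm_norm_measurable (operator_sm mE Tlin cf')).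
  rewrite integral_comb; [|exact: mTf|exact: mTf|by move=> x; exact: powR_ge0|by move=> x; exact: powR_ge0|by []].
  apply: ae_ge0_le_integral => //.
  - by move=> x _; rewrite lee_fin addr_ge0 ?mulr_ge0 ?powR_ge0.
  - apply/measurable_EFinP; apply: measurable_funD.
      by apply: measurable_funM => //; exact: (mrel _ mh).1.
    apply: measurable_funM => //; apply: measurable_funM => //.
    by apply: measurable_funM => //; exact: (mrel _ mh).2.
  - by move=> x _; rewrite lee_fin addr_ge0 ?mulr_ge0 ?powR_ge0.
  - apply/measurable_EFinP; apply: measurable_funD; first exact: mTf.
    apply: measurable_funM => //; apply: measurable_funM => //; exact: mTf.
  (* For infinite [r] one has [t = 1], so that [|f2| <= l / M] and [|T f2| <= l]: this is the side
     condition of [min_power_le]. *)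
  have f2l : ~~ b -> \forall x \ae m, (`|T f2 x| <= l)%R.
    move=> bF; have roo : r = +oo by rewrite (negbTE bF).
    have lc0 : (0 <= l / M)%R by rewrite divr_ge0// ltW.
    apply: (Lp_norm_oo_ae mu0); have := Tbound c2; rewrite roo => /le_trans; apply.
    apply: (@le_trans _ _ (A%:E * (l / M)%:E)).
      rewrite lee_wpmul2l ?lee_fin ?(ltW A0)//; apply: Lp_norm_oo_le => //.
      apply: ae_everywhere => x; have [Gx|nG] := pselect (G x).
        by rewrite /f2 cutoff_out ?normr0//; apply.
      rewrite /f2 cutoff_in//; have := small x nG.
      by rewrite /g /c /t (negbTE bF) ler_pdivrMr ?divr_gt0// mul1r.
    rewrite -EFinM lee_fin (_ : A * (l / M) = l * (A / M))%R; last by ring.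
    by rewrite ler_piMr ?(ltW l0)// ler_pdivrMr// mul1r.
  apply: ae_mfrestr.
  have {}f2l : \forall x \ae m, ~~ b -> (`|T f2 x| <= l)%R.
    have [bt|bF] := boolP b; first exact: ae_everywhere.
    by apply: ae_mono (f2l bF) => x.
  apply: ae_mono2 (operator_split mG bf) f2l => x h1 h2 _ _.
  by rewrite lee_fin; apply: min_power_le.
have f1E : \int[nu]_x (`|T f1 x| `^ q)%:E <= P%:E * upper_part nu q g l.
  apply: (le_trans (strong_type_q b1)); rewrite -PE [X in _ <= X * _]EFinM -muleA.
  have K00 : (0 <= K0 * (2 * M) `^ q)%R by rewrite mulr_ge0 ?powR_ge0 ?ltW.
  rewrite lee_wpmul2l ?lee_fin// /upper_part -ge0_integralZl//; last 3 first.
  - apply/measurable_EFinP; apply: measurable_funM; first exact: (mrel _ mg).1.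
    exact: (measurableT_comp (measurable_powR q) mg).
  - by move=> x _; rewrite lee_fin mulr_ge0 ?powR_ge0.
  - by rewrite lee_fin powR_ge0.
  apply: le_integral_ge0 => x _; first by rewrite lee_fin powR_ge0.
  rewrite -EFinM lee_fin; have [Gx|nG] := pselect (G x); last first.
    by rewrite cutoff_out// normr0 powR0 ?gt_eqF// !mulr_ge0 ?powR_ge0.
  rewrite cutoff_in// (_ : (l < g x)%R = true)// mul1r -powRM ?(ltW cc0)//.
  by rewrite /g mulrC divfK ?gt_eqF.
have f2E : b%:R%:E * ((l `^ (q - s))%:E * \int[nu]_x (`|T f2 x| `^ s)%:E) <=
    b%:R%:E * ((l `^ (q - s))%:E * (P%:E * lower_part nu s g l)).
  have [bt|bF] := boolP b; last by rewrite !mul0e.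
  rewrite !mul1e; apply: lee_wpmul2l; first by rewrite lee_fin.
  have rs : r = s%:E by rewrite bt.
  rewrite (integral_nu s0 (operator_sm mE Tlin c2) (operator_supp Tlin c2)).
  apply: (le_trans (operator_power_le r1 A0 Tbound rs c2)).
  rewrite -(integral_nu s0 b2.1 (ae_everywhere _ b2.2.2)).
  have PsE : P = (t `^ s)%R by rewrite /P bt.
  rewrite PsE /lower_part.
  have ts0 : 0 <= (t `^ s)%:E by rewrite lee_fin powR_ge0.
  have As0 : 0 <= (A `^ s)%:E by rewrite lee_fin powR_ge0.
  have mf2 := measurable_norm_powR s b2.1.
  have low0 x : 0 <= ((g x <= l)%R%:R * g x `^ s)%:E by rewrite lee_fin mulr_ge0 ?powR_ge0.
  have f20 x : 0 <= (`|cutoff (~` G) f x| `^ s)%:E by rewrite lee_fin powR_ge0.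
  have mlow : measurable_fun [set: radonType mu] (fun x => ((g x <= l)%R%:R * g x `^ s)%:E).
    apply/measurable_EFinP; apply: measurable_funM; first exact: (mrel _ mg).2.
    exact: (measurableT_comp (measurable_powR s) mg).
  rewrite -ge0_integralZl// -ge0_integralZl//.
  apply: le_integral_ge0 => x _; first by rewrite -EFinM lee_fin mulr_ge0// powR_ge0.
  rewrite -!EFinM lee_fin; have [Gx|nG] := pselect (G x).
    rewrite cutoff_out; last by apply.
    by rewrite normr0 powR0 ?gt_eqF// mulr0 !mulr_ge0 ?powR_ge0.
  rewrite cutoff_in// small// mul1r -!powRM ?(ltW A0) ?(ltW t0)//.
  apply: ge0_ler_powR; rewrite ?nnegrE ?mulr_ge0 ?invr_ge0 ?(ltW cc0) ?(ltW s0) ?(ltW A0) ?(ltW t0)//.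
  rewrite /g /c (_ : t * (`|f x| / (t / M)) = M * `|f x|)%R; last first.
    by field; rewrite !gt_eqF.
  by rewrite ler_wpM2r.
apply: (le_trans (leeD f1E f2E)).
have := upper_part_ge0 nu q g l; have := lower_part_ge0 nu s g l.
move: (upper_part nu q g l) (lower_part nu s g l) => u w w0 u0.
rewrite ge0_muleDr//; last by rewrite !mule_ge0// lee_fin ?ler0n.
by rewrite [in leRHS]muleCA [(P%:E * ((l `^ _)%:E * w))]muleCA.
Qed.

Local Notation e := (phi_exponent b p q s).
Local Notation Q := (4 * M * K0 `^ e)%R.
Let p0 : (0 < p)%R. Proof. exact: lt_trans qp. Qed.
Let Q0 : (0 < Q)%R. Proof. by rewrite !mulr_gt0// powR_gt0. Qed.

(** The exponent [e] originates here: [P ^ (1 / p) = t ^ (s / p)] is [t] times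
    [(2 ^ q K0) ^ ((s / p - 1) / (s - q))], and that last exponent equals [e]. The leftover
    [2 ^ (q e)] is at most [2], because [q e = q (s - p) / (p (s - q)) <= 1]. For infinite [r] it is
    [2 ^ (q / p)], also at most [2]. *)
Let P_le : (P <= (2 * t * K0 `^ e) `^ p)%R.
Proof.
have t00 := ltW t0; have K00 := ltW K0_gt0.
have pn0 : (p != 0)%R by rewrite gt_eqF.
have tT : b -> (t = (2 `^ q * K0) `^ (s - q)^-1)%R by rewrite /t => ->.
have tF : ~~ b -> t = 1%R by rewrite /t => /negbTE ->.
rewrite /P /phi_exponent; set k := K0 in tT K00 *.
case: ifP => [bt|/negbT bF]; last first.
  rewrite (tF bF) mulr1 powRM ?powR_ge0// -powRrM mulVf// powRr1//.
  rewrite ler_wpM2r//; apply: ler_powR; first by rewrite ler1n.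
  exact: ltW.
have sp : (t `^ s = (t `^ (s / p)) `^ p)%R by rewrite -powRrM divfK.
rewrite sp; apply: ge0_ler_powR; rewrite ?nnegrE ?mulr_ge0 ?powR_ge0 ?(ltW p0)//.
have -> : (t `^ (s / p) = t * t `^ (s / p - 1))%R.
  by rewrite -{2}[t]powRr1// -powRD ?(gt_eqF t0) ?implybT// addrC subrK.
rewrite [(2 * t)%R]mulrC -mulrA ler_wpM2l//.
set e' := ((p^-1 - s^-1) / (1 - q / s))%R.
have sq : (0 < s - q)%R by rewrite subr_gt0.
have -> : (t `^ (s / p - 1) = 2 `^ (q * e') * k `^ e')%R.
  rewrite (tT bt) -powRrM.
  have -> : ((s - q)^-1 * (s / p - 1) = e')%R.
    by rewrite /e'; field; rewrite !gt_eqF.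
  by rewrite powRM ?powR_ge0// -powRrM.
rewrite ler_wpM2r ?powR_ge0// -[leRHS]powRr1//; apply: ler_powR; first by rewrite ler1n.
have -> : (q * e' = (q * (s - p)) / (p * (s - q)))%R.
  by rewrite /e'; field; rewrite !gt_eqF.
rewrite ler_pdivrMr ?mulr_gt0// mul1r.
have : (q * s <= p * s)%R by rewrite ler_pM2r// ltW.
by move=> h; rewrite !mulrBr [(q * p)%R]mulrC; apply: lerB.
Qed.

(** Undoing the scaling multiplies the factors [2], from halving [T f], [M / t], from scaling [f],
    and [2 t K0 ^ e], from [P_le]; the height [t] cancels. *)
Lemma strong_type_bounded f : bounded_on f ->
  Lp_norm mu p%:E (T f) <= Q%:E * Lp_norm mu p%:E f.
Proof.
move=> bf; have cf := bounded_on_cut bf; have sf := bf.1.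
have sT := operator_sm mE Tlin cf; have oT := operator_supp Tlin cf.
have of_ := ae_everywhere mu bf.2.2.
have [M00 t00] := (ltW M0, ltW t0).
have main : \int[m]_x (`|T f x| `^ p)%:E <= (Q `^ p)%:E * \int[m]_x (`|f x| `^ p)%:E.
  rewrite -(integral_nu p0 sT oT) -(integral_nu p0 sf of_).
  have := scaled_strong_type_p bf.
  have -> : \int[nu]_x ((`|T f x| / 2) `^ p)%:E =
      (2^-1 `^ p)%:E * \int[nu]_x (`|T f x| `^ p)%:E.
    rewrite -ge0_integralZl//; last exact: measurable_norm_powR.
    by apply: eq_integral => x _; rewrite -EFinM -powRM ?invr_ge0// mulrC.
  have -> : \int[nu]_x ((`|f x| / (t / M)) `^ p)%:E =
      ((t / M)^-1 `^ p)%:E * \int[nu]_x (`|f x| `^ p)%:E.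
    rewrite -ge0_integralZl//; last 2 first.
    - exact: measurable_norm_powR.
    - by rewrite lee_fin powR_ge0.
    by apply: eq_integral => x _; rewrite -EFinM -powRM ?invr_ge0 ?divr_ge0// mulrC.
  rewrite -lee_pdivlMl ?powR_gt0 ?invr_gt0// => /le_trans; apply.
  rewrite !muleA -!EFinM lee_wpmul2r//.
    by apply: integral_ge0 => x _; rewrite lee_fin powR_ge0.
  rewrite lee_fin.
  have -> : ((2^-1 `^ p)^-1 = 2 `^ p)%R.
    by rewrite -[X in (X `^ p)%R]powR_inv1// -powRrM mulN1r powRN invrK.
  rewrite mulrAC -powRM ?invr_ge0 ?divr_ge0//.
  have -> : Q = (2 * (t / M)^-1 * (2 * t * K0 `^ e))%R.
    by field; rewrite !gt_eqF.
  rewrite [leRHS]powRM ?mulr_ge0 ?invr_ge0 ?divr_ge0 ?powR_ge0//.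
  by apply: ler_wpM2l; [exact: powR_ge0|exact: P_le].
rewrite !Lp_normE.
apply: (@le_trans _ _ (((Q `^ p)%:E * \int[m]_x (`|f x| `^ p)%:E) `^ p^-1)).
  apply: gt0_ler_poweR main; first by rewrite invr_ge0 ltW.
    rewrite in_itv/= leey andbT.
    by apply: integral_ge0 => x _; rewrite lee_fin powR_ge0.
  rewrite in_itv/= leey andbT mule_ge0 ?lee_fin ?powR_ge0//.
  by apply: integral_ge0 => x _; rewrite lee_fin powR_ge0.
rewrite poweRM ?lee_fin ?powR_ge0//; last first.
  by apply: integral_ge0 => x _; rewrite lee_fin powR_ge0.
by rewrite poweR_EFin -powRrM mulfV ?gt_eqF// powRr1// ltW.
Qed.

Let r0 : 0 < r. Proof. exact: lt_trans r1. Qed.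

(** As [E] has finite measure, smallness in L^s implies smallness in L^p: integrate
    [x ^ p <= eta ^ p + eta ^ (p - s) x ^ s] over [E]. It controls the image of the tail left by
    truncation. *)
Lemma small_power (eps : R) : b -> (0 < eps)%R -> exists2 d : R, (0 < d)%R &
  forall k : X -> W, strongly_measurable m k -> (\forall x \ae m, ~ E x -> k x = 0%R) ->
  \int[m]_x (`|k x| `^ s)%:E <= d%:E -> Lp_norm mu p%:E k <= eps%:E.
Proof.
move=> bT eps0.
pose a := (fine (m E) + 1)%R.
have mE0 : (0 <= fine (m E))%R by exact: fine_ge0.
have a0 : (0 < a)%R by rewrite ltr_wpDl.
have ps0 : (0 < s - p)%R by rewrite subr_gt0.
(* Chosen so that [eta ^ p m(E)] is at most half of [eps ^ p]; the [+ 1] in [a] covers a null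
   [E]. *)
pose eta := ((eps `^ p / (2 * a)) `^ p^-1)%R.
have ep0 : (0 < eps `^ p)%R by exact: powR_gt0.
have epa0 : (0 < eps `^ p / (2 * a))%R by apply: divr_gt0 => //; exact: mulr_gt0.
have eta0 : (0 < eta)%R by exact: powR_gt0.
have etap : (eta `^ p = eps `^ p / (2 * a))%R.
  by rewrite /eta -powRrM mulVf ?gt_eqF// powRr1// divr_ge0 ?mulr_ge0 ?(ltW a0) ?(ltW ep0).
exists (eta `^ (s - p) * (eps `^ p / 2))%R; first by apply: mulr_gt0; [exact: (powR_gt0 _ eta0)|exact: (divr_gt0 ep0)].
move=> k sk k0 kd.
have pt (x : R) : (0 <= x)%R -> (x `^ p <= eta `^ p + (eta `^ (s - p))^-1 * x `^ s)%R.
  move=> x0; have [xe|ex] := lerP x eta.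
    apply: (@le_trans _ _ (eta `^ p)%R).
      by apply: ge0_ler_powR; rewrite ?nnegrE ?(ltW eta0) ?(ltW p0).
    by rewrite lerDl mulr_ge0 ?invr_ge0 ?powR_ge0.
  rewrite ler_wpDl ?powR_ge0// ler_pdivlMl ?powR_gt0//.
  have xp : (0 < x)%R by exact: lt_trans ex.
  have -> : (x `^ s = x `^ (s - p) * x `^ p)%R.
    by rewrite -powRD ?(gt_eqF xp) ?implybT// subrK.
  rewrite ler_wpM2r ?powR_ge0//.
  by apply: ge0_ler_powR; rewrite ?nnegrE ?(ltW eta0) ?(ltW ps0) ?(ltW ex).
rewrite Lp_normE -[leRHS]poweRe1 ?lee_fin ?(ltW eps0)//.
rewrite -(mulfV (lt0r_neq0 p0)) poweRrM poweR_EFin.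
have I0 : 0 <= \int[m]_x (`|k x| `^ p)%:E.
  by apply: integral_ge0 => x _; rewrite lee_fin powR_ge0.
apply: gt0_ler_poweR; rewrite ?in_itv/= ?leey ?I0 ?invr_ge0 ?lee_fin ?powR_ge0 ?(ltW p0)//.
rewrite -(integral_nu p0 sk k0).
have mk := measurable_norm_powR s sk; have ek0 : (0 <= (eta `^ (s - p))^-1)%R by rewrite invr_ge0 powR_ge0.
have ks0 x : 0 <= (`|k x| `^ s)%:E by rewrite lee_fin powR_ge0.
have c00 : 0 <= (eta `^ p)%:E by rewrite lee_fin powR_ge0.
have ek00 : 0 <= ((eta `^ (s - p))^-1)%:E by rewrite lee_fin.
apply: (@le_trans _ _ (\int[nu]_x ((eta `^ p)%:E + ((eta `^ (s - p))^-1)%:E * (`|k x| `^ s)%:E))).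
  apply: le_integral_ge0 => x _; first by rewrite lee_fin powR_ge0.
  by rewrite -EFinM -EFinD lee_fin pt.
rewrite ge0_integralD//; last 2 first.
- by move=> x _; rewrite mule_ge0.
- by apply: emeasurable_funM => //; exact: measurable_cst.
rewrite integral_cst// ge0_integralZl//.
rewrite (integral_nu s0 sk k0).
rewrite -[X in _ * X + _]/(m (setT `&` E)) setTI -[m E]fineK ?ge0_fin_numE//.
apply: (@le_trans _ _ ((eta `^ p * fine (m E))%:E + ((eta `^ (s - p))^-1)%:E *
   (eta `^ (s - p) * (eps `^ p / 2))%:E)).
  by apply: leeD; [rewrite EFinM|exact: lee_wpmul2l].
rewrite -EFinM -EFinD lee_fin mulKf ?gt_eqF ?powR_gt0//.
rewrite [leRHS](splitr (eps `^ p)) lerD2r etap.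
rewrite invfM mulrA -mulrA ler_piMr ?divr_ge0 ?(ltW ep0)//.
by rewrite ler_pdivrMl// mulr1 /a lerDl.
Qed.

(** For infinite [r] the representative [f0] coincides almost everywhere with one of its
    truncations. For finite [r] it is a bounded function plus a tail, and the contribution of the
    tail to [T f] is arbitrarily small in L^p. *)
Lemma strong_type_general f : cut_Lp mu E r f ->
  Lp_norm mu p%:E (T f) <= Q%:E * Lp_norm mu p%:E f.
Proof.
move=> cf; have [sf [f0 [sf0 ff0 f00 nf0]]] := cut_sm_split mE r0 cf.
have cut (G : set X) : mble G -> cut_Lp mu E' r (cutoff G f0).
  move=> mG; exists (cutoff G f0).
    split; first exact: sm_cutoff.
    apply: le_lt_trans nf0; apply: Lp_norm_le => // x.
    have [Gx|nG] := pselect (G x); first by rewrite cutoff_in.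
    by rewrite cutoff_out// normr0.
  apply: ae_everywhere => x; have [E'x|nE'] := pselect (E' x); first by rewrite (cutoff_in _ E'x).
  rewrite (cutoff_out _ nE') /cutoff f00 ?scaler0// => /EE'//.
have cT : cutoff setT f0 = f0 by apply/funext => x; rewrite cutoff_in.
have cf0 : cut_Lp mu E' r f0 by rewrite -cT; exact: cut.
have cfE' : cut_Lp mu E' r f.
  case: cf0 => g Lg fg; exists g => //.
  by apply: ae_mono2 ff0 fg => x -> ->.
have [_ Tae _ _] := Tlin.
have TE := Tae f f0 cfE' cf0 ff0.
rewrite (Lp_norm_ae _ (operator_sm mE Tlin cfE') (operator_sm mE Tlin cf0) TE)//.
rewrite (Lp_norm_ae _ sf sf0 ff0)//.
have mG (k : R) : mble [set x | (`|f0 x| <= k)%R].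
  rewrite (_ : [set x | _] = ~` [set x | (k < `|f0 x|)%R]).
    by apply: measurableC; exact: measurable_norm_gt.
  by apply/seteqP; split => x /=; rewrite leNgt => /negP.
have bnd (k : R) : (0 <= k)%R -> bounded_on (cutoff [set x | (`|f0 x| <= k)%R] f0).
  move=> k0; split; first exact: sm_cutoff.
  split; last by move=> x nE; rewrite /cutoff f00// scaler0.
  exists k => x; have [h|h] := pselect (`|f0 x| <= k)%R; first by rewrite cutoff_in.
  by rewrite cutoff_out// normr0.
have [bT|bF] : b \/ ~~ b by case: (b); [left|right].
  2: {
  have [k k0 fk] : exists2 k : R, (0 <= k)%R & \forall x \ae m, (`|f0 x| <= k)%R.
    have nfin : Lp_norm mu +oo f0 \is a fin_num.
      by rewrite ge0_fin_numE ?Lnorm_ge0//; move: nf0; rewrite (negbTE bF).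
    exists (fine (Lp_norm mu +oo f0)); first by rewrite fine_ge0 ?Lnorm_ge0.
    by apply: (Lp_norm_oo_ae mu0); rewrite fineK.
  have f1 : \forall x \ae m, f0 x = cutoff [set x | (`|f0 x| <= k)%R] f0 x.
    by apply: ae_mono fk => x h; rewrite cutoff_in.
  have c1 := bounded_on_cut (bnd k k0).
  have TE1 := Tae _ _ cf0 c1 f1.
  rewrite (Lp_norm_ae _ (operator_sm mE Tlin cf0) (operator_sm mE Tlin c1) TE1)//.
  rewrite (Lp_norm_ae _ sf0 (bnd k k0).1 f1)//.
  exact: (strong_type_bounded (bnd k k0)). }
have rs : r = s%:E by rewrite bT.
apply/lee_addgt0Pr => eps eps0.
have [d d0 hd] := small_power bT eps0.
(* By dominated convergence the part of [f0] above height [n] tends to zero in L^s; the factor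
   [A ^ s] anticipates the bound on its image. *)
have [n hn] : exists n : nat, (A `^ s)%:E *
    \int[m]_x (`|cutoff (~` [set x | (`|f0 x| <= n%:R)%R]) f0 x| `^ s)%:E <= d%:E.
  have ioo : \int[m]_x (`|f0 x| `^ s)%:E < +oo.
    rewrite -Lp_norm_powR//; apply: poweR_lty; move: nf0.
    by rewrite bT.
  pose D n x := (`|cutoff (~` [set x | (`|f0 x| <= n%:R)%R]) f0 x| `^ s)%:E.
  have mf0 := measurable_norm_powR s sf0.
  have [_ _ cvgD] : [/\ m.-integrable setT (cst 0 : radonType mu -> \bar R),
      (fun n => \int[m]_x `|D n x - cst 0 x|) @ \oo --> 0 &
      (fun n => \int[m]_x D n x) @ \oo --> \int[m]_x (cst 0 : radonType mu -> \bar R) x].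
    apply: (@dominated_convergence _ (radonType mu) _ m setT measurableT D (cst 0)
      (fun x => (`|f0 x| `^ s)%:E)) => //.
    - by move=> n; apply: measurable_norm_powR; apply: sm_cutoff => //; exact: measurableC.
    - apply: ae_everywhere => x _; apply: cvg_near_cst.
      near=> n; rewrite /D cutoff_out ?normr0 ?powR0 ?gt_eqF//; apply => /=.
      near: n; exact: nbhs_infty_ger.
    - apply/integrableP; split => //.
      by under eq_integral do rewrite gee0_abs ?lee_fin ?powR_ge0//.
    - apply: ae_everywhere => x n _; rewrite gee0_abs ?lee_fin ?powR_ge0//.
      apply: ge0_ler_powR; rewrite ?nnegrE ?(ltW s0)//.
      have [Gx|nG] := pselect ((~` [set x | (`|f0 x| <= n%:R)%R]) x).
        by rewrite cutoff_in.
      by rewrite cutoff_out// normr0.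
  move: cvgD; rewrite integral_cst// mul0e => cvgD.
  have As0 : (0 < A `^ s)%R by exact: powR_gt0.
  have [n _ /(_ n (leqnn _)) hn] := cvge0_lt cvgD (divr_gt0 d0 As0).
  exists n; rewrite muleC -lee_pdivlMr// -EFinM; exact: ltW.
pose G := [set x | (`|f0 x| <= n%:R)%R].
have c1 := cut _ (mG n%:R); have c2 := cut _ (measurableC (mG n%:R)).
have TD : \forall x \ae m, T f0 x = (T (cutoff G f0) x + T (cutoff (~` G) f0) x)%R.
  have := operator_add Tlin c1 c2.
  rewrite (_ : (fun z => cutoff _ f0 z + cutoff _ f0 z)%R = f0)//.
  apply/funext => z; have [Gz|nG] := pselect (G z).
    by rewrite cutoff_in// cutoff_out ?addr0// => /(_ Gz).
  by rewrite cutoff_out// add0r cutoff_in.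
have s1 := operator_sm mE Tlin c1; have s2 := operator_sm mE Tlin c2.
apply: (@le_trans _ _ (Lp_norm mu p%:E (T (cutoff G f0)) +
    Lp_norm mu p%:E (T (cutoff (~` G) f0)))).
  rewrite (Lp_norm_ae _ (operator_sm mE Tlin cf0) (smD s1 s2) TD)//.
  exact: (Lp_normD (ltW (lt_trans q1 qp)) s1 s2).
apply: leeD; last first.
  apply: hd => //; first exact: (operator_supp Tlin c2).
  exact: le_trans (operator_power_le r1 A0 Tbound rs c2) hn.
apply: (le_trans (strong_type_bounded (bnd n%:R _))) => //.
apply: lee_wpmul2l; first by rewrite lee_fin ltW.
apply: Lp_norm_le => // x.
have [Gx|nG] := pselect (G x); first by rewrite cutoff_in.
by rewrite cutoff_out// normr0.
Unshelve. all: by end_near. Qed.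

End strong_type.

(** * Doubling constant and interpolation constant *)

Section doubling_facts.
Context {R : realType} {X : pmetricType R} (mu : radon_measure X).
Local Notation m := (radon_ext mu).
Hypothesis mu_supp : supp mu = [set: X].

Lemma ball_pos (x : X) (s : R) : (0 < s)%R -> 0 < m (ball x s).
Proof.
move=> s0; have : supp mu x by rewrite mu_supp.
move=> /(_ (ball x s) (mball_open x s) (ballxx x s0)).
by rewrite radon_extE//; apply: sub_sigma_algebra; exact: mball_open.
Qed.

Variables (T : R) (dfin : doubling_const mu T < +oo).

Lemma doubling_const_ge1 : 1 <= doubling_const mu T.
Proof. by apply: le_ereal_inf_tmp => D []. Qed.

(** When the ball on the right has finite measure, dividing by it, as it is positive, shows every
    admissible constant to be above one fixed quotient, and hence the infimum too. When it is
    infinite, so is the right-hand side. *)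
Lemma doubling_attained (x : X) (s : R) : (0 < s)%R -> (s <= T)%R ->
  m (ball x (2 * s)%R) <= doubling_const mu T * m (ball x s).
Proof.
move=> s0 sT; have pos := ball_pos x s0.
have mb (k : R) : measurable (ball x k : set (borelType X)).
  by apply: sub_sigma_algebra; exact: mball_open.
have [foo|] := ltP (m (ball x s)) +oo; last first.
  rewrite leye_eq => /eqP ->; rewrite gt0_muley ?leey//.
  exact: lt_le_trans doubling_const_ge1.
have fm : m (ball x s) \is a fin_num by rewrite ge0_fin_numE.
rewrite -(fineK fm) -lee_pdivrMr; last by rewrite fine_gt0// pos.
apply: le_ereal_inf_tmp => D [D1 Dd].
rewrite lee_pdivrMr; last by rewrite fine_gt0// pos.
rewrite fineK//; have := Dd x s; rewrite s0 sT => /(_ isT).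
by rewrite -!radon_extE.
Qed.

(** Small balls about [x] have finite measure by local finiteness, and doubling carries finiteness
    from radius [s / 2 ^ n] up to [s]. *)
Lemma ball_finite (x : X) (s : R) : (s <= T)%R -> m (ball x s) < +oo.
Proof.
move=> sT.
have dn : doubling_const mu T \is a fin_num.
  by rewrite ge0_fin_numE// (le_trans _ doubling_const_ge1).
have [U [oU Ux Uoo]] := radon_locally_finite mu x.
have : nbhs x U by exact: open_nbhs_nbhs.
move=> /nbhs_ballP[d /= d0 dU].
have dball : m (ball x d) < +oo.
  apply: le_lt_trans Uoo; rewrite -radon_extE; last exact: sub_sigma_algebra.
  exact: le_radon_ext.
have [s0|s0] := ltP 0%R s; last first.
  apply: le_lt_trans dball; apply: le_radon_ext => y /ball_mdist xy.
  by apply/ball_mdist; apply: lt_trans d0; exact: lt_le_trans s0.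
have main n : forall s : R, (0 < s)%R -> (s <= T)%R -> (dyadic s n < d)%R -> m (ball x s) < +oo.
  elim: n => [|n ih] {}s {}s0 {}sT.
    rewrite /dyadic expr0 divr1 => sd; apply: le_lt_trans dball.
    by apply: le_radon_ext; exact: le_ball (ltW sd).
  move=> sd; have s20 : (0 < s / 2)%R by rewrite divr_gt0.
  have s2s : (s / 2 <= T)%R by rewrite (le_trans _ sT)// ler_pdivrMr// ler_peMr ?ltW// ltr1n.
  have := doubling_attained x s20 s2s; rewrite [(2 * _)%R]mulrC divfK//.
  move=> /le_lt_trans; apply; rewrite -(fineK dn) lte_mul_pinfty//.
    by rewrite lee_fin fine_ge0// (le_trans _ doubling_const_ge1).
  apply: ih => //; move: sd; rewrite /dyadic exprS invfM mulrA//.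
by have [n /main] := dyadic_lt (c := s) s0 d0; apply.
Qed.

End doubling_facts.

Section phi_facts.
Context {R : realType}.

(** For real [r] this rests on [1 / (s / q - 1) = q / (s - q)]; for infinite [r] the conventions at
    [+oo] leave the base [q / (q - 1)] and the exponent [1 / p]. *)
Lemma phi_elementE (b : bool) (p q s : R) : (1 < q)%R -> (q < p)%R -> (p <= s)%R ->
  let r := if b then s%:E else +oo in
  (hoelder_conjugate q%:E + (r / q%:E - 1)^-1)
     `^ fine ((p%:E^-1 - r^-1) / (1 - q%:E / r)) =
  (interp_const b q s `^ phi_exponent b p q s)%:E.
Proof.
move=> q1 qp ps r; have q0 : (0 < q)%R by exact: lt_trans q1.
have p0 : (0 < p)%R by exact: lt_trans qp.
have qs : (q < s)%R by exact: lt_le_trans ps.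
have s0 : (0 < s)%R by exact: lt_trans qs.
have conj : hoelder_conjugate q%:E = (q / (q - 1))%:E.
  rewrite /hoelder_conjugate/= eqe gt_eqF// -EFinB inver subr_eq0 gt_eqF//.
rewrite conj /r /interp_const /phi_exponent; case: b {r}.
- have sq : (s / q - 1 != 0)%R by rewrite subr_eq0 gt_eqF// ltr_pdivlMr// mul1r.
  have qs1 : (1 - q / s != 0)%R by rewrite subr_eq0 gt_eqF// ltr_pdivrMr// mul1r.
  rewrite !inver !gt_eqF// -!EFinM -!EFinB !inver (negbTE sq) (negbTE qs1).
  rewrite -EFinM -EFinD /= mul1r.
  by congr (_ `^ _)%:E; congr (_ + _)%R; field; rewrite !gt_eqF ?subr_gt0.
- rewrite invey mule0 !sube0 inve1 mule1 !inver !gt_eqF//.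
  rewrite gt0_mulye ?lte_fin ?invr_gt0//.
  by rewrite addye// invey adde0 /= mul0r addr0.
Qed.

(** For every [q] the base is at least [1] and the exponent nonnegative. This settles [p = r] and
    makes phi a positive factor. *)
Lemma phi_ge1 (r p : \bar R) : 1 < p -> p <= r -> 1 <= interp_phi r p.
Proof.
move=> p1 pr; apply: le_ereal_inf_tmp => _ [q [q1 qp] <-].
case: p p1 pr qp => [p||//] p1 pr qp; last first.
  move: pr; rewrite leye_eq => /eqP ->; rewrite !invey mule0 sube0 sube0 mul0e /=.
  by rewrite poweRe0.
have p0 : (0 < p)%R by rewrite -lte_fin (lt_trans _ p1)// lte_fin.
have pow1 b (s : R) : (p <= s)%R ->
    1 <= (interp_const b q s `^ phi_exponent b p q s)%:E.
  move=> ps; have qs : (q < s)%R by exact: lt_le_trans ps.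
  have q0 : (0 < q)%R by exact: lt_trans q1.
  have s0 : (0 < s)%R by exact: lt_trans qs.
  rewrite lee_fin -[leLHS](powRr0 (interp_const b q s)); apply: ler_powR.
    exact: interp_const_ge1.
  rewrite /phi_exponent; case: b; last by rewrite invr_ge0 ltW.
  rewrite divr_ge0 ?subr_ge0//; first by rewrite lef_pV2.
  by rewrite ler_pdivrMr// mul1r ltW.
case: r pr => [s||//] pr.
  have := phi_elementE true q1 qp pr; rewrite /= => ->; exact: pow1.
have := phi_elementE false q1 qp (lexx p); rewrite /= => ->; exact: pow1.
Qed.

End phi_facts.

(** For [p < r] the bound at a fixed [q] is [strong_type_general] fed with the weak type estimate,
    and it remains to take the infimum over [q]. For [p = r] the assumed bound on [T] is enough,
    because phi is at least [1]. *)
Theorem theorem14 (R : realType) (X : pmetricType R) (mu : radon_measure X)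
  (X_locally_compact : locally_compact [set: X])
  (X_connected : connected [set: X])
  (mu_neq0 : mu [set: X] != 0)
  (mu_supp : supp mu = [set: X])
  (B1 B2 : completeNormedModType R)
  (rho : R) (rho_gt0 : (0 < rho)%R)
  (r : \bar R) (r_gt1 : 1 < r)
  (kappa : R) (kappa_gt2 : (2 < kappa)%R)
  (doubling : doubling_const mu (3 * kappa * rho) < +oo)
  (E : set X) (E_measurable : radon_measurable mu E)
  (E_diameter : diameter E < rho%:E)
  (T : (X -> B1) -> (X -> B2))
  (T_cont_linear : continuous_linear_Lp mu r (set_ball E (rho / 2)) E T)
  (K : X * X -> cont_linear B1 B2)
  (K_measurable :
    prod_strongly_measurable mu (E `*` set_ball E (rho / 2)) K)
  (A C : R) (A_gt0 : (0 < A)%R) (C_gt0 : (0 < C)%R)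
  (T_kernel : forall F : set X, open F -> F `<=` set_ball E (rho / 2) ->
    prod_strongly_integrable mu ((E `\` F) `*` F) K /\
    forall f : X -> B1, cut_Lp mu F +oo f ->
      \forall x \ae radon_ext mu, (E `\` F) x ->
        bochner_integral_eq mu F (fun y => K (x, y) (f y)) (T f x))
  (T_bound : forall f : X -> B1, cut_Lp mu (set_ball E (rho / 2)) r f ->
    Lp_norm mu r (T f) <= A%:E * Lp_norm mu r f)
  (K_hormander :
    \forall y \ae radon_ext mu, set_ball E (rho / 2) y ->
      \forall y' \ae radon_ext mu, set_ball E (rho / 2) y' ->
        (mdist y y' < rho)%R ->
        \int[radon_ext mu]_(x in E `\` ball (y : X) (2 * mdist y y'))
          `|K (x, y) - K (x, y')|%:E <= C%:E)
  (p : \bar R) (p_gt1 : 1 < p) (p_le_r : p <= r)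
  (f : X -> B1) (f_in : cut_Lp mu E r f) :
  Lp_norm mu p (T f) <=
    16%:E * interp_phi r p *
      (doubling_const mu (3 * kappa * rho) ^+ 9 * A%:E + C%:E) *
      Lp_norm mu p f.
Proof.
have r0 : 0 < r by exact: lt_trans r_gt1.
have phi1 := phi_ge1 p_gt1 p_le_r.
set Dd := doubling_const mu _ in doubling *.
have D1e : 1 <= Dd by exact: doubling_const_ge1.
have Dfin : Dd \is a fin_num by rewrite ge0_fin_numE// (le_trans _ D1e).
pose D := fine Dd; have DE : Dd = D%:E by rewrite fineK.
have D1 : (1 <= D)%R by rewrite -lee_fin -DE.
have D0 : (0 < D)%R by exact: lt_le_trans D1.
rewrite DE -EFin_expe -EFinM -EFinD.
set Z := (D ^+ 9 * A + C)%R.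
have Z0 : (0 < Z)%R by rewrite addr_gt0// mulr_gt0// exprn_gt0.
have N0 (V : normedModType R) (q : \bar R) (k : X -> V) : 0 <= Lp_norm mu q k by exact: Lnorm_ge0.
have phi0 : 0 < interp_phi r p by exact: lt_le_trans phi1.
have rho6 : (6 * rho <= 3 * kappa * rho)%R by rewrite ler_pM2r//; lra.
have mE : measurable (E : set (radonType mu)) by [].
pose E' := set_ball E (rho / 2).
have mE' : measurable (E' : set (radonType mu)) by apply: open_radon; exact: set_ball_open.
have rho2 : (0 < rho / 2)%R by rewrite divr_gt0.
have EE' : E `<=` E'.
  by rewrite /E' set_ball_bigcup => y Ey; exists y => //; exact: ballxx.
have [sf [f0 [sf0 ff0 f00 nf0]]] := cut_sm_split mE r0 f_in.
have cf : cut_Lp mu E' r f.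
  exists f0 => //; apply: ae_mono ff0 => x ->.
  have [E'x|nE'] := pselect (E' x); first by rewrite (cutoff_in _ E'x).
  by rewrite (cutoff_out _ nE') f00// => /EE'.
have sT := operator_sm mE T_cont_linear cf.
(* An empty [E] offers no point about which to centre [S]; there [T f] vanishes almost
   everywhere. *)
have [E0|/set0P[x0 Ex0]] := eqVneq E set0.
  have p0 : 0 < p by exact: lt_trans p_gt1.
  have Tf0 : \forall x \ae radon_ext mu, T f x = 0%R.
    by apply: ae_mono (operator_supp T_cont_linear cf) => x; apply; rewrite E0.
  rewrite (Lp_norm_ae p0 sT (@sm0 _ _ mu B2) Tf0).
  have -> : Lp_norm mu p (fun=> 0%R : B2) = 0.
    rewrite /Lp_norm -[RHS](@Lnorm0 _ _ _ (radon_ext mu) p) ?gt_eqF//.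
    by apply: eq_Lnorm => x; rewrite normr0.
  by rewrite !mule_ge0// ?lee_fin ?ltW.
have Ed x y : E x -> E y -> (mdist x y < rho)%R.
  move=> Ex Ey; rewrite -lte_fin; apply: le_lt_trans E_diameter.
  by apply: ereal_sup_ubound; exists (x, y).
have posB := ball_pos mu_supp.
have finB x s : (s <= 6 * rho)%R -> radon_ext mu (ball x s) < +oo.
  by move=> s6; apply: (ball_finite mu_supp doubling); exact: le_trans rho6.
have dbl x s : (0 < s)%R -> (s <= 6 * rho)%R ->
    radon_ext mu (ball x (2 * s)%R) <= D%:E * radon_ext mu (ball x s).
  by move=> s0 s6; rewrite -DE; apply: doubling_attained => //; exact: le_trans rho6.
have mu0 : 0 < radon_ext mu setT.
  by apply: (lt_le_trans (posB x0 _ rho_gt0)); exact: le_radon_ext.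
have E'oo : radon_ext mu E' < +oo.
  have h : (2 * rho <= 6 * rho)%R by rewrite ler_pM2r// ler_nat.
  apply: le_lt_trans (finB x0 _ h); apply: le_radon_ext.
  exact: set_ball_subset.
have Eoo : radon_ext mu E < +oo by apply: le_lt_trans E'oo; exact: le_radon_ext.
pose M := (4 * (D ^+ 5 * A + C))%R.
have weak := weak_type D1 rho_gt0 dbl posB finB Ex0 Ed mE r_gt1 T_cont_linear
  K_measurable A_gt0 C_gt0 (fun F oF FE' => (T_kernel F oF FE').2) T_bound K_hormander.
have D59 : (D ^+ 5 * A <= D ^+ 9 * A)%R by rewrite ler_pM2r// ler_weXn2l.
have D5A : (1 * A <= D ^+ 5 * A)%R by rewrite ler_pM2r// exprn_ege1.
(* [4 M] is [16 (D ^ 5 A + C)], and [D >= 1] allows the exponent to be raised to [9]. *)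
have [M4 AM] : (4 * M <= 16 * Z)%R /\ (A <= M)%R.
  rewrite /M /Z; move: (D ^+ 5 * A)%R (D ^+ 9 * A)%R D59 D5A => u v uv Au.
  by split; lra.
have strong (b : bool) (q s p' : R) : (1 < q)%R -> (q < p')%R -> (p' < s)%R ->
    r = (if b then s%:E else +oo) ->
    Lp_norm mu p'%:E (T f) <=
      (4 * M * interp_const b q s `^ phi_exponent b p' q s)%:E * Lp_norm mu p'%:E f.
  move=> q1 qp ps rE; rewrite rE in T_cont_linear T_bound f_in weak.
  exact: (@strong_type_general _ _ _ (B1 : normedModType R) (B2 : normedModType R) b q s q1
    (lt_trans qp ps) A M A_gt0 AM E E' mE mE' EE' Eoo E'oo mu0 T T_cont_linear T_bound
    weak p' qp ps f f_in).
(* Passing to the infimum requires division by the norm of [f]. An infinite norm makes the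
   right-hand side infinite; for a zero norm a single [q], here the midpoint of [1] and [p'],
   already gives the claim. *)
have inf_step (p' : R) : p = p'%:E ->
    (forall q, (1 < q)%R -> (q < p')%R -> exists2 k : R, (0 <= k)%R &
      (hoelder_conjugate q%:E + (r / q%:E - 1)^-1)
       `^ fine ((p^-1 - r^-1) / (1 - q%:E / r)) = k%:E /\
      Lp_norm mu p (T f) <= (4 * M * k)%:E * Lp_norm mu p f) ->
    Lp_norm mu p (T f) <= 16%:E * interp_phi r p * Z%:E * Lp_norm mu p f.
  move=> pE hq; have p'1 : (1 < p')%R by rewrite -lte_fin -pE.
  have c0 : 0 <= 16%:E * interp_phi r p * Z%:E.
    by rewrite !mule_ge0 ?lee_fin ?ltW.
  have Zpos : 0 < 16%:E * interp_phi r p * Z%:E.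
    by rewrite !mule_gt0 ?lte_fin.
  have [Nf|] := boolP (Lp_norm mu p f \is a fin_num); last first.
    rewrite ge0_fin_numE// -leNgt leye_eq => /eqP ->.
    by rewrite gt0_muley// leey.
  pose n := fine (Lp_norm mu p f).
  have nE : Lp_norm mu p f = n%:E by rewrite fineK.
  have n0 : (0 <= n)%R by exact: fine_ge0.
  rewrite nE in hq *; have [n00|np] := eqVneq n 0%R.
    have [||k _ [_]] := hq ((1 + p') / 2)%R; [lra|lra|].
    by rewrite n00 !mule0.
  have {}np : (0 < n)%R by rewrite lt_def np.
  have w0 : (0 < 16 * Z * n)%R by rewrite !mulr_gt0.
  rewrite (muleAC _ (interp_phi r p) Z%:E) (muleAC _ (interp_phi r p) n%:E) -!EFinM.
  rewrite -lee_pdivrMl//; apply: le_ereal_inf_tmp => _ [q [q1 qp] <-].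
  rewrite pE lte_fin in qp; have [k k0 [-> yk]] := hq q q1 qp.
  rewrite lee_pdivrMl//; apply: (le_trans yk); rewrite -!EFinM lee_fin.
  rewrite [leRHS]mulrAC; apply: ler_wpM2r => //.
  exact: ler_wpM2r.
have direct : p = r -> Lp_norm mu p (T f) <= 16%:E * interp_phi r p * Z%:E * Lp_norm mu p f.
  move=> pr; have := T_bound f cf; rewrite -{1 2}pr => /le_trans; apply.
  apply: lee_wpmul2r => //; apply: (@le_trans _ _ (16 * Z)%:E).
    by rewrite lee_fin; rewrite /Z; move: (D ^+ 5 * A)%R (D ^+ 9 * A)%R D59 D5A => u v uv Au; lra.
  rewrite muleAC -EFinM -[leLHS]mule1; apply: lee_wpmul2l => //.
  by rewrite lee_fin mulr_ge0// ltW.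
have k0 b (p' q s : R) : (0 <= interp_const b q s `^ phi_exponent b p' q s)%R by exact: powR_ge0.
have [[p' pE]|pE] : (exists p' : R, p = p'%:E) \/ p = +oo.
  by case: (p) p_gt1 => [p'||//]; [left; exists p'|right].
- have [[s rE]|rE] : (exists s : R, r = s%:E) \/ r = +oo.
    by case: (r) r_gt1 => [s||//]; [left; exists s|right].
  + have [ps|ps] := ltP p' s; last first.
      by apply: direct; apply/eqP; rewrite eq_le p_le_r rE pE lee_fin.
    apply: (inf_step p' pE) => q q1 qp.
    exists (interp_const true q s `^ phi_exponent true p' q s)%R => //.
    split; last by rewrite pE; exact: strong.
    by rewrite pE rE; exact: (phi_elementE true q1 qp (ltW ps)).
  + apply: (inf_step p' pE) => q q1 qp.
    (* For infinite [r] the parameter [s] is a placeholder, subject only to [p' < s]. *)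
    have pp : (p' < p' + 1)%R by rewrite ltrDl.
    exists (interp_const false q (p' + 1) `^ phi_exponent false p' q (p' + 1))%R => //.
    split; last by rewrite pE; exact: strong.
    by rewrite pE rE; exact: (phi_elementE false q1 qp (ltW pp)).
- by apply: direct; apply/eqP; rewrite eq_le p_le_r pE leey.
Qed.
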